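(* Let $\mathfrak g$ be a unimodular real Lie algebra of dimension $n$ (that is, $\mathrm{trace}(\mathrm{ad}_\xi)=0$ for all $\xi\in\mathfrak g$). Suppose that $\langle\,,\rangle$ is a scalar product on $\mathfrak g$ and consider on the unit sphere $S^{n-1}(\mathfrak g)$ the induced Jacobi structure. Then $S^{n-1}(\mathfrak g)$ is a unimodular Jacobi manifold. Thus, $$H^{LJ}_k(S^{n-1}(\mathfrak g))\cong H_{LJ}^{n-k}(S^{n-1}(\mathfrak g))\quad\text{for all }k.$$
   Context: $\mathcal V^k(M)$ and $\Omega^k(M)$ denote the spaces of $k$-vectors and $k$-forms on a manifold $M$ (zero for $k<0$). $[\,,\,]$ is the Schouten-Nijenhuis bracket, with the convention $[X,f]=X(f)$ for functions $f$, $[X,P]=\mathcal L_XP$ for vector fields $X$, $[P,Q]=(-1)^{pq}[Q,P]$ and $[P,Q\wedge R]=[P,Q]\wedge R+(-1)^{pq+q}Q\wedge[P,R]$ for $P\in\mathcal V^p(M)$, $Q\in\mathcal V^q(M)$. A Jacobi structure on $M$ is a pair $(\Lambda,E)$ with $\Lambda\in\mathcal V^2(M)$ and $E$ a vector field such that $[\Lambda,\Lambda]=2E\wedge\Lambda$ and $[E,\Lambda]=0$. For a 1-form $\alpha$, $\#_\Lambda(\alpha)$ is the vector field with $\beta(\#_\Lambda(\alpha))=\Lambda(\alpha,\beta)$. The LJ-cohomology $H^*_{LJ}(M)$ is the cohomology of $(\mathcal V^*(M)\oplus\mathcal V^{*-1}(M),\sigma)$, where for $(P,Q)\in\mathcal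 V^k(M)\oplus\mathcal V^{k-1}(M)$ $$\sigma(P,Q)=\big(-[\Lambda,P]+kE\wedge P+\Lambda\wedge Q,\ [\Lambda,Q]-(k-1)E\wedge Q+[E,P]\big).$$ The LJ-homology $H_*^{LJ}(M)$ is the homology of $(\Omega^*(M)\oplus\Omega^{*-1}(M),\delta)$, where for $(\alpha,\beta)\in\Omega^k(M)\oplus\Omega^{k-1}(M)$ $$\delta(\alpha,\beta)=\big(i(\Lambda)d\alpha-d\,i(\Lambda)\alpha+k\,i_E\alpha+(-1)^k\mathcal L_E\beta,\ i(\Lambda)d\beta-d\,i(\Lambda)\beta+(k-1)i_E\beta+(-1)^ki(\Lambda)\alpha\big),$$ with $i(X\wedge Y)\alpha=\alpha(X,Y,\cdot,\dots,\cdot)$. Modular class: let $(M,\Lambda,E)$ be an orientable Jacobi manifold of dimension $d$ and $\nu$ a volume form. Let $\mathcal X^\nu_{(\Lambda,E)}$ be the vector field with $\mathcal L_{\#_\Lambda(df)}\nu=\mathcal X^\nu_{(\Lambda,E)}(f)\,\nu$ for all $f\in C^\infty(M,\mathbb R)$, and let $\mathcal L_E\nu=(\mathrm{div}_\nu E)\nu$. The pair $\mathcal M^\nu_{(\Lambda,E)}=(\mathcal X^\nu_{(\Lambda,E)}-d\,E,\ \mathrm{div}_\nu E)$ is a 1-cocycle for $\sigma$, whose class in $H^1_{LJ}(M)$ does not depend on $\nu$ and is called the Jacobi modular class. $M$ is a unimodular Jacobi manifold if this class is zero. Induced Jacobi structure on the unit sphere: the Lie-Poisson bracket on $\mathfrak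 g^*$ is $\{f,g\}(x)=x([df(x),dg(x)])$ (with $df(x),dg(x)\in(\mathfrak g^* )^*\cong\mathfrak g$). Transport its Poisson 2-vector to $\mathfrak g$ by the linear isomorphism $\mathfrak g\to\mathfrak g^*$, $\xi\mapsto\langle\xi,\cdot\rangle$, obtaining a Poisson 2-vector $\bar\Lambda$ on $\mathfrak g$. Let $A$ be the radial (Euler) vector field on $\mathfrak g$ and $\alpha=\tfrac12d(\|\cdot\|^2)$. Put $E'=i_\alpha\bar\Lambda=\bar\Lambda(\alpha,\cdot)$ and $\Lambda'=\bar\Lambda-A\wedge i_\alpha\bar\Lambda$. The restrictions $\Lambda$, $E$ of $\Lambda'$, $E'$ to the unit sphere $S^{n-1}(\mathfrak g)=\{\xi\in\mathfrak g:\|\xi\|=1\}$ are tangent to it, and $(\Lambda,E)$ is the induced Jacobi structure on $S^{n-1}(\mathfrak g)$. *)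

(* Defs.v *)
From HB Require Import structures.
From mathcomp Require Import all_boot all_order all_algebra.
From mathcomp Require Import sesquilinear.
From mathcomp Require Import all_classical all_reals all_analysis.
Import Order.TTheory GRing.Theory Num.Theory.
Import numFieldNormedType.Exports.

Set Implicit Arguments.
Unset Strict Implicit.
Unset Printing Implicit Defensive.

Local Open Scope classical_set_scope.
Local Open Scope ring_scope.

(* Graded alternating algebra.  A (possibly inhomogeneous) multilinear form on
   V is a function [seq V -> R^o] of the sequence of its arguments; a form of
   degree k is one that vanishes on sequences of length other than k.  So all
   degrees live in one type, and the only form of degree k < 0 is 0.
   A k-vector of a space g is an alternating form of degree k on the dual of g,
   with the convention (X /\ Y)(a, b) = a X * b Y - a Y * b X. *)

Section Alternating.
Context {R : realType}.

Definition altform (V : lmodType R) (k : int) (a : seq V -> R^o) : Prop :=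
  [/\ forall u, (size u)%:Z != k -> a u = 0,
      forall u v (c : R) x y,
        a (u ++ (c *: x + y) :: v) = c *: a (u ++ x :: v) + a (u ++ y :: v)
    & forall u v w x, a (u ++ x :: v ++ x :: w) = 0].

Context {V : Type}.

(* The number of inversions of the shuffle that moves the entries selected by
   m in front of the others. *)
Definition shuffle_inv (m : seq bool) : nat :=
  (\sum_(i < size m | nth false m i) count negb (take i m))%N.

Definition shuffle_sum (F : seq V -> seq V -> R) (u : seq V) : R^o :=
  \sum_(m : (size u).-tuple bool)
    (-1) ^+ shuffle_inv m * F (mask m u) (mask (map negb m) u).

Definition wedge (a b : seq V -> R^o) : seq V -> R^o :=
  shuffle_sum (fun v w => a v * b w).

Definition contract (v : V) (a : seq V -> R^o) : seq V -> R^o :=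
  fun u => a (v :: u).

End Alternating.

Section VectorSpace.
Context {R : realType} {g : vectType R}.

Definition covector := 'Hom(g, R^o).

Definition bvec (i : 'I_(\dim {:g})) : g := (vbasis {:g})`_i.
Definition bcov (i : 'I_(\dim {:g})) : covector :=
  linfun (coord (vbasis {:g}) i : g -> R^o).

Definition vec1 (x : g) : seq covector -> R^o :=
  fun u => if u is [:: p] then p x else 0.

Definition vec_of (a : seq covector -> R^o) : g :=
  \sum_i a [:: bcov i] *: bvec i.

(* #_a(p), so that q (bisharp a p) = a(p, q). *)
Definition bisharp (a : seq covector -> R^o) (p : covector) : g :=
  vec_of (contract p a).

(* i(a) for a 2-vector a = 1/2 * \sum_(i, j) a(e^i, e^j) e_i /\ e_j, extended
   linearly from i(X /\ Y)w = w(X, Y, ...). *)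
Definition icontract (a : seq covector -> R^o) (w : seq g -> R^o) :
    seq g -> R^o :=
  fun u => 2^-1 * \sum_i \sum_j
    a [:: bcov i; bcov j] * w [:: bvec i, bvec j & u].

Definition ddir (v : g) (f : g -> R) : g -> R :=
  fun x => derive1 (fun t : R => f (x + t *: v)) 0.

Definition ddirs (vs : seq g) (f : g -> R) : g -> R := foldr ddir f vs.

(* f is C^oo on the open set U: all its iterated directional derivatives exist
   and are continuous on U, for the topology of g given by coordinates. *)
Definition smooth_on (U : set g) (f : g -> R) : Prop :=
  forall (vs : seq g) (x : g), U x ->
    (forall v, derivable (fun t : R => ddirs vs f (x + t *: v)) 0 1) /\
    {for passmx.rVof (vbasis {:g}) x,
      continuous (ddirs vs f \o passmx.vecof (vbasis {:g}))}.

Definition dfun (f : g -> R) (x : g) : covector :=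
  linfun (fun v => ddir v f x : R^o).

Definition ddirv (v : g) (X : g -> g) (x : g) : g :=
  \sum_i ddir v (fun y => bcov i (X y)) x *: bvec i.

(* Tensor fields on the flat space g (or on an open subset of it). *)

Definition ext_d (w : g -> seq g -> R^o) : g -> seq g -> R^o :=
  fun x u => \sum_(i < size u)
    (-1) ^+ i * ddir u`_i (fun y => w y (take i u ++ drop i.+1 u)) x.

Definition lie_form (X : g -> g) (w : g -> seq g -> R^o) :
    g -> seq g -> R^o :=
  fun x u => ddir (X x) (fun y => w y u) x +
    \sum_(i < size u) w x (set_nth 0 u i (ddirv u`_i X x)).

(* The Schouten-Nijenhuis bracket with the sign convention
     [P, Q] = \sum_i (i_{e^i} P /\ d_i Q + (-1)^p d_i P /\ i_{e^i} Q)
   in linear coordinates, for P of degree p.  It satisfies [X, f] = X(f),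
   [X, P] = L_X P, [P, Q] = (-1)^(p q) [Q, P] and
   [P, Q /\ R] = [P, Q] /\ R + (-1)^(p q + q) Q /\ [P, R].
   The degree p is read off as the number of arguments given to P. *)
Definition schouten (P Q : g -> seq covector -> R^o) :
    g -> seq covector -> R^o :=
  fun x => shuffle_sum (fun v w =>
    P x (dfun (fun y => Q y w) x :: v) +
    (-1) ^+ size v * Q x (dfun (fun y => P y v) x :: w)).

End VectorSpace.

Arguments covector {R} g.

Section Sphere.
Context {R : realType} {g : vectType R} (dot : {dot g for idfun}).

Definition sphere := {x : g | dot x x == 1}.

Definition radial_ext (T : zmodType) (F : sphere -> T) : g -> T :=
  fun x => if (insub ((Num.sqrt (dot x x))^-1 *: x) : option sphere)
           is Some s then F s else 0.

(* Smoothness on the embedded submanifold S; the radial retraction of g \ {0}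
   on S is smooth, so f is smooth iff its radial extension is. *)
Definition smooth (f : sphere -> R) : Prop :=
  smooth_on [set x | x != 0] (radial_ext f).

(* A k-vector on S takes its values in the exterior powers of the tangent
   spaces T_sS = {v | dot s v = 0}, contained in those of g, i.e. it vanishes
   as soon as one argument is conormal to S.
   A k-form on S is represented, pointwise, by the k-form on g that extends
   it by 0 on the normal line spanned by s. *)

Definition mvfield := sphere -> seq (covector g) -> R^o.
Definition dfield := sphere -> seq g -> R^o.

Definition kvector (k : int) (P : mvfield) : Prop :=
  [/\ forall s, altform k (P s),
      forall s (p : covector g) u,
        (forall v, dot (val s) v = 0 -> p v = 0) -> P s (p :: u) = 0
    & forall u, smooth (fun s => P s u)].

Definition kform (k : int) (w : dfield) : Prop :=
  [/\ forall s, altform k (w s),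
      forall s u, w s (val s :: u) = 0
    & forall u, smooth (fun s => w s u)].

(* The operations on S are those of g applied to the radial extensions, which
   are tangent to all spheres centred at 0; forms are pulled back to S. *)

Definition tproj (s : sphere) (v : g) : g := v - dot (val s) v *: val s.

Definition pullback (w : g -> seq g -> R^o) : dfield :=
  fun s u => w (val s) (map (tproj s) u).

Definition sdfun (f : sphere -> R) (s : sphere) : covector g :=
  dfun (radial_ext f) (val s).

Definition sd (w : dfield) : dfield := pullback (ext_d (radial_ext w)).

Definition slie (X : sphere -> g) (w : dfield) : dfield :=
  pullback (lie_form (radial_ext X) (radial_ext w)).

Definition sbracket (P Q : mvfield) : mvfield :=
  fun s => schouten (radial_ext P) (radial_ext Q) (val s).

Definition swedge (P Q : mvfield) : mvfield := fun s => wedge (P s) (Q s).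

Section Jacobi.
Context (L E : mvfield).

Definition jacobi_structure : Prop :=
  [/\ kvector 2 L, kvector 1 E,
      sbracket L L = swedge E L *+ 2 & sbracket E L = 0].

Definition evec (s : sphere) : g := vec_of (E s).
Definition iE (w : dfield) : dfield := fun s => contract (evec s) (w s).
Definition iL (w : dfield) : dfield := fun s => icontract (L s) (w s).

Definition LJ_sigma (k : int) (c : mvfield * mvfield) : mvfield * mvfield :=
  let: (P, Q) := c in
  (- sbracket L P + swedge E P *~ k + swedge L Q,
   sbracket L Q - swedge E Q *~ (k - 1) + sbracket E P).

Definition LJ_cochain (k : int) : set (mvfield * mvfield) :=
  [set c | kvector k c.1 /\ kvector (k - 1) c.2].

Definition LJ_cocycle (k : int) : set (mvfield * mvfield) :=
  [set c | LJ_cochain k c /\ LJ_sigma k c = 0].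

Definition LJ_coboundary (k : int) : set (mvfield * mvfield) :=
  LJ_sigma (k - 1) @` LJ_cochain (k - 1).

Definition LJ_delta (k : int) (c : dfield * dfield) : dfield * dfield :=
  let: (a, b) := c in
  (iL (sd a) - sd (iL a) + iE a *~ k + slie evec b *~ (-1) ^ k,
   iL (sd b) - sd (iL b) + iE b *~ (k - 1) + iL a *~ (-1) ^ k).

Definition LJ_chain (k : int) : set (dfield * dfield) :=
  [set c | kform k c.1 /\ kform (k - 1) c.2].

Definition LJ_cycle (k : int) : set (dfield * dfield) :=
  [set c | LJ_chain k c /\ LJ_delta k c = 0].

Definition LJ_boundary (k : int) : set (dfield * dfield) :=
  LJ_delta (k + 1) @` LJ_chain (k + 1).

Definition volume_form (d : int) (nu : dfield) : Prop :=
  kform d nu /\ forall s, exists u, nu s u != 0.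

Definition modular_field (nu : dfield) (X : mvfield) : Prop :=
  kvector 1 X /\
  forall f : sphere -> R, smooth f ->
    slie (fun s => bisharp (L s) (sdfun f s)) nu =
    fun s u => X s [:: sdfun f s] * nu s u.

Definition divergence_E (nu : dfield) (h : mvfield) : Prop :=
  kvector 0 h /\ slie evec nu = fun s u => h s [::] * nu s u.

(* d is the dimension of the manifold.  The modular field X and the divergence
   h of a given volume form are unique; the modular class is the class of
   (X - d E, h). *)
Definition unimodular_jacobi (d : int) : Prop :=
  [/\ jacobi_structure,
      exists nu, volume_form d nu
    & forall nu, volume_form d nu ->
        exists X h, [/\ modular_field nu X, divergence_E nu h
                      & LJ_coboundary 1 (X - E *~ d, h)]].

End Jacobi.
End Sphere.

Arguments mvfield {R g} dot.
Arguments dfield {R g} dot.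

Section Subquotient.
Context {R : realType}.

Definition coset (V : lmodType R) (B : set V) (z : V) : set V :=
  [set w | B (w - z)].

(* The quotient Z / B, as a set of cosets. *)
Definition subquotient (V : lmodType R) (Z B : set V) : set (set V) :=
  coset B @` Z.

Definition linear_iso (V W : lmodType R) (Z B : set V) (Z' B' : set W) : Prop :=
  exists phi : set V -> set W,
    set_bij (subquotient Z B) (subquotient Z' B') phi /\
    forall (a : R) x y x' y', Z x -> Z y -> Z' x' -> Z' y' ->
      phi (coset B x) = coset B' x' -> phi (coset B y) = coset B' y' ->
      phi (coset B (a *: x + y)) = coset B' (a *: x' + y').

End Subquotient.

Section LiePoisson.
Context {R : realType} {g : vectType R}.

Definition lie_bracket (br : {bilinear g -> g -> g}) : Prop :=
  (forall x, br x x = 0) /\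
  (forall x y z, br x (br y z) + br y (br z x) + br z (br x y) = 0).

Definition unimodular_lie (br : {bilinear g -> g -> g}) : Prop :=
  forall x, \tr (passmx.mxof (vbasis {:g}) (vbasis {:g}) (linfun (br x))) = 0.

Context (br : {bilinear g -> g -> g}) (dot : {dot g for idfun}).

Definition flat : 'Hom(g, covector g) :=
  linfun (fun x => linfun (fun v => dot x v : R^o) : covector g).

(* The covector p on g is the pullback by [flat] of evaluation at [dsharp p],
   a covector on the dual of g: p v = flat v (dsharp p). *)
Definition dsharp (p : covector g) : g := (flat^-1)%VF p.

(* The Lie-Poisson 2-vector of the dual of g at mu, on (g^* )^* = g. *)
Definition lie_poisson (mu : covector g) (a b : g) : R := mu (br a b).

Definition barL (x : g) : seq (covector g) -> R^o :=
  fun u => if u is [:: p; q] then lie_poisson (flat x) (dsharp p) (dsharp q)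
           else 0.

Definition alpha : g -> covector g := dfun (fun x => 2^-1 * dot x x).

Definition E' (x : g) : seq (covector g) -> R^o := contract (alpha x) (barL x).

Definition L' (x : g) : seq (covector g) -> R^o :=
  barL x - wedge (vec1 x) (E' x).

Definition sphere_E : mvfield dot := fun s => E' (val s).
Definition sphere_L : mvfield dot := fun s => L' (val s).

End LiePoisson.

Arguments sphere_E {R g} br dot.
Arguments sphere_L {R g} br dot.

(* Main.v *)
(* Let s be the position vector, mu a volume form of g and nu = i_s mu the
   induced volume form of the sphere.  Contraction of mu with a multivector P is
   a Fourier transform of exterior algebras: it exchanges exterior
   multiplication and contraction.  Hence P |-> i_P nu is a bijection from
   tangent multivectors to forms, it turns d into the divergence operator
   div P = sum_i i(e^i) D_i P, and i(Lambda) d - d i(Lambda) into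
   [Lambda, P] + (div Lambda) /\ P up to sign, because the Schouten bracket
   measures the failure of the divergence to be a derivation.  When the modular
   pair of nu vanishes, (P, Q) |-> (i_Q nu, +-i_P nu) therefore intertwines sigma
   and delta up to sign, which gives the duality.

   For the induced structure on the sphere, with g unimodular, the modular pair
   of the standard nu is exactly 0: this is a trace computation in a basis of g
   and its reciprocal basis.  Another volume form f nu changes the pair by the
   coboundary of ln |f|. *)

Require Import Defs.
From HB Require Import structures.
From mathcomp Require Import all_boot all_order all_algebra.
From mathcomp Require Import sesquilinear.
From mathcomp Require Import all_classical all_reals all_analysis.
From mathcomp Require Import ring lra zify.
Import Order.TTheory GRing.Theory Num.Theory.
Import numFieldNormedType.Exports.
(* [contract] also names a constant of mathcomp-analysis. *)
Import Defs.

Set Implicit Arguments.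
Unset Strict Implicit.
Unset Printing Implicit Defensive.

Local Open Scope classical_set_scope.
Local Open Scope ring_scope.

(** * Exterior algebra *)

(** A sphere has no global frame in general, so all tensors are expanded in the fixed basis of g and
    differentiated along constant vectors, through radial extensions. The price is twofold: such
    derivatives do not commute after restriction ([sderC]), and the derivative of a tangent field is
    no longer tangent ([fder_csP]). Each correction term has to cancel, against the tangency of
    another field or against a symmetric tensor. Tangency is handled by two operators, [es] (wedge
    with s) and [cs] (contraction with the covector dual to s), whose anticommutator is the
    identity. As nu = i_s mu, contracting nu with P amounts, up to sign, to transforming s /\ P by
    mu; so only the transform of g, which has constant coefficients and commutes with derivatives,
    has to be inverted. With d = n - 1 the dimension of the sphere, the duality rests on div Lambda
    = - d E and div E = 0. The first identity is what converts the coefficient k of i_E in delta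
    into the coefficient of E in sigma at the complementary degree n - k. *)

Lemma scale_regE (R : realType) (c x : R) : c *: (x : R^o) = c * x.
Proof. by []. Qed.

Section Multilinear.
Context {R : realType} {V : lmodType R}.
Implicit Types (a : seq V -> R^o) (p q : V -> R) (u : seq V) (x y : V).

(** Wedge product with the covector [p] on the left: the rule i_x(p /\ a) = p(x) a - p /\ i_x a read
    as a recursion on the arguments, so that [contract_ext] holds by computation. [p] is a bare
    function, so that vectors acting on covectors fit as well. *)
Fixpoint ext p a u : R^o :=
  if u is x :: u' then p x * a u' - ext p (contract x a) u' else 0.

Lemma contract_is_linear x : linear (contract x : (seq V -> R^o) -> seq V -> R^o).
Proof. by []. Qed.
HB.instance Definition _ x :=
  GRing.isLinear.Build R (seq V -> R^o) (seq V -> R^o) *:%R (contract x)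
    (contract_is_linear x).

Lemma ext_is_linear p : linear (ext p).
Proof.
move=> c a b; apply/funext => u; elim: u a b => [|x u IHu] a b.
  by rewrite ?fctE scale_regE mulr0 addr0.
rewrite ?fctE /= linearP IHu ?fctE !scale_regE; ring.
Qed.
HB.instance Definition _ p :=
  GRing.isLinear.Build R (seq V -> R^o) (seq V -> R^o) *:%R (ext p)
    (ext_is_linear p).

Lemma contract_ext x p a :
  contract x (ext p a) = p x *: a - ext p (contract x a).
Proof. by []. Qed.

Lemma contractD x a b : contract x (a + b) = contract x a + contract x b.
Proof. by []. Qed.
Lemma contractN x a : contract x (- a) = - contract x a.
Proof. by []. Qed.
Lemma contractB x a b : contract x (a - b) = contract x a - contract x b.
Proof. by []. Qed.
Lemma contractZ x (k : R) a : contract x (k *: a) = k *: contract x a.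
Proof. by []. Qed.
Lemma contract0 x : contract x (0 : seq V -> R^o) = 0.
Proof. by []. Qed.
Lemma contract_sum x (I : finType) (a : I -> seq V -> R^o) :
  contract x (\sum_i a i) = \sum_i contract x (a i).
Proof. exact: linear_sum. Qed.
Lemma extD p a b : ext p (a + b) = ext p a + ext p b.
Proof. exact: linearD. Qed.
Lemma extN p a : ext p (- a) = - ext p a.
Proof. exact: linearN. Qed.
Lemma extB p a b : ext p (a - b) = ext p a - ext p b.
Proof. exact: linearB. Qed.
Lemma extZ p (k : R) a : ext p (k *: a) = k *: ext p a.
Proof. exact: linearZ. Qed.
Lemma ext0 p : ext p 0 = 0.
Proof. exact: linear0. Qed.
Lemma ext_sum p (I : finType) (a : I -> seq V -> R^o) :
  ext p (\sum_i a i) = \sum_i ext p (a i).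
Proof. exact: linear_sum. Qed.

Lemma ext_eqp p q a : p =1 q -> ext p a = ext q a.
Proof. by move=> /funext ->. Qed.

Lemma ext_linl (c : R) p q a :
  ext (fun x => c * p x + q x) a = c *: ext p a + ext q a.
Proof.
apply/funext => u; elim: u a => [|x u IHu] a; rewrite ?fctE !scale_regE /=.
  by rewrite mulr0 addr0.
by rewrite IHu ?fctE !scale_regE; ring.
Qed.

Lemma ext0l a : ext (fun=> 0) a = 0.
Proof.
apply/funext => u; elim: u a => [|x u IHu] a //=.
by rewrite IHu mul0r subr0.
Qed.

Lemma ext_suml (I : finType) (c : I -> R) (p : I -> V -> R) a :
  ext (fun x => \sum_i c i * p i x) a = \sum_i c i *: ext (p i) a.
Proof.
elim: (index_enum I) => [|i r IHr].
  by rewrite big_nil -[RHS](ext0l a); apply: ext_eqp => x; rewrite big_nil.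
rewrite big_cons -IHr -ext_linl; apply: ext_eqp => x.
by rewrite big_cons.
Qed.

Lemma extC p q a : ext p (ext q a) = - ext q (ext p a).
Proof.
apply/funext => u; elim: u a => [|x u IHu] a; first by rewrite ?fctE /= oppr0.
rewrite ?fctE /= !contract_ext !linearB !linearZ /= ?fctE IHu ?fctE.
rewrite !scale_regE; ring.
Qed.

Lemma extxx p a : ext p (ext p a) = 0.
Proof.
apply/funext => u; have := congr1 (@^~ u) (extC p p a).
by rewrite ?fctE; set t : R^o := ext _ _ _ => h; have : (t : R) = 0 by lra.
Qed.

Lemma ext_local p a b u :
  (forall v, (size v).+1 = size u -> a v = b v) -> ext p a u = ext p b u.
Proof.
elim: u a b => [|x u IHu] a b //= eqab; rewrite eqab //.
by congr (_ - _); apply: IHu => v sz_v; apply: eqab => /=; rewrite sz_v.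
Qed.

Definition multilinear a := forall u v (c : R) x y,
  a (u ++ (c *: x + y) :: v) = c * a (u ++ x :: v) + a (u ++ y :: v).
(** Asking for adjacent repetitions only makes the condition stable under [contract] and [ext] by
    induction on the prefix; [altform_Alt] recovers arbitrary repetitions. *)
Definition alternating a := forall u v x, a (u ++ x :: x :: v) = 0.
Definition Alt a := multilinear a /\ alternating a.
Definition linp p := forall (c : R) x y, p (c *: x + y) = c * p x + p y.

Lemma Alt0 : Alt 0.
Proof. by split=> [u v c x y|u v x] //; rewrite ?fctE mulr0 addr0. Qed.

Lemma AltP a b (c : R) : Alt a -> Alt b -> Alt (c *: a + b).
Proof.
move=> [aL aA] [bL bA]; split=> [u v d x y|u v x]; rewrite ?fctE !scale_regE /=.
  by rewrite aL bL; ring.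
by rewrite aA bA mulr0 addr0.
Qed.

Lemma AltD a b : Alt a -> Alt b -> Alt (a + b).
Proof. by move=> aA bA; rewrite -[a]scale1r; apply: AltP. Qed.

Lemma AltZ (c : R) a : Alt a -> Alt (c *: a).
Proof. by move=> aA; rewrite -[_ *: _]addr0; apply: AltP => //; apply: Alt0. Qed.

Lemma AltN a : Alt a -> Alt (- a).
Proof. by move=> aA; rewrite -scaleN1r; apply: AltZ. Qed.

Lemma AltB a b : Alt a -> Alt b -> Alt (a - b).
Proof. by move=> aA bA; apply: AltD => //; apply: AltN. Qed.

Lemma Alt_sum (I : finType) (a : I -> seq V -> R^o) :
  (forall i, Alt (a i)) -> Alt (\sum_i a i).
Proof. by move=> aA; elim/big_ind: _ => //; [apply: Alt0 | apply: AltD]. Qed.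

Lemma Alt_contract x a : Alt a -> Alt (contract x a).
Proof.
move=> [aL aA]; split=> [u v c y z|u v y].
  exact: (aL (x :: u)).
exact: (aA (x :: u)).
Qed.

Lemma contractxx x a : Alt a -> contract x (contract x a) = 0.
Proof. by move=> [_ aA]; apply/funext => u; apply: (aA [::]). Qed.

Lemma contract_linl (c : R) x y a : Alt a ->
  contract (c *: x + y) a = c *: contract x a + contract y a.
Proof. by move=> [aL _]; apply/funext => u; apply: (aL [::]). Qed.

Lemma contract0l a : Alt a -> contract 0 a = 0.
Proof.
move=> aA; have := contract_linl 1 0 0 aA; rewrite !scale1r add0r => /eqP.
by rewrite -subr_eq0 opprD addNKr oppr_eq0 => /eqP.
Qed.

Lemma contractDl x y a : Alt a ->
  contract (x + y) a = contract x a + contract y a.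
Proof. by move=> aA; rewrite -[x]scale1r contract_linl // !scale1r. Qed.

Lemma contractZl (c : R) x a : Alt a -> contract (c *: x) a = c *: contract x a.
Proof.
by move=> aA; rewrite -[c *: x]addr0 contract_linl // contract0l // addr0.
Qed.

Lemma contract_suml (I : finType) (x : I -> V) a : Alt a ->
  contract (\sum_i x i) a = \sum_i contract (x i) a.
Proof.
move=> aA; elim: (index_enum I) => [|i r IHr]; first by rewrite !big_nil contract0l.
by rewrite !big_cons contractDl // IHr.
Qed.

(** Polarisation of [contractxx] at [x + y]. *)
Lemma contractC x y a : Alt a ->
  contract x (contract y a) = - contract y (contract x a).
Proof.
move=> aA; apply/eqP; rewrite -addr_eq0; apply/eqP.
have := contractxx (x + y) aA.
rewrite contractDl; last exact: Alt_contract.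
rewrite !contractDl // !linearD /= !contractxx // add0r addr0 => h.
exact: h.
Qed.

Lemma Alt_ext p a : linp p -> Alt a -> Alt (ext p a).
Proof.
move=> pL aA; split=> u; elim: u a aA => [|y u IHu] a aA v.
- move=> c x y /=; rewrite pL contract_linl // linearP /= ?fctE.
  by rewrite !scale_regE; ring.
- move=> c x z /=; rewrite IHu; last exact: Alt_contract.
  by rewrite (aA.1 u); ring.
- by move=> x /=; rewrite contractxx // linear0 subr0 subrr.
- by move=> x /=; rewrite IHu ?(aA.2 u) ?mulr0 ?subr0 //; apply: Alt_contract.
Qed.

Lemma altform_Alt (k : int) a :
  altform k a <-> (forall u, (size u)%:Z != k -> a u = 0) /\ Alt a.
Proof.
split=> [[ak aL aA]|[ak aA]].
  by split=> //; split=> // u v x; apply: (aA u [::]).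
split=> // [u v c x y|u]; first exact: aA.1.
elim: u a aA {ak} => [|y u IHu] a aA; last first.
  by move=> v w x; apply: (IHu (contract y a)); apply: Alt_contract.
move=> v; elim: v a aA => [|y v IHv] a aA w x; first exact: (aA.2 [::]).
have /(congr1 (@^~ (v ++ x :: w))) := contractC y x aA.
rewrite /contract !fctE /= => ->; apply/eqP; rewrite oppr_eq0; apply/eqP.
exact: (IHv (contract y a) (Alt_contract y aA)).
Qed.

Definition one u : R^o := if u is [::] then 1 else 0.

Lemma contract_one x : contract x one = 0. Proof. by []. Qed.

Lemma Alt_one : Alt one.
Proof. by split=> [[|z u]|[|z u]] * //=; rewrite mulr0 addr0. Qed.

End Multilinear.

(** * Fourier transform of the exterior algebra *)

Section Hodge.
Context {R : realType} {V W : lmodType R} {n : nat}.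
Variables (pr : W -> V -> R) (b : 'I_n -> V) (c : 'I_n -> W).
Variable mu : seq V -> R^o.
Hypothesis prL : forall w, linp (pr w).
Hypothesis prbc : forall x, x = \sum_i pr (c i) x *: b i.
Hypothesis prcb : forall w, w = \sum_i pr w (b i) *: c i.
Hypothesis mu_size : forall u, size u != n -> mu u = 0.
Hypothesis mu_Alt : Alt mu.
Hypothesis mu_top : forall w, ext (pr w) mu = 0.
Implicit Types (P : seq W -> R^o) (u : seq V).

(* [star m P] is the contraction of [mu] with [P] of degree [m], in the order of
   contractions for which [star] exchanges [ext] and [contract] without signs. *)
Fixpoint star m P : seq V -> R^o :=
  if m is m'.+1 then
    m%:R^-1 *: \sum_i contract (b i) (star m' (contract (c i) P))
  else P [::] *: mu.

Lemma starS m P : star m.+1 P =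
  m.+1%:R^-1 *: \sum_i contract (b i) (star m (contract (c i) P)).
Proof. by []. Qed.

Lemma star_is_linear m : linear (star m).
Proof.
elim: m => [|m IHm] k P Q /=.
  have -> : (k *: P + Q) [::] = k * P [::] + Q [::] :> R by [].
  by rewrite scalerDl scalerA.
under eq_bigr => i _ do rewrite linearP IHm linearP.
rewrite big_split /= -scaler_sumr scalerDr !scalerA.
by rewrite [k * _]mulrC.
Qed.
HB.instance Definition _ m :=
  GRing.isLinear.Build R (seq W -> R^o) (seq V -> R^o) *:%R (star m)
    (star_is_linear m).

Lemma starB m P Q : star m (P - Q) = star m P - star m Q.
Proof. exact: linearB. Qed.
Lemma starN m P : star m (- P) = - star m P.
Proof. exact: linearN. Qed.
Lemma starZ m k P : star m (k *: P) = k *: star m P.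
Proof. exact: linearZ. Qed.

Lemma star_sum m (I : finType) (P : I -> seq W -> R^o) :
  star m (\sum_i P i) = \sum_i star m (P i).
Proof. exact: linear_sum. Qed.

Lemma Alt_star m P : Alt (star m P).
Proof.
elim: m P => [|m IHm] P /=; first exact: AltZ.
by apply: AltZ; apply: Alt_sum => i; apply: Alt_contract.
Qed.

Lemma star_size m P u : (size u + m)%N != n -> star m P u = 0.
Proof.
elim: m P u => [|m IHm] P u /= sz_u.
  by rewrite !fctE mu_size ?scaler0 // -(addn0 (size u)).
rewrite !fctE fct_sumE big1 ?scaler0 // => i _.
by rewrite /contract IHm //= addSnnS.
Qed.

Lemma star_degree m P u : (forall v, size v = m -> P v = 0) -> star m P u = 0.
Proof.
elim: m P u => [|m IHm] P u P0 /=.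
  by rewrite P0 // scale0r.
rewrite !fctE fct_sumE big1 ?scaler0 // => i _.
by rewrite /contract IHm //= => v sz_v; rewrite P0 //= sz_v.
Qed.

Lemma star0 P : star 0 P = P [::] *: mu.
Proof. by []. Qed.
#[local] Opaque star.

Lemma contract_basis x (a : seq V -> R^o) : Alt a ->
  contract x a = \sum_i pr (c i) x *: contract (b i) a.
Proof.
move=> aA; rewrite {1}(prbc x) contract_suml //.
by apply: eq_bigr => i _; rewrite contractZl.
Qed.

Lemma contract_cobasis w P : Alt P ->
  contract w P = \sum_i pr w (b i) *: contract (c i) P.
Proof.
move=> PA; rewrite {1}(prcb w) contract_suml //.
by apply: eq_bigr => i _; rewrite contractZl.
Qed.

(** In the inductive step the scalar terms [pr (c i) x] add up to one copy of the right-hand side,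
    and the remaining sum gives [m.+1] copies of it by the induction hypothesis; the factor
    [m.+2%:R^-1] in [star] normalises the total to one. *)
Lemma star_ext m x P : Alt P ->
  star m.+1 (ext (pr^~ x) P) = contract x (star m P).
Proof.
elim: m P => [|m IHm] P PA.
  rewrite starS invr1 scale1r contract_basis; last exact: AltZ.
  apply: eq_bigr => i _; apply/funext => u.
  rewrite /contract !star0 /= !fctE subr0.
  by symmetry; apply: mulrA.
have PA' i : Alt (contract (c i) P) by exact: Alt_contract.
rewrite starS.
have step i : contract (b i) (star m.+1 (contract (c i) (ext (pr^~ x) P))) =
    pr (c i) x *: contract (b i) (star m.+1 P)
    + contract x (contract (b i) (star m (contract (c i) P))).
  rewrite contract_ext starB IHm // starZ contractB contractZ.
  rewrite [contract (b i) (contract x _)]contractC ?opprK //.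
  exact: Alt_star.
under eq_bigr => i _ do rewrite step.
rewrite big_split /= -contract_basis; last exact: Alt_star.
rewrite -contract_sum.
have -> : \sum_i contract (b i) (star m (contract (c i) P))
   = m.+1%:R *: star m.+1 P.
  by rewrite starS scalerA divff ?pnatr_eq0 // scale1r.
move: (star m.+1 P) => S; rewrite contractZ -{1}[contract x S]scale1r -scalerDl scalerA.
by rewrite -(natrD _ 1) mulVf ?scale1r // pnatr_eq0.
Qed.

(** The base case is the place where [mu] must have top degree: w /\ mu = 0 gives w /\ i_b mu = w(b)
    mu. *)
Lemma star_contract m w P : Alt P ->
  star m (contract w P) = ext (pr w) (star m.+1 P).
Proof.
elim: m P => [|m IHm] P PA.
  rewrite starS invr1 scale1r ext_sum star0.
  have step i : ext (pr w) (contract (b i) (star 0 (contract (c i) P))) =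
      (pr w (b i) * P [:: c i]) *: mu.
    have := contract_ext (b i) (pr w) mu.
    rewrite mu_top contract0 => /esym/eqP; rewrite subr_eq0 => /eqP h.
    by rewrite star0 contractZ extZ -h scalerA mulrC.
  under eq_bigr => i _ do rewrite step.
  rewrite -scaler_suml contract_cobasis // fct_sumE.
  by congr (_ *: _).
have PA' i : Alt (contract (c i) P) by exact: Alt_contract.
set T := star m.+1 (contract w P).
(* Moving [ext (pr w)] past the contraction with [b i] leaves the terms [pr w (b i)], which
   reassemble [contract w P] and thus [T] itself. The equation is then solved for [T], with
   coefficient m + 2. *)
have key : T = - m.+1%:R^-1 *: (T - m.+2%:R *: ext (pr w) (star m.+2 P)).
  rewrite {1}/T starS scaleNr -scalerN; congr (_ *: _).
  rewrite opprB [star m.+2 _]starS extZ scalerA divff ?pnatr_eq0 //.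
  rewrite scale1r ext_sum.
  have step i : contract (b i) (star m (contract (c i) (contract w P))) =
      ext (pr w) (contract (b i) (star m.+1 (contract (c i) P)))
      - pr w (b i) *: star m.+1 (contract (c i) P).
    rewrite contractC // starN IHm // contractN contract_ext opprB addrC.
    by [].
  under eq_bigr => i _ do rewrite step -starZ.
  rewrite big_split /= sumrN -star_sum -contract_cobasis //.
have h : m.+1%:R *: T = - (T - m.+2%:R *: ext (pr w) (star m.+2 P)).
  by rewrite {1}key scaleNr scalerN scalerA divff ?pnatr_eq0 // scale1r.
apply: (@scalerI _ _ (m.+2%:R : R)); first by rewrite pnatr_eq0.
by rewrite -{1}(addn1 m.+1) natrD scalerDl scale1r h opprB subrK.
Qed.

(* On [u] only the component of [P] of degree [n - size u] contributes; the
   truncated subtraction is harmless since [mu] vanishes on longer sequences. *)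
Definition hodge P u : R^o := star (n - size u) P u.

Lemma hodge_is_linear : linear hodge.
Proof. by move=> k P Q; apply/funext => u; rewrite /hodge linearP. Qed.
HB.instance Definition _ :=
  GRing.isLinear.Build R (seq W -> R^o) (seq V -> R^o) *:%R hodge
    hodge_is_linear.

Lemma Alt_hodge P : Alt (hodge P).
Proof.
split=> [u v k x y|u v x]; rewrite /hodge !size_cat /=.
  exact: (Alt_star _ _).1.
exact: (Alt_star _ _).2.
Qed.

Lemma hodge_size (k : int) P u :
  (forall v, (size v)%:Z != k -> P v = 0) ->
  (size u)%:Z != n%:Z - k -> hodge P u = 0.
Proof.
move=> Pk sz_u; rewrite /hodge; have [le_un|lt_nu] := leqP (size u) n.
  by apply: star_degree => v sz_v; apply: Pk; rewrite sz_v; lia.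
by apply: star_size; lia.
Qed.

Lemma hodge_ext x P : Alt P -> hodge (ext (pr^~ x) P) = contract x (hodge P).
Proof.
move=> PA; apply/funext => u; rewrite /contract /hodge /=.
have [lt_un|le_nu] := ltnP (size u) n.
  by rewrite (subnS n) -[in LHS](@prednK (n - size u)) ?subn_gt0 // star_ext.
have -> : (n - (size u).+1 = 0)%N by lia.
have -> : (n - size u = 0)%N by lia.
by rewrite !star0 /= scale0r !fctE mu_size ?scaler0 //= gtn_eqF.
Qed.

Lemma hodge_contract w P : Alt P ->
  hodge (contract w P) = ext (pr w) (hodge P).
Proof.
move=> PA; apply/funext => -[|x u].
  by rewrite /hodge star_contract.
have [lt_un|le_nu] := ltnP (size u) n; last first.
  (* With n or more arguments left, the truncated degrees are all 0, and the claim becomes w /\ mu =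
     0 on one side and the vanishing of [mu] on long sequences on the other. *)
  rewrite (@ext_local _ _ _ _ (star 0 P)) => [|v [sz_v]]; last first.
    by rewrite /hodge sz_v; have -> : (n - size u = 0)%N by lia.
  rewrite star0 extZ mu_top scaler0 /hodge [size _]/=.
  have -> : (n - (size u).+1 = 0)%N by lia.
  by rewrite star0 !fctE mu_size ?scaler0 //=; lia.
rewrite {1}/hodge star_contract //; apply: ext_local => v [sz_v].
by rewrite /hodge sz_v /= -subSn.
Qed.

End Hodge.
Arguments star : simpl never.

(** * Volume form of a pair of dual bases *)

Section Volume.
Context {R : realType} {V W : lmodType R} {n : nat}.
Variables (pr : W -> V -> R) (b : 'I_n -> V) (c : 'I_n -> W).
Hypothesis prL : forall w, linp (pr w).
Hypothesis prR : forall x, linp (pr^~ x).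
Hypothesis prbc : forall x, x = \sum_i pr (c i) x *: b i.
Hypothesis prcb : forall w, w = \sum_i pr w (b i) *: c i.
Hypothesis prE : forall i j, pr (c i) (b j) = (i == j)%:R.

Definition volume (l : seq 'I_n) : seq V -> R^o :=
  foldr (fun i => ext (pr (c i))) one l.

Lemma Alt_volume l : Alt (volume l).
Proof. by elim: l => [|i l IHl] /=; [apply: Alt_one | apply: Alt_ext]. Qed.

Lemma ext_size (p : V -> R) k (a : seq V -> R^o) u :
  (forall v, size v != k -> a v = 0) -> size u != k.+1 -> ext p a u = 0.
Proof.
move=> ak; case: u => [|x u] //= sz_u.
rewrite ak // mulr0 sub0r (@ext_local _ _ p _ 0) ?ext0 ?oppr0 // => v sz_v.
by rewrite /contract ak //= sz_v.
Qed.

Lemma volume_size l u : size u != size l -> volume l u = 0.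
Proof.
elim: l u => [|i l IHl] u /=; first by case: u.
exact: ext_size.
Qed.

Lemma ext_volume i l : i \in l -> ext (pr (c i)) (volume l) = 0.
Proof.
elim: l => [|j l IHl] //=; rewrite in_cons => /predU1P[<-|il].
  exact: extxx.
by rewrite extC IHl // ext0 oppr0.
Qed.

(** A covector is a combination of the [c i], and each of these already occurs as a factor. *)
Lemma volume_top l w : (forall i, i \in l) -> ext (pr w) (volume l) = 0.
Proof.
move=> allP; have e x : pr w x = \sum_i pr w (b i) * pr (c i) x.
  rewrite {1}(prcb w); elim/big_rec2: _ => [|i y z _ <-].
    by have := prR x 1 0 0; rewrite scale1r add0r mul1r => h; lra.
  exact: prR.
rewrite (ext_eqp _ e) ext_suml big1 // => i _.
by rewrite ext_volume ?scaler0.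
Qed.

Lemma contract_volume j l : j \notin l -> contract (b j) (volume l) = 0.
Proof.
elim: l => [|i l IHl] //=; rewrite in_cons negb_or => /andP[ji jl].
by rewrite contract_ext prE eq_sym (negPf ji) scale0r IHl // ext0 subr0.
Qed.

Lemma volume_basis l : uniq l -> volume l (map b l) = 1.
Proof.
elim: l => [|i l IHl] //= /andP[il ul].
by rewrite contract_volume // ext0 prE eqxx IHl // mul1r subr0.
Qed.
End Volume.

(** * Fourier inversion *)

Section HodgeInverse.
Context {R : realType} {V W : lmodType R} {n : nat}.
Variables (pr : W -> V -> R) (b : 'I_n -> V) (c : 'I_n -> W).
Hypothesis prL : forall w, linp (pr w).
Hypothesis prR : forall x, linp (pr^~ x).
Hypothesis prbc : forall x, x = \sum_i pr (c i) x *: b i.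
Hypothesis prcb : forall w, w = \sum_i pr w (b i) *: c i.
Hypothesis prE : forall i j, pr (c i) (b j) = (i == j)%:R.

Let pr' x w := pr w x.
Let prE' i j : pr' (b i) (c j) = (i == j)%:R.
Proof. by rewrite /pr' prE eq_sym. Qed.

Variable s : seq 'I_n.
Hypothesis us : uniq s.
Hypothesis ss : forall i, i \in s.
(** The order is reversed because [star_volume] returns the covectors in reverse order; this makes
    the inversion constant 1, without a sign depending on n. *)
Definition covolume := volume pr' b (rev s).

Lemma star_volume l t :
  star c b covolume (size l) (volume pr c l) t
  = covolume (rev (map c l) ++ t).
Proof.
elim: l t => [|i l IHl] t /=; first by rewrite star0 scale1r.
rewrite (@star_ext _ _ _ _ pr' c b _ _ _) //.
- by rewrite /contract IHl rev_cons cat_rcons.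
- exact: Alt_volume.
- exact: Alt_volume.
Qed.

Hypothesis sn : size s = n.

(** Each transform exchanges contraction and exterior multiplication, so their composite commutes
    with contractions. By induction on the arguments only the value on the empty sequence is left,
    to which just the component of [P] of degree 0 contributes. *)
Lemma hodgeK P : Alt P ->
  hodge c b covolume (hodge b c (volume pr c s) P) = P.
Proof.
have Avol : Alt (volume pr c s) by exact: Alt_volume.
have Acov : Alt covolume by exact: Alt_volume.
move=> PA; apply/funext => u; elim: u P PA => [|w u IHu] P PA; last first.
  rewrite -[LHS]/(contract w (hodge c b covolume (hodge b c _ P)) u).
  rewrite -(@hodge_ext _ _ _ _ pr' c b) //.
  - rewrite -[pr'^~ w]/(pr w) -(@hodge_contract _ _ _ _ pr b c) //.
    + by rewrite IHu //; apply: Alt_contract.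
    + by move=> v nv; apply: volume_size; rewrite sn.
    + move=> v; exact: (@volume_top _ _ _ _ pr b c).
  - by move=> v nv; apply: volume_size; rewrite size_rev sn.
  - exact: Alt_hodge.
set mu := volume pr c s.
have -> : hodge c b covolume (hodge b c mu P) [::] =
    star c b covolume n (P [::] *: mu) [::].
  rewrite /hodge subn0; apply/eqP; rewrite -subr_eq0; apply/eqP.
  rewrite -[LHS]/((star c b covolume n _ - star c b covolume n _) [::]) -starB.
  apply: star_degree => v sz_v.
  rewrite -[LHS]/(star b c mu (n - size v) P v - P [::] *: mu v).
  by rewrite sz_v subnn star0 subrr.
rewrite starZ -[LHS]/(P [::] * star c b covolume n mu [::]).
have -> : star c b covolume n mu [::] = star c b covolume (size s) mu [::].
  by rewrite sn.
rewrite star_volume cats0 /covolume -map_rev.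
rewrite volume_basis ?rev_uniq //.
by rewrite mulr1.
Qed.
End HodgeInverse.

(** * Shuffle sums *)

Section Shuffle.
Context {R : realType} {V : Type}.
Implicit Types (F : seq V -> seq V -> R) (u : seq V).

Lemma shuffle_sum_nil F : shuffle_sum F [::] = F [::] [::].
Proof.
rewrite /shuffle_sum (big_pred1 [tuple]) => [|m]; last first.
  by rewrite [m]tuple0; apply/esym/eqP.
by rewrite /shuffle_inv big_ord0 mul1r.
Qed.

(** A leading unselected entry is jumped over by every selected one; a leading selected entry adds
    no inversion. *)
Lemma shuffle_inv_cons (b : bool) (m : seq bool) :
  shuffle_inv (b :: m) = (if b then shuffle_inv m else shuffle_inv m + count id m)%N.
Proof.
rewrite /shuffle_inv /= big_mkcond big_ord_recl /=.
rewrite -[X in if b then X else _]add0n.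
have -> : (if b then (0 + \sum_(i < size m | nth false m i) count negb (take i m))%N else
   (\sum_(i < size m | nth false m i) count negb (take i m) + count id m)%N) =
   (\sum_(i < size m | nth false m i) (count negb (take i m) + ~~ b))%N.
  rewrite big_split /=; case: b => /=.
    by rewrite add0n [X in (_ + X)%N]big1 ?addn0.
  congr addn; rewrite sum1_card -sum1_count (big_nth false) big_mkord.
  by rewrite -sum1_card; apply: eq_bigl.
case: b => /=; rewrite add0n [RHS]big_mkcond; apply: eq_bigr => i _.
  by rewrite !add0n addn0.
by rewrite !add0n addnC.
Qed.

(** The first argument goes to either factor, in the second case past the [size v] arguments of the
    first one. Shuffle sums thereby obey a recursion on the argument list of the same kind as
    [ext]. *)
Lemma shuffle_sum_cons F x u : shuffle_sum F (x :: u) =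
  shuffle_sum (fun v w => F (x :: v) w) u
  + shuffle_sum (fun v w => (-1) ^+ size v * F v (x :: w)) u.
Proof.
rewrite {1}/shuffle_sum /=.
rewrite (reindex (fun p : bool * (size u).-tuple bool => [tuple of p.1 :: p.2])) /=;
  last first.
  exists (fun m => (thead m, [tuple of behead m])) => [[b m] _|m _] /=.
    by congr pair; apply: val_inj.
  by rewrite [RHS]tuple_eta; apply: val_inj.
rewrite -(pair_bigA _ (fun b (m : (size u).-tuple bool) =>
  (-1) ^+ shuffle_inv (b :: m) *
  F (mask (b :: m) (x :: u)) (mask (map negb (b :: m)) (x :: u)))) /=.
rewrite big_bool /=; congr (_ + _); apply: eq_bigr => m _.
  by rewrite shuffle_inv_cons.
by rewrite shuffle_inv_cons exprD size_mask ?size_tuple // mulrA.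
Qed.

Lemma eq_shuffle_sum F G u :
  (forall v w, (size v + size w = size u)%N -> F v w = G v w) ->
  shuffle_sum F u = shuffle_sum G u.
Proof.
move=> FG; apply: eq_bigr => m _; rewrite FG // !size_mask ?size_map ?size_tuple //.
by rewrite count_map -[RHS](size_tuple m) -(count_predC id m).
Qed.

Lemma shuffle_sumD F G u :
  shuffle_sum (fun v w => F v w + G v w) u = shuffle_sum F u + shuffle_sum G u.
Proof.
by rewrite /shuffle_sum -big_split; apply: eq_bigr => m _ /=; rewrite mulrDr.
Qed.

Lemma shuffle_sumZ (k : R) F u :
  shuffle_sum (fun v w => k * F v w) u = k * shuffle_sum F u.
Proof.
by rewrite /shuffle_sum mulr_sumr; apply: eq_bigr => m _ /=; rewrite mulrCA.
Qed.

Lemma shuffle_sum0 u : shuffle_sum (fun _ _ => 0 : R) u = 0.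
Proof. by rewrite /shuffle_sum big1 // => m _; rewrite mulr0. Qed.

Lemma shuffle_sum_sum (I : finType) (F : I -> seq V -> seq V -> R) u :
  shuffle_sum (fun v w => \sum_i F i v w) u = \sum_i shuffle_sum (F i) u.
Proof.
rewrite /shuffle_sum exchange_big; apply: eq_bigr => m _ /=.
by rewrite mulr_sumr.
Qed.

End Shuffle.

(** * Wedge products with a factor of degree at most two *)

Section WedgeExt.
Context {R : realType} {W : lmodType R}.
Implicit Types (a b : seq W -> R^o).

Lemma wedgeE a b u : wedge a b u = shuffle_sum (fun v w => a v * b w) u.
Proof. by []. Qed.

Lemma wedge_deg0 a b : (forall u, size u != 0%N -> a u = 0) ->
  wedge a b = a [::] *: b.
Proof.
move=> a0; apply/funext => u; rewrite wedgeE.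
elim: u a a0 b => [|x u IHu] a a0 b; first by rewrite shuffle_sum_nil.
rewrite shuffle_sum_cons (@eq_shuffle_sum _ _ _ (fun _ _ => 0)); last first.
  by move=> v w _; rewrite a0 ?mul0r.
rewrite shuffle_sum0 add0r -[RHS]/((a [::] *: (contract x b)) u) -IHu //.
apply: eq_shuffle_sum => v w _; case: v => [|y v]; first by rewrite mul1r.
have -> : a (y :: v) = 0 :> R by exact: a0.
by rewrite !mul0r mulr0.
Qed.

Lemma wedge_deg1 a b : (forall u, size u != 1%N -> a u = 0) ->
  wedge a b = ext (fun p => a [:: p]) b.
Proof.
move=> a1; apply/funext => u; elim: u b => [|x u IHu] b.
  by rewrite wedgeE shuffle_sum_nil a1 // mul0r.
rewrite wedgeE shuffle_sum_cons /=.
rewrite -[X in X + _]/(wedge (contract x a) b u) wedge_deg0; last first.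
  by move=> v v0; rewrite /contract a1.
congr (_ + _); rewrite -IHu wedgeE.
transitivity (-1 * shuffle_sum (fun v w => a v * contract x b w) u : R);
  last exact: mulN1r.
rewrite -shuffle_sumZ.
apply: eq_shuffle_sum => v w _; have [v1|v1] := eqVneq (size v) 1%N.
  by rewrite v1 expr1.
have -> : a v = 0 :> R by exact: a1.
by rewrite !mul0r !mulr0.
Qed.

Lemma contract_wedge2 x a b : (forall u, size u != 2%N -> a u = 0) ->
  contract x (wedge a b) =
  ext (fun p => a [:: x; p]) b + wedge a (contract x b).
Proof.
move=> a2; apply/funext => u.
rewrite -[LHS]/(wedge a b (x :: u)) wedgeE shuffle_sum_cons.
rewrite -[X in X + _]/(wedge (contract x a) b u) wedge_deg1; last first.
  by move=> v v0; rewrite /contract a2.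
congr (_ + _).
apply: eq_shuffle_sum => v w _; have [v1|v1] := eqVneq (size v) 2%N.
  by rewrite v1 sqrrN expr1n mul1r.
have -> : a v = 0 :> R by exact: a2.
by rewrite !mul0r !mulr0.
Qed.

Context {V : lmodType R} {n : nat}.
Variables (pr : W -> V -> R) (b : 'I_n -> V) (c : 'I_n -> W).
Hypothesis prL : forall w, linp (pr w).
Hypothesis prR : forall x, linp (pr^~ x).
Hypothesis prcb : forall w, w = \sum_i pr w (b i) *: c i.

Lemma Alt_pair_basis a x y : Alt a ->
  a [:: x; y] = \sum_i pr x (b i) * a [:: c i; y].
Proof.
move=> aA; rewrite -[LHS]/(contract x a [:: y]) {1}(prcb x) contract_suml //.
rewrite fct_sumE; apply: eq_bigr => i _.
by rewrite contractZl.
Qed.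

Lemma Alt_one_basis a y : Alt a -> a [:: y] = \sum_i pr y (b i) * a [:: c i].
Proof.
move=> aA; rewrite -[LHS]/(contract y a [::]) {1}(prcb y) contract_suml //.
rewrite fct_sumE; apply: eq_bigr => i _.
by rewrite contractZl.
Qed.

Lemma Alt_swap2 a x y : Alt a -> a [:: x; y] = - a [:: y; x].
Proof. by move=> /(contractC y x)/(congr1 (@^~ [::])). Qed.

Lemma ext_deg1E a P : Alt a ->
  ext (fun p => a [:: p]) P = \sum_i a [:: c i] *: ext (pr^~ (b i)) P.
Proof.
move=> aA; rewrite -ext_suml; apply: ext_eqp => p.
by rewrite Alt_one_basis //; apply: eq_bigr => i _; rewrite mulrC.
Qed.

Lemma ext_deg2E a x P : Alt a ->
  ext (fun p => a [:: x; p]) P = \sum_i a [:: x; c i] *: ext (pr^~ (b i)) P.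
Proof. by move=> aA; apply: (ext_deg1E P (Alt_contract x aA)). Qed.

(** Both sides satisfy the same contraction rule: contracting the double sum with [x] yields two
    cross terms, equal by the antisymmetry of [a], and the factor 1/2 keeps one of them. The
    right-hand side is the counterpart of [icontract]. *)
Lemma wedge_deg2 a P : (forall u, size u != 2%N -> a u = 0) -> Alt a ->
  wedge a P = 2^-1 *: \sum_i \sum_j
    a [:: c i; c j] *: ext (pr^~ (b i)) (ext (pr^~ (b j)) P).
Proof.
move=> a2 aA; apply/funext => u; elim: u P => [|x u IHu] P.
  rewrite wedgeE shuffle_sum_nil a2 // mul0r !fctE fct_sumE big1 ?mulr0 //.
    by rewrite scaler0.
  by move=> i _; rewrite fct_sumE big1 // => j _; rewrite !fctE scaler0.
rewrite -[LHS]/(contract x (wedge a P) u) contract_wedge2 //.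
rewrite -[RHS]/(contract x (2^-1 *: _) u) contractZ contract_sum.
rewrite -[LHS]/(_ u + wedge a (contract x P) u) IHu -[LHS]/((_ + _) u).
congr (_ u); set e := fun i => ext (pr^~ (b i)).
have step i j : contract x (a [:: c i; c j] *: e i (e j P)) =
    pr x (b i) *: (a [:: c i; c j] *: e j P)
    - pr x (b j) *: (a [:: c i; c j] *: e i P)
    + a [:: c i; c j] *: e i (e j (contract x P)).
  rewrite contractZ contract_ext /e contract_ext extB extZ opprB.
  rewrite scalerDr scalerBr addrA addrAC !scalerA.
  by rewrite [pr x (b i) * _]mulrC [pr x (b j) * _]mulrC addrAC.
under [in RHS]eq_bigr => i _ do rewrite contract_sum.
under [in RHS]eq_bigr => i _.
  under eq_bigr => j _ do rewrite step.
  rewrite big_split sumrB /=; over.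
rewrite big_split /= scalerDr; congr (_ + _).
rewrite sumrB exchange_big /= [X in _ - X]exchange_big /=.
have E1 : \sum_j \sum_i pr x (b i) *: (a [:: c i; c j] *: e j P)
   = ext (fun p => a [:: x; p]) P.
  rewrite ext_deg2E //; apply: eq_bigr => j _.
  rewrite (Alt_pair_basis _ _ aA) scaler_suml.
  by apply: eq_bigr => i _; rewrite scalerA.
have -> : \sum_j \sum_i pr x (b j) *: (a [:: c i; c j] *: e i P) =
   - ext (fun p => a [:: x; p]) P.
  rewrite -E1 exchange_big /= -sumrN; apply: eq_bigr => i _.
  rewrite -sumrN; apply: eq_bigr => j _.
  by rewrite (Alt_swap2 _ _ aA) scaleNr scalerN.
rewrite E1 opprK; set E := ext _ P.
have -> : E + E = (2 : R) *: E by rewrite scaler_nat mulr2n.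
by rewrite scalerA mulVf ?scale1r // pnatr_eq0.
Qed.
End WedgeExt.

(** * Smooth functions on the punctured space *)

Section Calculus.
Context {R : realType} {g : vectType R}.
Implicit Types (f h : g -> R) (x v w : g) (k : nat).

Local Notation rv := (passmx.rVof (vbasis {:g})).
Local Notation vr := (passmx.vecof (vbasis {:g})).

Lemma vecofrV x : vr (rv x) = x.
Proof. by apply: passmx.rVofK; apply: vbasisP. Qed.
Lemma rVvecof r : rv (vr r) = r.
Proof. by apply: passmx.vecofK; apply: vbasisP. Qed.

Lemma rVofP (a : R) x y : rv (a *: x + y) = a *: rv x + rv y.
Proof. by apply/rowP => i; rewrite !mxE linearP. Qed.
Lemma vecof0 : vr 0 = 0.
Proof. by rewrite /passmx.vecof big1 // => i _; rewrite mxE scale0r. Qed.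

Definition has_ddir f x v (d : R) :=
  is_derive (0 : R) (1 : R) (fun t : R => f (x + t *: v)) d.
Definition dir_derivable f x := forall v,
  derivable (fun t : R => f (x + t *: v)) 0 1.
Definition cont_at f x := {for rv x, continuous (f \o vr)}.
Definition nearv x (P : g -> Prop) := \forall y \near rv x, P (vr y).

Lemma has_ddirP f x v : dir_derivable f x -> has_ddir f x v (ddir v f x).
Proof. by move=> fx; rewrite /ddir derive1E; apply: derivableP. Qed.

Lemma has_ddirE f x v d : has_ddir f x v d -> ddir v f x = d.
Proof. by rewrite /has_ddir /ddir derive1E => h; rewrite derive_val. Qed.

Lemma has_ddir_ex f x v d :
  has_ddir f x v d -> derivable (fun t : R => f (x + t *: v)) 0 1.
Proof. by rewrite /has_ddir => h; apply: ex_derive. Qed.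

Lemma has_ddirD f h x v a b : has_ddir f x v a -> has_ddir h x v b ->
  has_ddir (fun y => f y + h y) x v (a + b).
Proof. by move=> fa hb; apply: is_deriveD. Qed.

Lemma has_ddirM f h x v a b : has_ddir f x v a -> has_ddir h x v b ->
  has_ddir (fun y => f y * h y) x v (f x * b + h x * a).
Proof.
move=> fa hb; have := is_deriveM fa hb.
by rewrite !scale0r !addr0.
Qed.

Lemma has_ddir_cst c x v : has_ddir (fun=> c) x v 0.
Proof. exact: is_derive_cst. Qed.

Lemma has_ddir_comp f (p : R -> R) x v a b : is_derive (f x) (1 : R) p b ->
  has_ddir f x v a -> has_ddir (fun y => p (f y)) x v (b * a).
Proof.
move=> pb fa; have pb' : is_derive (f (x + (0 : R) *: v)) (1 : R) p b.
  by rewrite scale0r addr0.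
exact: (@is_derive1_comp _ p (fun t => f (x + t *: v)) _ _ _ pb' fa).
Qed.

Lemma has_ddir_lin (l : {scalar g}) x v : has_ddir l x v (l v).
Proof.
rewrite /has_ddir; have -> : (fun t : R => l (x + t *: v)) = (fun t => l x + t * l v).
  by apply/funext => t; rewrite linearD linearZ.
have dl := is_deriveM (is_derive_id (0 : R) (1 : R)) (is_derive_cst (l v) (0 : R) (1 : R)).
have := is_deriveD (is_derive_cst (l x) (0 : R) (1 : R)) dl.
by rewrite add0r scaler0 add0r [l v *: _]mulr1.
Qed.

Lemma nearv_line x v w (P : g -> Prop) : nearv x P ->
  exists2 e : R, 0 < e & forall a b : R, `|a| < e -> `|b| < e ->
    P (x + a *: v + b *: w).
Proof.
move=> /nbhs_normP[e /= e0 eP].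
set N := `|rv v| + `|rv w| + 1.
have N0 : 0 < N by rewrite ltr_wpDl // addr_ge0.
exists (e / N) => [|a b ae be]; first by rewrite divr_gt0.
rewrite -[X in P X]vecofrV; apply: eP => /=.
rewrite -addrA addrC -addrA !rVofP addrA opprD addrCA subrr addr0 normrN.
apply: le_lt_trans (ler_normD _ _) _; rewrite !normrZ.
apply: (@le_lt_trans _ _ (e / N * (`|rv v| + `|rv w|))).
  by rewrite mulrDr lerD // ler_wpM2r // ltW.
rewrite -mulrA gtr_pMr // mulrC ltr_pdivrMr // mul1r /N ltrDl.
exact: ltr01.
Qed.

Lemma nearv_line1 x v (P : g -> Prop) : nearv x P ->
  \forall t \near (0 : R), P (x + t *: v).
Proof.
move=> /(nearv_line v v)[e e0 eP]; apply/nbhs_normP; exists e => //= t /=.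
rewrite distrC subr0 => te.
by have := eP t 0 te; rewrite normr0 scale0r addr0; apply.
Qed.

Lemma nearvS2 x (P Q S : g -> Prop) : (forall y, P y -> Q y -> S y) ->
  nearv x P -> nearv x Q -> nearv x S.
Proof.
move=> PQS xP xQ; have F := nbhs_filter (rv x).
exact: (@filterS2 _ (nbhs (rv x)) F _ _ _ (fun y => PQS (vr y)) xP xQ).
Qed.

Lemma nearvS x (P Q : g -> Prop) : (forall y, P y -> Q y) ->
  nearv x P -> nearv x Q.
Proof. by move=> PQ xP; exact: (nearvS2 (fun y Py _ => PQ y Py) xP xP). Qed.

Lemma nearvI x (P Q : g -> Prop) : nearv x P -> nearv x Q ->
  nearv x (fun y => P y /\ Q y).
Proof. exact: nearvS2. Qed.

Lemma nearv_self x (P : g -> Prop) : nearv x P -> P x.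
Proof. by move=> /nbhs_singleton; rewrite vecofrV. Qed.

Lemma nearv_neq0 x : x != 0 -> nearv x (fun y => y != 0).
Proof.
move=> x0; apply/nbhs_normP; exists `|rv x|.
  by rewrite /= normr_gt0 passmx.rVof_eq0 // vbasisP.
move=> y /= xy; apply/eqP => y0; move: xy.
have -> : y = 0 by rewrite -[y]rVvecof y0 -[0]vecof0 rVvecof.
by rewrite subr0 ltxx.
Qed.

Lemma has_ddir_near f h x v a : nearv x (fun y => f y = h y) ->
  has_ddir f x v a -> has_ddir h x v a.
Proof.
move=> fh; apply: near_eq_is_derive; exact: (nearv_line1 v fh).
Qed.

Lemma cont_atP f x : cont_at f x <->
  forall e : R, 0 < e -> nearv x (fun y => `|f x - f y| < e).
Proof.
have F := nbhs_filter (rv x).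
rewrite /cont_at /nearv; split=> [h e e0|h].
  have := (@cvgrPdist_lt _ _ _ _ F (f \o vr) _).1 h e e0.
  by rewrite /= vecofrV.
by apply/(@cvgrPdist_lt _ _ _ _ F) => e e0 /=; rewrite vecofrV; apply: h.
Qed.

Lemma cont_atD f h x : cont_at f x -> cont_at h x ->
  cont_at (fun y => f y + h y) x.
Proof. exact: (@continuousD R R _ (f \o vr) (h \o vr) (rv x)). Qed.

Lemma cont_atM f h x : cont_at f x -> cont_at h x ->
  cont_at (fun y => f y * h y) x.
Proof. exact: (@continuousM R _ (f \o vr) (h \o vr) (rv x)). Qed.

Lemma cont_at_cst c x : cont_at (fun=> c) x.
Proof. exact: (@cst_continuous _ _ c (rv x)). Qed.

Lemma cont_at_comp f (p : R -> R) x : {for f x, continuous p} ->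
  cont_at f x -> cont_at (fun y => p (f y)) x.
Proof.
move=> pc fc; apply: (@continuous_comp _ _ _ (f \o vr) p) => //=.
by rewrite vecofrV.
Qed.

Lemma cont_at_lin (l : {scalar g}) x : cont_at l x.
Proof.
have E : l \o vr = fun r => \sum_i r 0 i * l (vbasis {:g})`_i.
  apply/funext => r; rewrite /= /passmx.vecof raddf_sum.
  by apply: eq_bigr => i _; exact: linearZ.
have F := nbhs_filter (rv x); rewrite /cont_at E.
elim: (index_enum _) => [|i s IHs].
  have -> : (fun r : 'rV[R]_(\dim {:g}) => \sum_(i <- [::]) r 0 i * l (vbasis {:g})`_i)
      = fun=> 0 by apply/funext => r; rewrite big_nil.
  exact: (@cst_continuous _ _ 0 (rv x)).
have -> : (fun r : 'rV[R]_(\dim {:g}) => \sum_(i <- i :: s) r 0 i * l (vbasis {:g})`_i)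
    = (fun r => r 0 i * l (vbasis {:g})`_i)
      + (fun r => \sum_(i <- s) r 0 i * l (vbasis {:g})`_i).
  by apply/funext => r; rewrite big_cons.
apply: (@continuousD R R _ _ _ (rv x)) IHs.
apply: (@continuousM R _ _ _ (rv x)); first exact: coord_continuous.
exact: (@cst_continuous _ _ _ (rv x)).
Qed.

Lemma cont_at_near f h x : nearv x (fun y => f y = h y) ->
  cont_at f x -> cont_at h x.
Proof.
move=> fh /cont_atP fc; apply/cont_atP => e e0.
have <- := nearv_self fh; move: fh (fc e e0); apply: nearvS2 => y <-; exact: id.
Qed.

(** Smoothness is graded so that closure properties can be proved by induction on the order. The
    grading is shifted: [Ck k] asks that the iterated derivatives up to order k be continuous and
    differentiable once more along lines. *)
Fixpoint Ck k f : Prop :=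
  (forall x, x != 0 -> dir_derivable f x /\ cont_at f x) /\
  if k is k'.+1 then forall v, Ck k' (ddir v f) else True.

Lemma ddirs_rcons vs v f : ddirs (rcons vs v) f = ddirs vs (ddir v f).
Proof. by rewrite /ddirs foldr_rcons. Qed.

Lemma smooth_onP f : smooth_on [set x | x != 0] f <-> forall k, Ck k f.
Proof.
split=> [fs k|fC vs x x0].
  elim: k f fs => [|k IHk] f fs /=; split=> //.
  - by move=> x x0; apply: (fs [::] x x0).
  - by move=> x x0; apply: (fs [::] x x0).
  by move=> v; apply: IHk => vs x x0; rewrite -ddirs_rcons; apply: fs.
have := fC (size vs); elim/last_ind: vs f {fC} => [|vs v IHvs] f.
  by case=> /(_ x x0).
by rewrite size_rcons ddirs_rcons => -[_ /(_ v)]; apply: IHvs.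
Qed.

Lemma Ck0 k f : Ck k f -> forall x, x != 0 -> dir_derivable f x /\ cont_at f x.
Proof. by case: k => [|k] []. Qed.

Lemma CkW k f : Ck k.+1 f -> Ck k f.
Proof.
elim: k f => [|k IHk] f [f0 fC]; split => // v.
by apply: IHk; apply: fC.
Qed.

Lemma nearv_eq_on f h x : (forall y, y != 0 -> f y = h y) -> x != 0 ->
  nearv x (fun y => f y = h y).
Proof.
by move=> fh /nearv_neq0; apply: nearvS.
Qed.

Lemma Ck_eq k f h : (forall x, x != 0 -> f x = h x) -> Ck k f -> Ck k h.
Proof.
elim: k f h => [|k IHk] f h fh fC; split=> //.
- move=> x x0; have [fd fc] := Ck0 fC x0; have nfh := nearv_eq_on fh x0.
  split=> [v|]; last exact: cont_at_near fc.
  exact: has_ddir_ex (has_ddir_near nfh (has_ddirP v fd)).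
- move=> x x0; have [fd fc] := Ck0 fC x0; have nfh := nearv_eq_on fh x0.
  split=> [v|]; last exact: cont_at_near fc.
  exact: has_ddir_ex (has_ddir_near nfh (has_ddirP v fd)).
move=> v; case: (fC) => _ /(_ v); apply: IHk => x x0; have [fd _] := Ck0 fC x0.
apply/esym/has_ddirE; apply: has_ddir_near (has_ddirP v fd).
exact: nearv_eq_on.
Qed.

Lemma CkS k f (df : g -> g -> R) :
  (forall x v, x != 0 -> has_ddir f x v (df v x)) ->
  (forall x, x != 0 -> cont_at f x) -> (forall v, Ck k (df v)) -> Ck k.+1 f.
Proof.
move=> fd fc dfC; split=> [x x0|v].
  by split=> [v|]; [exact: has_ddir_ex (fd x v x0)|exact: fc].
by apply: Ck_eq (dfC v) => x x0; apply/esym/has_ddirE/fd.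
Qed.

Lemma CkD k f h : Ck k f -> Ck k h -> Ck k (fun x => f x + h x).
Proof.
elim: k f h => [|k IHk] f h fC hC.
  split=> // x x0; have [fd fc] := Ck0 fC x0; have [hd hc] := Ck0 hC x0.
  split=> [v|]; last exact: cont_atD.
  exact: has_ddir_ex (has_ddirD (has_ddirP v fd) (has_ddirP v hd)).
apply: (@CkS _ _ (fun v x => ddir v f x + ddir v h x)) => [x v x0|x x0|v].
- by apply: has_ddirD; apply: has_ddirP; [case: (Ck0 fC x0)|case: (Ck0 hC x0)].
- by apply: cont_atD; [case: (Ck0 fC x0)|case: (Ck0 hC x0)].
- by apply: IHk; [apply: fC.2|apply: hC.2].
Qed.

Lemma CkM k f h : Ck k f -> Ck k h -> Ck k (fun x => f x * h x).
Proof.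
elim: k f h => [|k IHk] f h fC hC.
  split=> // x x0; have [fd fc] := Ck0 fC x0; have [hd hc] := Ck0 hC x0.
  split=> [v|]; last exact: cont_atM.
  exact: has_ddir_ex (has_ddirM (has_ddirP v fd) (has_ddirP v hd)).
apply: (@CkS _ _ (fun v x => f x * ddir v h x + h x * ddir v f x)) => [x v x0|x x0|v].
- by apply: has_ddirM; apply: has_ddirP; [case: (Ck0 fC x0)|case: (Ck0 hC x0)].
- by apply: cont_atM; [case: (Ck0 fC x0)|case: (Ck0 hC x0)].
- apply: CkD; apply: IHk; by [apply: CkW|apply: fC.2|apply: hC.2].
Qed.

Lemma Ck_cst k c : Ck k (fun=> c).
Proof.
elim: k c => [|k IHk] c; last first.
  apply: (@CkS _ _ (fun _ _ => 0)) => // [x v _|x _].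
    exact: has_ddir_cst.
  exact: cont_at_cst.
split=> // x _; split=> [v|]; last exact: cont_at_cst.
exact: has_ddir_ex (has_ddir_cst c x v).
Qed.

Lemma Ck_lin k (l : {scalar g}) : Ck k l.
Proof.
case: k => [|k]; last first.
  apply: (@CkS _ _ (fun v _ => l v)) => [x v _|x _|v].
  - exact: has_ddir_lin.
  - exact: cont_at_lin.
  - exact: Ck_cst.
split=> // x _; split=> [v|]; last exact: cont_at_lin.
exact: has_ddir_ex (has_ddir_lin l x v).
Qed.

Lemma CkV k f : Ck k f -> (forall x, x != 0 -> f x != 0) ->
  Ck k (fun x => (f x)^-1).
Proof.
move=> fC f0; elim: k fC => [|k IHk] fC.
  split=> // x x0; have [fd fc] := Ck0 fC x0; split=> [v|].
    have h0 : f (x + (0 : R) *: v) != 0 by rewrite scale0r addr0 f0.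
    exact: (derivableV h0 (fd v)).
  apply: cont_at_comp fc; apply: cvgV; last exact: cvg_id.
  exact: f0.
have fkV := IHk (CkW fC).
(* The derivative is written as a product of inverses, to which the induction hypothesis at order
   [k] and [CkM] apply. *)
apply: (@CkS _ _ (fun v x => - 1 * ((f x)^-1 * ((f x)^-1 * ddir v f x)))).
- move=> x v x0; have [fd fc] := Ck0 fC x0.
  have dV : derivable (fun t : R => (f (x + t *: v))^-1) 0 1.
    have h0 : f (x + (0 : R) *: v) != 0 by rewrite scale0r addr0 f0.
    exact: (derivableV h0 (fd v)).
  apply: is_derive_eq (derivableP dV) _; rewrite (deriveV _ (fd v)) ?scale0r ?addr0 ?f0 // -derive1E -/(ddir v f x).
  rewrite mulN1r scaleNr expr2 invfM; congr (- _).
  by symmetry; apply: mulrA.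
- move=> x x0; have [_ fc] := Ck0 fC x0.
  by apply: cont_at_comp fc; apply: cvgV; [exact: f0|exact: cvg_id].
- move=> v; apply: CkM; first exact: Ck_cst.
  by apply: CkM => //; apply: CkM => //; apply: fC.2.
Qed.

End Calculus.

(** * Symmetry and linearity of directional derivatives *)

Section MixedDerivatives.
Context {R : realType} {g : vectType R}.
Implicit Types (f h : g -> R) (x v w : g) (k : nat).

Lemma has_ddirZ f x v (a d : R) : has_ddir f x v d -> has_ddir f x (a *: v) (a * d).
Proof.
move=> fd.
have da : is_derive (0 : R) (1 : R) (fun t : R => t * a) a.
  have := is_deriveM (is_derive_id (0 : R) (1 : R)) (is_derive_cst a (0 : R) (1 : R)).
  by rewrite scaler0 add0r [a *: _]mulr1.
have fd' : is_derive ((fun t : R => t * a) 0) (1 : R) (fun t : R => f (x + t *: v)) d.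
  by rewrite mul0r.
have := @is_derive1_comp _ _ (fun t => t * a) 0 _ _ fd' da; rewrite mulrC /has_ddir.
by congr is_derive; apply/funext => t /=; rewrite scalerA.
Qed.

Lemma has_ddir_shift f x y v d : has_ddir f (x + y) v d ->
  has_ddir (fun z => f (z + y)) x v d.
Proof.
by rewrite /has_ddir; congr is_derive; apply/funext => t; rewrite addrAC.
Qed.

Lemma is_derive_line f x v (s : R) : dir_derivable f (x + s *: v) ->
  is_derive s (1 : R) (fun t : R => f (x + t *: v)) (ddir v f (x + s *: v)).
Proof.
move=> /(has_ddirP v) fd.
have ds : is_derive s (1 : R) (fun t : R => t - s) (1 : R).
  exact: (is_derive_shift s (1 : R) (- s)).
have fd' : is_derive ((fun t : R => t - s) s) (1 : R)
    (fun t : R => f (x + s *: v + t *: v)) (ddir v f (x + s *: v)).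
  by rewrite subrr.
have := @is_derive1_comp _ _ (fun t => t - s) s _ _ fd' ds; rewrite mulr1.
congr is_derive; apply/funext => t /=.
by rewrite -addrA -scalerDl [s + _]addrC subrK.
Qed.

Lemma mvt_line f x v (t : R) : 0 < t ->
  (forall s : R, 0 <= s <= t -> dir_derivable f (x + s *: v)) ->
  exists2 s : R, 0 < s < t & f (x + t *: v) - f x = t * ddir v f (x + s *: v).
Proof.
move=> t0 fd.
have [s||s] := @MVT R (fun s => f (x + s *: v)) (fun s => ddir v f (x + s *: v)) 0 t t0.
- move=> /itvP sI; have s0t : 0 <= s <= t by rewrite !ltW ?sI.
  exact: (is_derive_line (fd s s0t)).
- apply: derivable_within_continuous => s /itvP sI.
  have s0t : 0 <= s <= t by rewrite !sI.
  exact: (@ex_derive _ _ _ _ _ _ _ (is_derive_line (v := v) (fd s s0t))).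
rewrite subr0 scale0r addr0 mulrC => sI ->; exists s => //.
Qed.

(** The mean value theorem is applied twice: along [w] to the difference of [f] under the shift by
    [t *: v], then along [v] to the derivative [ddir w f]. *)
Lemma second_difference f x v w (e t : R) : Ck 1 f -> 0 < t -> t < e ->
  (forall a b : R, `|a| < e -> `|b| < e -> x + a *: v + b *: w != 0) ->
  exists a b : R, [/\ `|a| < e, `|b| < e &
    f (x + t *: v + t *: w) - f (x + t *: v) - f (x + t *: w) + f x
    = t * (t * ddir v (ddir w f) (x + a *: v + b *: w))].
Proof.
move=> fC t0 te x0.
have ab (a : R) : 0 <= a <= t -> `|a| < e.
  by move=> /andP[a0 a_t]; rewrite ger0_norm // (le_lt_trans a_t).
have Ux (a b : R) : 0 <= a <= t -> 0 <= b <= t ->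
    x + a *: v + b *: w != 0 by move=> /ab ae /ab be; apply: x0.
have tI : 0 <= t <= t by rewrite lexx ltW.
have oI : 0 <= (0 : R) <= t by rewrite lexx ltW.
pose phi y := f (y + t *: v) - f y.
have phid s : 0 <= s <= t -> forall u, has_ddir phi (x + s *: w) u
    (ddir u f (x + t *: v + s *: w) - ddir u f (x + s *: w)).
  move=> sI u; have [fd1 _] := Ck0 fC (Ux t s tI sI).
  have [fd0 _] := Ck0 fC (Ux 0 s oI sI).
  rewrite scale0r addr0 in fd0.
  apply: is_deriveB; last exact: has_ddirP.
  have := has_ddirP u fd1; rewrite addrAC; exact: has_ddir_shift.
have [s sI|s sI] := @mvt_line phi x w t t0.
  by move=> u; apply: has_ddir_ex (phid s sI u).
have sI' : 0 <= s <= t by case/andP: sI => s0 st; rewrite !ltW.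
rewrite (has_ddirE (phid s sI' w)) => E1.
have [r rI|r rI E2] := @mvt_line (ddir w f) (x + s *: w) v t t0.
  have [dd _] := @Ck0 _ _ 0 _ (fC.2 w) _ (Ux r s rI sI').
  by rewrite addrAC.
exists r, s; split; [by apply: ab; case/andP: rI => r0 rt; rewrite !ltW|exact: ab|].
rewrite [x + r *: v + _]addrAC -E2 [x + s *: w + _]addrAC -E1 /phi.
rewrite [x + t *: w + _]addrAC; ring.
Qed.

(** The second difference is symmetric in [v] and [w], so it expresses both mixed derivatives, at
    two points of a small parallelogram; their continuity at [x] bounds each error by e / 2. *)
Lemma schwarz f x v w : Ck 2 f -> x != 0 ->
  ddir v (ddir w f) x = ddir w (ddir v f) x.
Proof.
move=> fC x0; have fC1 := CkW fC.
apply/eqP; rewrite -subr_eq0 -normr_le0; apply/ler_addgt0Pl => e e0.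
rewrite addr0.
have e20 : 0 < e / 2 by rewrite divr_gt0.
have c1 := (cont_atP _ _).1 (@Ck0 _ _ 0 _ ((fC.2 w).2 v) _ x0).2 _ e20.
have c2 := (cont_atP _ _).1 (@Ck0 _ _ 0 _ ((fC.2 v).2 w) _ x0).2 _ e20.
have := nearvI (nearv_neq0 x0)
  (nearvI c1 c2).
move=> /(nearv_line v w)[d d0 dP].
pose t := d / 2; have t0 : 0 < t by rewrite divr_gt0.
have td : t < d by rewrite /t ltr_pdivrMr // ltr_pMr // ltr1n.
have [|a [b [ad bd E1]]] := @second_difference f x v w d t fC1 t0 td.
  by move=> a b ad bd; case: (dP a b ad bd).
have [|a' [b' [ad' bd' E2]]] := @second_difference f x w v d t fC1 t0 td.
  by move=> a' b' ad' bd'; rewrite addrAC; case: (dP b' a' bd' ad').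
have [_ [h1 _]] := dP a b ad bd.
have [_ [_]] := dP b' a' bd' ad'.
rewrite [x + b' *: v + _]addrAC => h2.
have E : ddir v (ddir w f) (x + a *: v + b *: w) =
         ddir w (ddir v f) (x + a' *: w + b' *: v).
  apply: (mulfI (lt0r_neq0 t0)); apply: (mulfI (lt0r_neq0 t0)).
  apply: etrans (esym E1) _; apply: etrans _ E2.
  rewrite [x + t *: w + t *: v]addrAC {E1 h1 h2 dP c1 c2}.
  move: (f (x + _ + _)) (f (x + t *: v)) (f (x + t *: w)) (f x) => a1 a2 a3 a4.
  ring.
move: h1 h2; rewrite E.
move: (ddir v (ddir w f) x) (ddir w (ddir v f) x) (ddir w _ (_ + _)).
move=> A B z h1 h2.
have -> : A - B = (A - z) - (B - z) by ring.
apply: le_trans (ler_normB _ _) _.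
by rewrite [e]splitr; apply: lerD; apply: ltW.
Qed.

(** Additivity in the direction comes from the continuity of the derivatives: the increment along
    the diagonal of a parallelogram is the sum of the increments along two sides, and the mean value
    theorem turns each into a derivative at a nearby point, with error at most e / 3. *)
Lemma ddirD f x v w : Ck 1 f -> x != 0 ->
  ddir (v + w) f x = ddir v f x + ddir w f x.
Proof.
move=> fC x0; apply/eqP; rewrite -subr_eq0 -normr_le0.
apply/ler_addgt0Pl => e e0; rewrite addr0.
have e30 : 0 < e / 3 by rewrite divr_gt0.
have c u := (cont_atP _ _).1 (@Ck0 _ _ 0 _ (fC.2 u) _ x0).2 _ e30.
have := nearvI
  (nearvI (nearv_neq0 x0) (c (v + w)))
  (nearvI (c v) (c w)).
move=> /(nearv_line v w)[d d0 dP].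
pose t := d / 2; have t0 : 0 < t by rewrite divr_gt0.
have td : t < d by rewrite /t ltr_pdivrMr // ltr_pMr // ltr1n.
have sd (s : R) : 0 <= s <= t -> `|s| < d.
  by move=> /andP[s0 st]; rewrite ger0_norm // (le_lt_trans st).
have tI : 0 <= t <= t by rewrite lexx ltW.
have oI : 0 <= (0 : R) <= t by rewrite lexx ltW.
have fd a b : 0 <= a <= t -> 0 <= b <= t -> dir_derivable f (x + a *: v + b *: w).
  by move=> /sd ad /sd bd; have [[y0 _] _] := dP a b ad bd; case: (Ck0 fC y0).
have W s : 0 < s < t -> 0 <= s <= t by case/andP=> s0 st; rewrite !ltW.
have [s sI|a /W aI E1] := @mvt_line f x (v + w) t t0.
  by rewrite scalerDr addrA; apply: fd.
have [s sI|b /W bI E2] := @mvt_line f x v t t0.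
  by rewrite -[x + _]addr0 -(scale0r w); apply: fd.
have [s sI|r /W rI E3] := @mvt_line f (x + t *: v) w t t0; first exact: fd.
have [[_ h1] _] := dP a a (sd a aI) (sd a aI).
have [_ [h2 _]] := dP b 0 (sd b bI) (sd 0 oI).
have [_ [_ h3]] := dP t r (sd t tI) (sd r rI).
rewrite scale0r addr0 in h2; rewrite -addrA -scalerDr in h1.
move: E1 E2 E3 h1 h2 h3; rewrite [in f (x + t *: (v + w))]scalerDr addrA.
move: (f (x + _ + _)) (f (x + t *: v)) (f x) => a1 a2 a3.
move: (ddir (v + w) f x) (ddir v f x) (ddir w f x) => A B C.
move: (ddir (v + w) f _) (ddir v f _) (ddir w f _) => A' B' C'.
move=> E1 E2 E3 h1 h2 h3.
have E : A' = B' + C'.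
  by apply: (mulfI (lt0r_neq0 t0)); rewrite mulrDr -E1 -E2 -E3; ring.
have -> : A - (B + C) = (A - A') - (B - B') - (C - C') by rewrite E; ring.
apply: le_trans (ler_normB _ _) _; rewrite [e](_ : _ = e / 3 + e / 3 + e / 3).
  apply: lerD (ltW h3); apply: le_trans (ler_normB _ _) _.
  by apply: lerD; apply: ltW.
by field.
Qed.

Lemma ddirZ f x v (a : R) : Ck 0 f -> x != 0 -> ddir (a *: v) f x = a * ddir v f x.
Proof.
move=> fC x0; apply: has_ddirE; apply: has_ddirZ; apply: has_ddirP.
by case: (Ck0 fC x0).
Qed.

Lemma Ck_sqrt k f : Ck k f -> (forall x, x != 0 -> 0 < f x) ->
  Ck k (fun x => Num.sqrt (f x)).
Proof.
move=> fC f0; elim: k fC => [|k IHk] fC.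
  split=> // x x0; have [fd fc] := Ck0 fC x0; split=> [v|].
    have sd := is_derive1_sqrt (f0 x x0).
    exact: has_ddir_ex (has_ddir_comp sd (has_ddirP v fd)).
  by apply: cont_at_comp fc; apply: sqrt_continuous.
have fkS := IHk (CkW fC).
apply: (@CkS _ _ _ _ (fun v x => (2 * Num.sqrt (f x))^-1 * ddir v f x)).
- move=> x v x0; have [fd fc] := Ck0 fC x0.
  exact: (has_ddir_comp (is_derive1_sqrt (f0 x x0)) (has_ddirP v fd)).
- move=> x x0; have [_ fc] := Ck0 fC x0.
  by apply: cont_at_comp fc; apply: sqrt_continuous.
- move=> v; apply: CkM; last exact: fC.2.
  apply: CkV => [|x x0]; first by apply: CkM => //; apply: Ck_cst.
  by rewrite mulf_neq0 // sqrtr_eq0 -ltNge f0.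
Qed.

Lemma Ck_ln k f : Ck k f -> (forall x, x != 0 -> 0 < f x) ->
  Ck k (fun x => ln (f x)).
Proof.
move=> fC f0.
have fd1 x v : x != 0 -> has_ddir (fun x => ln (f x)) x v ((f x)^-1 * ddir v f x).
  move=> x0; apply: (has_ddir_comp (is_derive1_ln (f0 x x0))).
  by apply: has_ddirP; case: (Ck0 fC x0).
have fc1 x : x != 0 -> cont_at (fun x => ln (f x)) x.
  move=> x0; apply: cont_at_comp (Ck0 fC x0).2.
  by apply: continuous_ln; apply: f0.
case: k fC => [|k] fC.
  split=> // x x0; split=> [v|]; last exact: fc1.
  exact: has_ddir_ex (fd1 x v x0).
apply: (@CkS _ _ _ _ (fun v x => (f x)^-1 * ddir v f x)) => // v.
apply: CkM; last exact: fC.2.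
by apply: CkV => [|x x0]; [exact: CkW|rewrite gt_eqF // f0].
Qed.

End MixedDerivatives.

(** * Calculus on the sphere *)

Section SphereCalculus.
Context {R : realType} {g : vectType R} (dot : {dot g for idfun}).
Implicit Types (x y v w : g) (k : nat) (s : sphere dot) (f h : sphere dot -> R).

Lemma dotP (a : R) x y z : dot (a *: x + y) z = a * dot x z + dot y z.
Proof. by rewrite linearPl. Qed.
Lemma dotC x y : dot x y = dot y x.
Proof. by have /= := hermC dot x y; rewrite expr0 mul1r. Qed.
Lemma dotPr (a : R) x y z : dot z (a *: x + y) = a * dot z x + dot z y.
Proof. by rewrite dotC dotP ![dot z _]dotC. Qed.
Lemma dot_gt0 x : x != 0 -> 0 < dot x x.
Proof. exact: neq0_dnorm_gt0. Qed.

Definition linR (l : g -> R) (lL : linp l) : {scalar g} :=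
  HB.pack l (GRing.isLinear.Build R g R^o *:%R l lL).

Lemma linp_dot x : linp (dot x).
Proof. by move=> a y z; apply: dotPr. Qed.
Lemma linp_dotl x : linp (dot^~ x).
Proof. by move=> a y z; apply: dotP. Qed.
Lemma linp_cov (p : covector g) : linp p.
Proof. by move=> a y z; rewrite linearP. Qed.

Lemma linpD (l : g -> R) x y : linp l -> l (x + y) = l x + l y.
Proof. by move=> lL; have := lL 1 x y; rewrite scale1r mul1r. Qed.
Lemma linp0 (l : g -> R) : linp l -> l 0 = 0.
Proof. by move=> lL; have := lL 1 0 0; rewrite scale1r mul1r addr0 => h; lra. Qed.
Lemma linpZ (l : g -> R) a x : linp l -> l (a *: x) = a * l x.
Proof. by move=> lL; rewrite -[a *: x]addr0 lL linp0 // addr0. Qed.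
Lemma linpN (l : g -> R) x : linp l -> l (- x) = - l x.
Proof. by move=> lL; rewrite -scaleN1r linpZ // mulN1r. Qed.
Lemma linpB (l : g -> R) x y : linp l -> l (x - y) = l x - l y.
Proof. by move=> lL; rewrite linpD // linpN. Qed.
Lemma linp_sum (l : g -> R) (I : finType) (F : I -> g) : linp l ->
  l (\sum_i F i) = \sum_i l (F i).
Proof.
move=> lL; elim: (index_enum I) => [|i r IHr]; first by rewrite !big_nil linp0.
by rewrite !big_cons linpD // IHr.
Qed.

Lemma bcovE (i : 'I_(\dim {:g})) x : bcov i x = coord (vbasis {:g}) i x.
Proof. by rewrite /bcov lfunE. Qed.
Lemma bvec_sum x : x = \sum_i bcov i x *: bvec i.
Proof.
rewrite {1}(coord_vbasis (memvf x)); apply: eq_bigr => i _.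
by rewrite bcovE.
Qed.
Lemma bcov_bvec (i j : 'I_(\dim {:g})) : bcov i (bvec j) = (i == j)%:R.
Proof.
rewrite bcovE /bvec coord_free ?(eq_sym i) //.
exact: basis_free (vbasisP _).
Qed.
Lemma linp_basis (l : g -> R) x : linp l -> l x = \sum_i bcov i x * l (bvec i).
Proof.
move=> lL; rewrite {1}(bvec_sum x) linp_sum //; apply: eq_bigr => i _.
exact: linpZ.
Qed.

Lemma bcov_sum (p : covector g) : p = \sum_i p (bvec i) *: bcov i.
Proof.
apply/lfunP => x; rewrite sum_lfunE (linp_basis x (linp_cov p)).
by apply: eq_bigr => i _; rewrite scale_lfunE mulrC.
Qed.

Lemma Ck_sum (I : finType) k (f : I -> g -> R) :
  (forall i, Ck k (f i)) -> Ck k (fun x => \sum_i f i x).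
Proof.
move=> fC; elim: (index_enum I) => [|i r IHr].
  by apply: Ck_eq (Ck_cst k 0) => x _; rewrite big_nil.
by apply: Ck_eq (CkD (fC i) IHr) => x _; rewrite big_cons.
Qed.

Lemma has_ddir_sum (I : finType) (f : I -> g -> R) x v (d : I -> R) :
  (forall i, has_ddir (f i) x v (d i)) ->
  has_ddir (fun x => \sum_i f i x) x v (\sum_i d i).
Proof.
move=> fd; elim: (index_enum I) => [|i r IHr].
  rewrite big_nil; have := has_ddir_cst 0 x v; rewrite /has_ddir.
  by congr is_derive; apply/funext => t; rewrite big_nil.
rewrite big_cons; have := has_ddirD (fd i) IHr; rewrite /has_ddir.
by congr is_derive; apply/funext => t; rewrite big_cons.
Qed.

Lemma dot_basis x y : dot x y = \sum_i bcov i x * dot (bvec i) y.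
Proof. exact: (linp_basis x (linp_dotl y)). Qed.

Lemma Ck_dot k : Ck k (fun x => dot x x).
Proof.
apply: Ck_eq (_ : Ck k (fun x => \sum_i bcov i x * dot (bvec i) x)) => [x _|].
  by rewrite [RHS]dot_basis.
apply: Ck_sum => i; apply: CkM; first exact: (Ck_lin k (bcov i)).
exact: (Ck_lin k (linR (linp_dot (bvec i)))).
Qed.

Lemma has_ddir_dot x v : has_ddir (fun x => dot x x) x v (2 * dot x v).
Proof.
have -> : (fun x => dot x x) = (fun x => \sum_i bcov i x * dot (bvec i) x).
  by apply/funext => y; rewrite [LHS]dot_basis.
have -> : 2 * dot x v =
    \sum_i (bcov i x * dot (bvec i) v + dot (bvec i) x * bcov i v).
  rewrite big_split /= -dot_basis.
  under eq_bigr => i _ do rewrite mulrC.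
  by rewrite -dot_basis (dotC v x); ring.
apply: has_ddir_sum => i; apply: has_ddirM; first exact: (has_ddir_lin (bcov i)).
exact: (has_ddir_lin (linR (linp_dot (bvec i)))).
Qed.

Definition nrm x : R := Num.sqrt (dot x x).

Lemma nrm_gt0 x : x != 0 -> 0 < nrm x.
Proof. by move=> x0; rewrite sqrtr_gt0 dot_gt0. Qed.
Lemma Ck_nrm k : Ck k nrm.
Proof. exact: Ck_sqrt (Ck_dot k) dot_gt0. Qed.
Lemma nrm_sqr x : nrm x ^+ 2 = dot x x.
Proof.
have [->|x0] := eqVneq x 0; last by rewrite sqr_sqrtr // ltW ?dot_gt0.
by rewrite /nrm (linp0 (linp_dot 0)) sqrtr0 expr0n.
Qed.

Lemma has_ddir_nrm x v : x != 0 -> has_ddir nrm x v ((nrm x)^-1 * dot x v).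
Proof.
move=> x0; have := @has_ddir_comp _ _ (fun x => dot x x) _ x v _ _
  (is_derive1_sqrt (dot_gt0 x0)) (has_ddir_dot x v).
rewrite -/(nrm x) => h; apply: is_derive_eq h _.
by have := nrm_gt0 x0 => n0; field; rewrite gt_eqF.
Qed.

Lemma sphere_dot s : dot (val s) (val s) = 1.
Proof. exact/eqP/(valP s). Qed.
Lemma sphere_neq0 s : val s != 0.
Proof.
apply/eqP => s0; have := sphere_dot s; rewrite s0 (linp0 (linp_dot 0)) => /eqP.
by rewrite eq_sym oner_eq0.
Qed.
Lemma sphere_nrm s : nrm (val s) = 1.
Proof. by rewrite /nrm sphere_dot sqrtr1. Qed.

Section RadialExt.
Context {T : zmodType}.
Implicit Types F : sphere dot -> T.

Lemma radial_extP F x : x != 0 ->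
  exists2 s : sphere dot, val s = (nrm x)^-1 *: x & radial_ext F x = F s.
Proof.
move=> x0; rewrite /radial_ext; case: insubP => [s _ vs|].
  by exists s.
rewrite -/(nrm x) !(linpZ _ _ (linp_dot _)) !(linpZ _ _ (linp_dotl _)) -nrm_sqr.
by case/eqP; have := nrm_gt0 x0 => n0; field; rewrite gt_eqF.
Qed.

Lemma radial_ext0 F : radial_ext F 0 = 0.
Proof.
rewrite /radial_ext; case: insubP => // s; rewrite scaler0 (linp0 (linp_dot 0)).
by rewrite eq_sym oner_eq0.
Qed.

Lemma radial_ext_val F s : radial_ext F (val s) = F s.
Proof.
have [s' vs' ->] := radial_extP F (sphere_neq0 s); congr F.
by apply: val_inj; rewrite vs' sphere_nrm invr1 scale1r.
Qed.

Lemma radial_extZ F (c : R) x : 0 < c -> radial_ext F (c *: x) = radial_ext F x.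
Proof.
move=> c0; have [->|x0] := eqVneq x 0; first by rewrite scaler0.
have cx0 : c *: x != 0 by rewrite scaler_eq0 negb_or gt_eqF.
have [s vs ->] := radial_extP F x0; have [s' vs' ->] := radial_extP F cx0.
congr F; apply: val_inj; rewrite vs vs' scalerA; congr (_ *: _).
have -> : nrm (c *: x) = c * nrm x.
  rewrite /nrm !(linpZ _ _ (linp_dot _)) !(linpZ _ _ (linp_dotl _)) mulrA.
  by rewrite sqrtrM ?mulr_ge0 ?ltW // -expr2 sqrtr_sqr gtr0_norm.
by have := nrm_gt0 x0 => n0; field; rewrite !gt_eqF.
Qed.
End RadialExt.

Lemma radial_ext_map (T U : zmodType) (F : sphere dot -> T) (p : T -> U) x :
  x != 0 -> radial_ext (fun s => p (F s)) x = p (radial_ext F x).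
Proof.
move=> x0; have [s vs ->] := radial_extP F x0.
have [s' vs' ->] := radial_extP (fun s => p (F s)) x0.
by congr (p (F _)); apply: val_inj; rewrite vs.
Qed.

Lemma radial_ext_map2 (T U S : zmodType) (F : sphere dot -> T)
    (G : sphere dot -> U) (p : T -> U -> S) x :
  x != 0 ->
  radial_ext (fun s => p (F s) (G s)) x = p (radial_ext F x) (radial_ext G x).
Proof.
move=> x0; have [s vs ->] := radial_extP F x0.
have [s' vs' ->] := radial_extP G x0.
have [t vt ->] := radial_extP (fun s => p (F s) (G s)) x0.
by congr (p (F _) (G _)); apply: val_inj; rewrite vt.
Qed.

Lemma radial_ext_fun (A : Type) (T : zmodType) (F : sphere dot -> A -> T) x a :
  radial_ext F x a = radial_ext (fun s => F s a) x.
Proof.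
have [->|x0] := eqVneq x 0; first by rewrite !radial_ext0.
by rewrite (radial_ext_map F (fun F => F a)).
Qed.

Lemma smoothP f : smooth f <-> forall k, Ck k (radial_ext f).
Proof. exact: smooth_onP. Qed.

Lemma smooth_cst c : smooth (fun _ : sphere dot => c).
Proof.
apply/smoothP => k; apply: Ck_eq (Ck_cst k c) => x x0.
by have [s] := radial_extP (fun=> c) x0.
Qed.

Lemma smoothD f h : smooth f -> smooth h -> smooth (fun s => f s + h s).
Proof.
move=> /smoothP fC /smoothP hC; apply/smoothP => k.
by apply: Ck_eq (CkD (fC k) (hC k)) => x x0; rewrite (radial_ext_map2 f h +%R).
Qed.

Lemma smoothM f h : smooth f -> smooth h -> smooth (fun s => f s * h s).
Proof.
move=> /smoothP fC /smoothP hC; apply/smoothP => k.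
by apply: Ck_eq (CkM (fC k) (hC k)) => x x0; rewrite (radial_ext_map2 f h *%R).
Qed.

Lemma smoothZ c f : smooth f -> smooth (fun s => c * f s).
Proof. by move=> fS; apply: smoothM => //; apply: smooth_cst. Qed.

Lemma smoothN f : smooth f -> smooth (fun s => - f s).
Proof.
move=> /(smoothZ (-1)); congr smooth; apply/funext => s; exact: mulN1r.
Qed.

Lemma smoothB f h : smooth f -> smooth h -> smooth (fun s => f s - h s).
Proof. by move=> fS hS; apply: smoothD => //; apply: smoothN. Qed.

Lemma smooth_sum (I : finType) (f : I -> sphere dot -> R) :
  (forall i, smooth (f i)) -> smooth (fun s => \sum_i f i s).
Proof.
move=> fS; elim: (index_enum I) => [|i r IHr].
  have -> : (fun s => \sum_(i <- [::]) f i s) = (fun=> 0).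
    by apply/funext => s; rewrite big_nil.
  exact: smooth_cst.
have -> : (fun s => \sum_(i <- i :: r) f i s) =
    (fun s => f i s + \sum_(i <- r) f i s).
  by apply/funext => s; rewrite big_cons.
exact: smoothD.
Qed.

(** The radial extension of the restriction of [l] is l(x) / |x|, not [l]. *)
Lemma smooth_lin (l : g -> R) : linp l -> smooth (fun s => l (val s)).
Proof.
move=> lL; apply/smoothP => k.
apply: Ck_eq (CkM (CkV (Ck_nrm k) _) (Ck_lin k (linR lL))) => x x0.
  have [s vs ->] := radial_extP (fun s => l (val s)) x0.
  by rewrite vs linpZ.
by rewrite gt_eqF // nrm_gt0.
Qed.

Lemma smooth_inv f : smooth f -> (forall s, f s != 0) -> smooth (fun s => (f s)^-1).
Proof.
move=> /smoothP fC f0; apply/smoothP => k.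
apply: Ck_eq (CkV (fC k) _) => x x0; first by rewrite (radial_ext_map f GRing.inv).
by have [s _ ->] := radial_extP f x0.
Qed.

Lemma smooth_ln f : smooth f -> (forall s, 0 < f s) -> smooth (fun s => ln (f s)).
Proof.
move=> /smoothP fC f0; apply/smoothP => k.
apply: Ck_eq (Ck_ln (fC k) _) => x x0; first by rewrite (radial_ext_map f (@ln R)).
by have [s _ ->] := radial_extP f x0.
Qed.

(** Defined for every [v] of g, not only for tangent ones: a smooth [f] has a linear derivative that
    vanishes on the normal line ([sder_radial]), so only the tangential part of [v] counts and a
    basis of g can replace a local frame. *)
Definition sder v f s : R := ddir v (radial_ext f) (val s).

Lemma eq_sder f h v s : (forall t, f t = h t) -> sder v f s = sder v h s.
Proof. by move=> /funext ->. Qed.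

Lemma smooth_has_ddir f v x : smooth f -> x != 0 ->
  has_ddir (radial_ext f) x v (ddir v (radial_ext f) x).
Proof.
by move=> /smoothP/(_ 0) fC x0; apply: has_ddirP; case: (Ck0 fC x0).
Qed.

Lemma sder_has f v s : smooth f ->
  has_ddir (radial_ext f) (val s) v (sder v f s).
Proof. by move=> fS; apply: smooth_has_ddir => //; apply: sphere_neq0. Qed.

Lemma sder_near (F : g -> R) f v s d : (forall x, x != 0 -> F x = radial_ext f x) ->
  has_ddir F (val s) v d -> sder v f s = d.
Proof.
move=> Ff Fd; apply: has_ddirE; apply: has_ddir_near Fd.
exact: nearv_eq_on (sphere_neq0 s).
Qed.

Lemma sder_cst c v s : sder v (fun=> c) s = 0.
Proof.
apply: (@sder_near (fun=> c)); last exact: has_ddir_cst.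
by move=> x x0; have [s' _ ->] := radial_extP (fun=> c) x0.
Qed.

Lemma sderD f h v s : smooth f -> smooth h ->
  sder v (fun s => f s + h s) s = sder v f s + sder v h s.
Proof.
move=> fS hS; apply: sder_near (has_ddirD (sder_has v s fS) (sder_has v s hS)).
by move=> x x0; rewrite (radial_ext_map2 f h +%R).
Qed.

Lemma sderM f h v s : smooth f -> smooth h ->
  sder v (fun s => f s * h s) s = f s * sder v h s + h s * sder v f s.
Proof.
move=> fS hS; rewrite -(radial_ext_val f s) -(radial_ext_val h s).
apply: sder_near (has_ddirM (sder_has v s fS) (sder_has v s hS)).
by move=> x x0; rewrite (radial_ext_map2 f h *%R).
Qed.

Lemma sderZ c f v s : smooth f -> sder v (fun s => c * f s) s = c * sder v f s.
Proof.
by move=> fS; rewrite sderM ?sder_cst ?mulr0 ?addr0 //; apply: smooth_cst.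
Qed.

Lemma sderN f v s : smooth f -> sder v (fun s => - f s) s = - sder v f s.
Proof.
move=> fS; rewrite -mulN1r -sderZ //.
by apply: eq_sder => t; rewrite mulN1r.
Qed.

Lemma sderB f h v s : smooth f -> smooth h ->
  sder v (fun s => f s - h s) s = sder v f s - sder v h s.
Proof. by move=> fS hS; rewrite sderD ?sderN //; apply: smoothN. Qed.

Lemma sder_sum (I : finType) (f : I -> sphere dot -> R) v s :
  (forall i, smooth (f i)) ->
  sder v (fun s => \sum_i f i s) s = \sum_i sder v (f i) s.
Proof.
move=> fS; apply: sder_near (has_ddir_sum (fun i => sder_has v s (fS i))).
move=> x x0; have [s' vs' ->] := radial_extP (fun s => \sum_i f i s) x0.
apply: eq_bigr => i _; have [t vt ->] := radial_extP (f i) x0.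
by congr (f i _); apply: val_inj; rewrite vt.
Qed.

(** The correction comes from differentiating the factor 1 / |x| of the radial extension; the result
    is [l] at the tangential part of [v]. *)
Lemma sder_lin (l : g -> R) v s : linp l ->
  sder v (fun s => l (val s)) s = l v - dot (val s) v * l (val s).
Proof.
move=> lL; have s0 := sphere_neq0 s.
have dV : has_ddir (fun x => (nrm x)^-1) (val s) v (- dot (val s) v).
  have n0 : nrm (val s) != 0 by rewrite sphere_nrm oner_neq0.
  have inv : is_derive (nrm (val s)) (1 : R) GRing.inv (- 1).
    apply: DeriveDef; first exact: derivableV.
    rewrite (@deriveV _ R^o id) // derive_id sphere_nrm expr1n invr1.
    exact: mulN1r.
  have := has_ddir_comp inv (has_ddir_nrm v s0).
  by rewrite sphere_nrm invr1 mul1r mulN1r.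
apply: (@sder_near (fun x => (nrm x)^-1 * l x)) => [x x0|].
  have [s' vs' ->] := radial_extP (fun s => l (val s)) x0.
  by rewrite vs' linpZ.
have := has_ddirM dV (has_ddir_lin (linR lL) (val s) v).
by rewrite sphere_nrm invr1 mul1r mulrN mulrC.
Qed.

Lemma sder_ln f v s : smooth f -> (forall s, 0 < f s) ->
  sder v (fun s => ln (f s)) s = (f s)^-1 * sder v f s.
Proof.
move=> fS f0; apply: (@sder_near (fun x => ln (radial_ext f x))) => [x x0|].
  by rewrite (radial_ext_map f (@ln R)).
rewrite -{1}(radial_ext_val f s); apply: has_ddir_comp (sder_has v s fS).
by rewrite radial_ext_val; apply: is_derive1_ln.
Qed.

Lemma sder_linv f s : smooth f -> linp (fun v => sder v f s).
Proof.
move=> /smoothP fC a x y; rewrite /sder ddirD ?sphere_neq0 //.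
by rewrite (ddirZ _ _ (fC 0)) ?sphere_neq0.
Qed.

Lemma sder_radial f s : smooth f -> sder (val s) f s = 0.
Proof.
move=> fS; apply: has_ddirE; rewrite /has_ddir.
apply: (near_eq_is_derive _ (is_derive_cst (f s) (0 : R) (1 : R))).
near=> t; have -> : val s + t *: val s = (1 + t) *: val s.
  by rewrite scalerDl scale1r.
rewrite radial_extZ ?radial_ext_val // -ltrBlDl sub0r; near: t; apply: lt_nbhsr; exact: ltrN10.
Unshelve. all: by end_near. Qed.

(** The derivative of a function homogeneous of degree 0 is homogeneous of degree -1; the factor
    [nrm x] brings it back to degree 0. *)
Lemma radial_ext_sder f v x : smooth f -> x != 0 ->
  radial_ext (sder v f) x = nrm x * ddir v (radial_ext f) x.
Proof.
move=> fS x0; have [s vs ->] := radial_extP (sder v f) x0.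
have n0 := nrm_gt0 x0; apply: has_ddirE.
have := has_ddirZ (nrm x) (smooth_has_ddir v fS x0).
rewrite /has_ddir; congr is_derive; apply/funext => t.
rewrite -(radial_extZ _ (val s + _) n0) vs scalerDr !scalerA divff ?gt_eqF //.
by rewrite scale1r mulrC.
Qed.

Lemma smooth_sder f v : smooth f -> smooth (sder v f).
Proof.
move=> fS; apply/smoothP => k.
apply: Ck_eq (CkM (Ck_nrm k) (_ : Ck k (ddir v (radial_ext f)))) => [x x0|].
  by rewrite radial_ext_sder.
by move/smoothP: fS => /(_ k.+1) [_ /(_ v)].
Qed.

Lemma sderC f v w s : smooth f ->
  sder v (sder w f) s - sder w (sder v f) s
  = dot (val s) v * sder w f s - dot (val s) w * sder v f s.
Proof.
move=> fS; have s0 := sphere_neq0 s.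
have E u z : sder u (sder z f) s =
    dot (val s) u * sder z f s + ddir u (ddir z (radial_ext f)) (val s).
  apply: (@sder_near (fun x => nrm x * ddir z (radial_ext f) x)) => [x x0|].
    by rewrite radial_ext_sder.
  have dd : has_ddir (ddir z (radial_ext f)) (val s) u
      (ddir u (ddir z (radial_ext f)) (val s)).
    apply: has_ddirP; move/smoothP: fS => /(_ 1%N) [_ /(_ z) fC].
    by case: (@Ck0 _ _ 0 _ fC _ s0).
  have := has_ddirM (has_ddir_nrm u s0) dd.
  rewrite sphere_nrm invr1 !mul1r addrC => h; apply: is_derive_eq h _.
  by rewrite -/(sder z f s); ring.
rewrite !E (schwarz v w (iffLR (smoothP f) fS 2)) //.
ring.
Qed.

End SphereCalculus.

(** * Fields of forms and multivectors *)

Section Fields.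
Context {R : realType} {g : vectType R} (dot : {dot g for idfun}).
Implicit Types (v : g) (s : sphere dot) (f : sphere dot -> R).

Section Operators.
Context {V : lmodType R}.
Implicit Types (F G : sphere dot -> seq V -> R^o) (u : seq V) (x : V).

Definition smoothF F := forall u, smooth (fun s => F s u).
Definition fder v F s : seq V -> R^o := fun u => sder v (fun s => F s u) s.
Definition AltF F := forall s, Alt (F s).

Lemma smoothFD F G : smoothF F -> smoothF G -> smoothF (fun s => F s + G s).
Proof. by move=> FS GS u; apply: smoothD. Qed.
Lemma smoothFM f F : smooth f -> smoothF F -> smoothF (fun s => f s *: F s).
Proof. by move=> fS FS u; apply: smoothM. Qed.
Lemma smoothFZ (c : R) F : smoothF F -> smoothF (fun s => c *: F s).
Proof. by move=> FS u; apply: smoothZ. Qed.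
Lemma smoothF_cst (a : seq V -> R^o) : smoothF (fun=> a).
Proof. by move=> u; apply: smooth_cst. Qed.
Lemma smoothF_sum (I : finType) (F : I -> sphere dot -> seq V -> R^o) :
  (forall i, smoothF (F i)) -> smoothF (fun s => \sum_i F i s).
Proof.
move=> FS u; have -> : (fun s => (\sum_i F i s) u) = (fun s => \sum_i F i s u).
  by apply/funext => s; rewrite fct_sumE.
by apply: smooth_sum => i; apply: FS.
Qed.
Lemma smoothF_contract x F : smoothF F -> smoothF (fun s => contract x (F s)).
Proof. by move=> FS u; apply: FS. Qed.
Lemma smoothF_ext p F : smoothF F -> smoothF (fun s => ext p (F s)).
Proof.
move=> FS u; elim: u F FS => [|x u IHu] F FS /=; first exact: smooth_cst.
by apply: smoothB; [exact: smoothZ|apply: IHu; exact: smoothF_contract].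
Qed.

Lemma fderD v F G s : smoothF F -> smoothF G ->
  fder v (fun s => F s + G s) s = fder v F s + fder v G s.
Proof. by move=> FS GS; apply/funext => u; apply: sderD. Qed.
Lemma fderM v f F s : smooth f -> smoothF F ->
  fder v (fun s => f s *: F s) s = f s *: fder v F s + sder v f s *: F s.
Proof.
move=> fS FS; apply/funext => u; rewrite /fder.
rewrite -[RHS]/(f s * sder v (fun s => F s u) s + sder v f s * F s u).
by rewrite [_ * F s u]mulrC; apply: sderM.
Qed.
Lemma fderZ v (c : R) F s : smoothF F ->
  fder v (fun s => c *: F s) s = c *: fder v F s.
Proof. by move=> FS; apply/funext => u; apply: sderZ. Qed.
Lemma fder_sum v (I : finType) (F : I -> sphere dot -> seq V -> R^o) s :
  (forall i, smoothF (F i)) ->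
  fder v (fun s => \sum_i F i s) s = \sum_i fder v (F i) s.
Proof.
move=> FS; apply/funext => u; rewrite fct_sumE.
rewrite -sder_sum; last by move=> i; apply: FS.
by apply: eq_sder => t; rewrite fct_sumE.
Qed.
Lemma fder_contract v x F s :
  fder v (fun s => contract x (F s)) s = contract x (fder v F s).
Proof. by []. Qed.
Lemma fder_ext v p F s : smoothF F ->
  fder v (fun s => ext p (F s)) s = ext p (fder v F s).
Proof.
move=> FS; apply/funext => u; elim: u F FS => [|x u IHu] F FS.
  exact: sder_cst.
have cS := smoothF_contract x FS.
rewrite /fder /= sderB; [|exact: smoothZ|exact: (smoothF_ext p cS)].
by rewrite sderZ //; congr (_ - _); apply: IHu.
Qed.

Lemma smoothF_fder v F : smoothF F -> smoothF (fder v F).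
Proof. by move=> FS u; apply: smooth_sder. Qed.

Lemma Alt_fder v F s : smoothF F -> AltF F -> Alt (fder v F s).
Proof.
move=> FS FA; split=> [u w c x y|u w x]; rewrite /fder.
  rewrite -sderZ // -sderD //; last exact: smoothZ.
  by apply: eq_sder => t; rewrite (FA t).1.
rewrite -[RHS](sder_cst 0 v s).
by apply: eq_sder => t; rewrite (FA t).2.
Qed.

Lemma fder_size v F s u : (forall s, F s u = 0) -> fder v F s u = 0.
Proof.
move=> F0; rewrite /fder -[RHS](sder_cst 0 v s); apply: eq_sder => t.
exact: F0.
Qed.

Lemma fder_linv F s u : smoothF F -> linp (fun v => fder v F s u).
Proof. by move=> FS; apply: sder_linv. Qed.

Lemma fder_basis v F s : smoothF F ->
  fder v F s = \sum_i bcov i v *: fder (bvec i) F s.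
Proof.
move=> FS; apply/funext => u; rewrite (linp_basis v (fder_linv s u FS)) fct_sumE.
by [].
Qed.

Lemma fder_radial F s : smoothF F -> fder (val s) F s = 0.
Proof. by move=> FS; apply/funext => u; apply: sder_radial. Qed.

Lemma eq_fder v F G s : (forall s, F s = G s) -> fder v F s = fder v G s.
Proof. by move=> /funext ->. Qed.
End Operators.

Section StarFields.
Context {V W : lmodType R} {n : nat} (b : 'I_n -> V) (c : 'I_n -> W).
Variable mu : seq V -> R^o.
Implicit Types (F : sphere dot -> seq W -> R^o).

Lemma smoothF_star m F : smoothF F -> smoothF (fun s => star b c mu m (F s)).
Proof.
elim: m F => [|m IHm] F FS.
  by apply: smoothFM; [apply: FS|apply: smoothF_cst].
apply: smoothFZ; apply: smoothF_sum => i; apply: smoothF_contract.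
by apply: IHm; apply: smoothF_contract.
Qed.

(** The transform is built from constant tensors of g. *)
Lemma fder_star m v F s : smoothF F ->
  fder v (fun s => star b c mu m (F s)) s = star b c mu m (fder v F s).
Proof.
elim: m F => [|m IHm] F FS.
  rewrite (@fderM _ v (fun s => F s [::]) (fun=> mu)) //; last exact: smoothF_cst.
  rewrite (_ : fder v (fun=> mu) s = 0) ?scaler0 ?add0r //.
  by apply/funext => u; apply: sder_cst.
have cS i := smoothF_contract (c i) FS.
rewrite -[LHS]/(fder v (fun s => m.+1%:R^-1 *: \sum_i
  contract (b i) (star b c mu m (contract (c i) (F s)))) s).
rewrite fderZ; last first.
  by apply: smoothF_sum => i; apply: smoothF_contract; apply: smoothF_star.
rewrite starS fder_sum; last first.
  by move=> i; apply: smoothF_contract; apply: smoothF_star.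
congr (_ *: _); apply: eq_bigr => i _; rewrite fder_contract.
by rewrite IHm // fder_contract.
Qed.

Lemma smoothF_hodge F : smoothF F -> smoothF (fun s => hodge b c mu (F s)).
Proof. by move=> FS u; apply: smoothF_star. Qed.

Lemma fder_hodge v F s : smoothF F ->
  fder v (fun s => hodge b c mu (F s)) s = hodge b c mu (fder v F s).
Proof.
by move=> FS; apply/funext => u; rewrite /hodge -fder_star.
Qed.
End StarFields.

Section Wedge.
Context {W : lmodType R}.
Implicit Types (F G : sphere dot -> seq W -> R^o).

Lemma smoothF_wedge F G : smoothF F -> smoothF G ->
  smoothF (fun s => wedge (F s) (G s)).
Proof.
move=> FS GS u; apply: smooth_sum => m; apply: smoothZ; apply: smoothM.
  exact: FS.
exact: GS.
Qed.

Lemma fder_wedge v F G s : smoothF F -> smoothF G ->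
  fder v (fun s => wedge (F s) (G s)) s =
  wedge (fder v F s) (G s) + wedge (F s) (fder v G s).
Proof.
move=> FS GS; apply/funext => u.
rewrite -[RHS]/(wedge (fder v F s) (G s) u + wedge (F s) (fder v G s) u).
rewrite /fder /wedge -shuffle_sumD /shuffle_sum sder_sum; last first.
  move=> m; apply: smoothZ; apply: smoothM; [exact: FS|exact: GS].
apply: eq_bigr => m _; have FGS := smoothM (FS (mask m u)) (GS (mask (map negb m) u)).
rewrite sderZ // sderM; [|exact: FS|exact: GS]; rewrite addrC.
by congr (_ * (_ + _)); rewrite mulrC.
Qed.
End Wedge.
End Fields.

(** * Projection along a unit direction *)

Section Projection.
Context {R : realType} {V : lmodType R}.

Lemma contract_ext1 (p : V -> R) (e : V) (a : seq V -> R^o) : p e = 1 ->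
  contract e (ext p a) = a - ext p (contract e a).
Proof. by move=> pe; rewrite contract_ext pe scale1r. Qed.

(** As [p e = 1], the operator i_e(p /\ a) in [a] is the pullback by the projection along [e]; this
    is the induction step of that fact. *)
Lemma contract_proj (p : V -> R) (e x : V) (a : seq V -> R^o) :
  Alt a -> linp p -> p e = 1 ->
  contract x (contract e (ext p a)) =
  contract e (ext p (contract (x - p x *: e) a)).
Proof.
move=> aA pL pe; rewrite !contract_ext1 // -scaleNr contractDl // contractZl //.
rewrite scaleNr !contractB contract_ext contractZ contractxx // scaler0 subr0.
by rewrite (contractC x e) // extN opprK opprD addrA.
Qed.
End Projection.

(** * Tensor fields on the sphere in ambient coordinates *)

Section SphereTensors.
Context {R : realType} {g : vectType R} (dot : {dot g for idfun}).
Implicit Types (v x : g) (s : sphere dot) (f : sphere dot -> R).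
Implicit Types (P Q : mvfield dot) (w : dfield dot).

Local Notation n := (\dim {:g}).

Definition pair (p : covector g) (x : g) : R := p x.

Lemma pairL p : linp (pair p). Proof. exact: linp_cov. Qed.
Lemma pairR x : linp (pair^~ x).
Proof. by move=> a p q; rewrite /pair add_lfunE scale_lfunE. Qed.

Definition flatv (x : g) : covector g := flat dot x.

Lemma flatE x y : flatv x y = dot x y.
Proof.
rewrite /flatv /flat.
have e z : linfun (fun v => dot z v : R^o) = linfun (linR (linp_dot dot z)) by [].
have lin : linear (fun z => linfun (fun v => dot z v : R^o) : covector g).
  move=> a z t; apply/lfunP => v.
  by rewrite add_lfunE scale_lfunE !e !lfunE /= dotP.
pose l : {linear g -> covector g} :=
  HB.pack (fun z => linfun (fun v => dot z v : R^o) : covector g)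
   (GRing.isLinear.Build R g (covector g) *:%R _ lin).
rewrite -[linfun (fun x => linfun _)]/(linfun l) lfunE /=.
by rewrite e lfunE.
Qed.

Lemma flatP a x y : flatv (a *: x + y) = a *: flatv x + flatv y.
Proof. by rewrite /flatv linearP. Qed.

Lemma sdfunE f s v : smooth f -> sdfun f s v = sder v f s.
Proof.
move=> fS; rewrite /sdfun /dfun -[linfun _]/(linfun (linR (sder_linv s fS))).
by rewrite lfunE.
Qed.

Lemma sdfun_sum f s : smooth f ->
  sdfun f s = \sum_i sder (bvec i) f s *: bcov i.
Proof.
move=> fS; rewrite [LHS]bcov_sum.
by apply: eq_bigr => i _; rewrite sdfunE.
Qed.

Definition sflat s : covector g := flatv (val s).

Definition tangent_mv P := forall s, contract (sflat s) (P s) = 0.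
Definition tangent_form w := forall s, contract (val s) (w s) = 0.

(** The covectors that vanish on the tangent space at s are the multiples of [sflat s], so tangency
    is a single contraction. *)
Lemma kvectorP (k : int) P : kvector k P <->
  [/\ forall s u, (size u)%:Z != k -> P s u = 0, AltF P, tangent_mv P & smoothF P].
Proof.
split=> [[Pk Pt PS]|[Pk PA Pt PS]].
  have /(_ _)/altform_Alt aP := Pk.
  split=> // s; [by case: (aP s)|by case: (aP s)|].
  apply/funext => u; apply: Pt => v; rewrite /sflat flatE => ->.
  by [].
split=> // [s|s p u pt]; first by apply/altform_Alt; split=> //; apply: Pk.
have -> : p = p (val s) *: sflat s.
  apply/lfunP => v; rewrite scale_lfunE flatE.
  have := pt (tproj s v); rewrite /tproj (linpB _ _ (linp_dot _ _)).
  rewrite (linpZ _ _ (linp_dot _ _)) sphere_dot mulr1 subrr => /(_ erefl).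
  rewrite (linpB _ _ (linp_cov p)) (linpZ _ _ (linp_cov p)) => /eqP.
  by rewrite subr_eq0 => /eqP ->; rewrite [RHS]mulrC.
rewrite -[LHS]/(contract _ (P s) u) contractZl // Pt.
by rewrite scaler0.
Qed.

Lemma kformP (k : int) w : kform k w <->
  [/\ forall s u, (size u)%:Z != k -> w s u = 0, AltF w, tangent_form w & smoothF w].
Proof.
split=> [[Pk Pt PS]|[Pk PA Pt PS]].
  have /(_ _)/altform_Alt aP := Pk.
  split=> // s; [by case: (aP s)|by case: (aP s)|].
  by apply/funext => u; apply: Pt.
split=> // [s|s u]; first by apply/altform_Alt; split=> //; apply: Pk.
by rewrite -[LHS]/(contract _ (w s) u) Pt.
Qed.

(** Expanding the differentials in the dual basis gives the coordinate formula; since [P] is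
    homogeneous, only [v] of length [k] contributes to the second half and the sign leaves the
    shuffle sum. *)
Lemma sbracketE (k : nat) P Q s :
  (forall s u, size u != k -> P s u = 0) -> AltF P -> AltF Q ->
  smoothF P -> smoothF Q ->
  sbracket P Q s =
  \sum_i wedge (contract (bcov i) (P s)) (fder (bvec i) Q s) +
  (-1) ^+ k *: \sum_i wedge (fder (bvec i) P s) (contract (bcov i) (Q s)).
Proof.
move=> Pk PA QA PS QS; apply/funext => u; rewrite /sbracket /schouten.
rewrite !fctE !fct_sumE.
have -> : \sum_i wedge (contract (bcov i) (P s)) (fder (bvec i) Q s) u =
   shuffle_sum (fun r t => \sum_i P s (bcov i :: r) * fder (bvec i) Q s t) u.
  by rewrite shuffle_sum_sum.
have -> : \sum_i wedge (fder (bvec i) P s) (contract (bcov i) (Q s)) u =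
   shuffle_sum (fun r t => \sum_i fder (bvec i) P s r * Q s (bcov i :: t)) u.
  by rewrite shuffle_sum_sum.
rewrite scale_regE -shuffle_sumZ -shuffle_sumD.
apply: eq_shuffle_sum => v w _; rewrite !radial_ext_val.
have dE (F : mvfield dot) t : smoothF F ->
    dfun (fun y => radial_ext F y t) (val s) =
    \sum_i fder (bvec i) F s t *: bcov i.
  move=> FS; rewrite -sdfun_sum; last exact: FS.
  rewrite (_ : (fun y => _) = radial_ext (fun s => F s t)) //.
  by apply/funext => y; rewrite radial_ext_fun.
have cE (F : mvfield dot) (G : mvfield dot) t r : AltF F -> smoothF G ->
    F s (dfun (fun y => radial_ext G y t) (val s) :: r) =
    \sum_i fder (bvec i) G s t * F s (bcov i :: r).
  move=> FA GS; rewrite dE // -[LHS]/(contract _ (F s) r) contract_suml //.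
  by rewrite fct_sumE; apply: eq_bigr => i _; rewrite contractZl.
rewrite !cE //; congr (_ + _).
  by apply: eq_bigr => i _; rewrite mulrC.
have [->//|vk] := eqVneq (size v) k.
rewrite !big1 ?mulr0 // => i _;
 by rewrite fder_size ?mul0r // => s'; rewrite Pk.
Qed.

(* [i(s)(s^flat /\ a)] is the pullback of [a] by the projection to T_sS. *)
Lemma pullbackE s (a : seq g -> R^o) u : Alt a ->
  a (map (tproj s) u) = contract (val s) (ext (pair (sflat s)) a) u.
Proof.
have fs : pair (sflat s) (val s) = 1 by rewrite /pair flatE sphere_dot.
elim: u a => [|x u IHu] a aA; first by rewrite /contract /= fs mul1r subr0.
rewrite [map _ _]/= -[LHS]/(contract (tproj s x) a (map (tproj s) u)).
rewrite IHu; last exact: Alt_contract.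
rewrite -[RHS]/(contract x (contract (val s) (ext _ a)) u); congr (_ u).
rewrite (contract_proj x aA (pairL _) fs).
by rewrite (_ : pair (sflat s) x = dot (val s) x) // /pair flatE.
Qed.

End SphereTensors.

(** * The transform of g and the operators of the normal direction *)

Section FormOperations.
Context {R : realType} {g : vectType R} (dot : {dot g for idfun}).
Implicit Types (v x : g) (s : sphere dot) (f : sphere dot -> R).
Implicit Types (P Q : mvfield dot) (w : dfield dot).
Implicit Types (a : seq (covector g) -> R^o).

Local Notation n := (\dim {:g}).
Local Notation covec := (covector g).

Definition mu : seq g -> R^o := volume (@pair R g) (fun i => bcov i) (enum 'I_n).
Definition comu : seq covec -> R^o :=
  covolume (@pair R g) (fun i => bvec i) (enum 'I_n).
Definition hod : (seq covec -> R^o) -> seq g -> R^o :=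
  hodge (fun i => bvec i) (fun i => bcov i) mu.
Definition cohod : (seq g -> R^o) -> seq covec -> R^o :=
  hodge (fun i => bcov i) (fun i => bvec i) comu.

Let prL (p : covec) : linp (pair p). Proof. exact: pairL. Qed.
Let prR (x : g) : linp (pair^~ x). Proof. exact: pairR. Qed.
Let prbc (x : g) : x = \sum_i pair (bcov i) x *: bvec i.
Proof. exact: bvec_sum. Qed.
Let prcb (p : covec) : p = \sum_i pair p (bvec i) *: bcov i.
Proof. exact: bcov_sum. Qed.
Let prE (i j : 'I_n) : pair (bcov i) (bvec j) = (i == j)%:R.
Proof. exact: bcov_bvec. Qed.
Let enumP (i : 'I_n) : i \in enum 'I_n. Proof. exact: mem_enum. Qed.
Let sizeP : size (enum 'I_n) = n. Proof. exact: size_enum_ord. Qed.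

Lemma Alt_mu : Alt mu. Proof. exact: Alt_volume. Qed.
Lemma Alt_comu : Alt comu. Proof. exact: Alt_volume. Qed.
Lemma mu_size u : size u != n -> mu u = 0.
Proof. by rewrite -{1}sizeP; apply: volume_size. Qed.
Lemma comu_size u : size u != n -> comu u = 0.
Proof. by move=> nu; apply: volume_size; rewrite size_rev sizeP. Qed.

Lemma Alt_hod a : Alt (hod a). Proof. exact: Alt_hodge Alt_mu a. Qed.
Lemma Alt_cohod (w : seq g -> R^o) : Alt (cohod w).
Proof. exact: Alt_hodge Alt_comu w. Qed.

Lemma hod_ext x a : Alt a -> hod (ext (pair^~ x) a) = contract x (hod a).
Proof. exact: (hodge_ext prbc mu_size Alt_mu). Qed.

Lemma hod_contract p a : Alt a -> hod (contract p a) = ext (pair p) (hod a).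
Proof.
apply: (hodge_contract prcb mu_size) => q.
exact: (volume_top prR prcb).
Qed.

Lemma hodK a : Alt a -> cohod (hod a) = a.
Proof. exact: (hodgeK prL prR prcb prE (enum_uniq _) enumP sizeP). Qed.

Lemma cohodK (w : seq g -> R^o) : Alt w -> hod (cohod w) = w.
Proof.
move=> wA.
have prE' (i j : 'I_n) : pair (bcov j) (bvec i) = (i == j)%:R.
  by rewrite prE eq_sym.
(* The inversion formula with vectors and covectors exchanged, for the reversed enumeration: its
   volume is [comu], and reversing once more makes its covolume [mu]. *)
have := @hodgeK _ _ _ _ (fun x p => @pair R g p x) (fun i => bcov i) (fun i => bvec i)
  prR prL prbc prE' (rev (enum 'I_n)).
rewrite rev_uniq enum_uniq size_rev sizeP => /(_ isT).
have revP i : i \in rev (enum 'I_n) by rewrite mem_rev enumP.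
move=> /(_ revP erefl w wA); rewrite /covolume revK.
exact.
Qed.

Lemma hod_is_linear : linear hod. Proof. exact: hodge_is_linear. Qed.
Lemma hodP (k : R) a b : hod (k *: a + b) = k *: hod a + hod b.
Proof. exact: hod_is_linear. Qed.
HB.instance Definition _ :=
  GRing.isLinear.Build R (seq covec -> R^o) (seq g -> R^o) *:%R hod hod_is_linear.
Lemma cohod_is_linear : linear cohod. Proof. exact: hodge_is_linear. Qed.
HB.instance Definition _ :=
  GRing.isLinear.Build R (seq g -> R^o) (seq covec -> R^o) *:%R cohod cohod_is_linear.

Lemma hodD a b : hod (a + b) = hod a + hod b. Proof. exact: linearD. Qed.
Lemma hodN a : hod (- a) = - hod a. Proof. exact: linearN. Qed.
Lemma hodB a b : hod (a - b) = hod a - hod b. Proof. exact: linearB. Qed.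
Lemma hodZ (k : R) a : hod (k *: a) = k *: hod a. Proof. exact: linearZ. Qed.
Lemma hod_sum (I : finType) (a : I -> seq covec -> R^o) :
  hod (\sum_i a i) = \sum_i hod (a i).
Proof. exact: linear_sum. Qed.

Lemma smoothF_hod P : smoothF P -> smoothF (fun s => hod (P s)).
Proof. exact: smoothF_hodge. Qed.
Lemma fder_hod v P s : smoothF P ->
  fder v (fun s => hod (P s)) s = hod (fder v P s).
Proof. exact: fder_hodge. Qed.
Lemma smoothF_cohod w : smoothF w -> smoothF (fun s => cohod (w s)).
Proof. exact: smoothF_hodge. Qed.

(** Because s is a unit vector, [cs s (es s a) + es s (cs s a) = a]. So [cs] inverts [es] on tangent
    multivectors, and [es] after [cs] is the projection that corresponds under [hod] to pulling a
    form back to the sphere. *)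
Definition es s a := ext (pair^~ (val s)) a.
Definition cs s a := contract (sflat s) a.

Lemma Alt_es s a : Alt a -> Alt (es s a).
Proof. by apply: Alt_ext; apply: pairR. Qed.
Lemma Alt_cs s a : Alt a -> Alt (cs s a).
Proof. exact: Alt_contract. Qed.

Lemma sflat1 s : pair (sflat s) (val s) = 1.
Proof. by rewrite /pair flatE sphere_dot. Qed.

Lemma cs_es s a : cs s (es s a) = a - es s (cs s a).
Proof. exact: (contract_ext1 a (sflat1 s)). Qed.

Lemma es_sum s a : es s a = \sum_i bcov i (val s) *: ext (pair^~ (bvec i)) a.
Proof.
rewrite -ext_suml; apply: ext_eqp => p.
exact: (linp_basis (val s) (linp_cov p)).
Qed.

Lemma smooth_coord (p : covec) : smooth (fun s : sphere dot => p (val s)).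
Proof. exact: (smooth_lin dot (linp_cov p)). Qed.

Lemma smoothF_es P : smoothF P -> smoothF (fun s => es s (P s)).
Proof.
move=> PS; rewrite (_ : (fun s => es s (P s)) = (fun s =>
  \sum_i bcov i (val s) *: ext (pair^~ (bvec i)) (P s))); last first.
  by apply/funext => s; rewrite es_sum.
apply: smoothF_sum => i; apply: smoothFM; first exact: smooth_coord.
exact: smoothF_ext.
Qed.

Lemma sder_coord (p : covec) v s :
  sder v (fun s : sphere dot => p (val s)) s = p (tproj s v).
Proof.
by rewrite (sder_lin _ _ (linp_cov p)) /tproj (linpB _ _ (linp_cov p))
  (linpZ _ _ (linp_cov p)).
Qed.

(** Leibniz rule, in which the position vector has derivative [tproj s v], its radial extension
    being x / |x|. *)
Lemma fder_es v P s : smoothF P ->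
  fder v (fun s => es s (P s)) s =
  ext (pair^~ (tproj s v)) (P s) + es s (fder v P s).
Proof.
move=> PS; rewrite (eq_fder _ _ (fun s => es_sum s (P s))).
rewrite fder_sum; last first.
  by move=> i; apply: smoothFM; [exact: smooth_coord|exact: smoothF_ext].
under eq_bigr => i _.
  rewrite (@fderM _ _ _ _ _ (fun s => bcov i (val s)) (fun s => ext _ (P s)));
    [|exact: smooth_coord|exact: smoothF_ext].
  rewrite fder_ext // sder_coord; over.
rewrite big_split /= -es_sum addrC; congr (_ + _).
rewrite -ext_suml; apply: ext_eqp => p.
by rewrite -(linp_basis (tproj s v) (linp_cov p)).
Qed.

(** Differentiating the tangency condition shows how far the derivative of a tangent multivector
    leaves the tangent spaces: this is the second fundamental form of the sphere. *)
Lemma fder_csP v P s : smoothF P -> AltF P -> tangent_mv P ->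
  cs s (fder v P s) = - contract (flatv dot (tproj s v)) (P s).
Proof.
move=> PS PA Pt.
have E t : cs t (P t) = \sum_i dot (val t) (bvec i) *: contract (bcov i) (P t).
  rewrite /cs {1}(bcov_sum (sflat t)) contract_suml //.
  by apply: eq_bigr => i _; rewrite contractZl // flatE.
have S i : smooth (fun t : sphere dot => dot (val t) (bvec i)).
  exact: (smooth_lin dot (linp_dotl dot (bvec i))).
have : fder v (fun t => cs t (P t)) s = 0.
  rewrite (eq_fder _ _ Pt); apply/funext => u; exact: sder_cst.
rewrite (eq_fder _ _ E) fder_sum; last first.
  by move=> i; apply: smoothFM => //; apply: smoothF_contract.
under eq_bigr => i _.
  rewrite (@fderM _ _ _ _ _ (fun s => dot (val s) (bvec i))
    (fun s => contract _ (P s))) //; last exact: smoothF_contract.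
  rewrite fder_contract (sder_lin _ _ (linp_dotl dot (bvec i)))
   -(linpZ _ _ (linp_dotl dot (bvec i))) -(linpB _ _ (linp_dotl dot (bvec i))).
  over.
rewrite big_split /= => /eqP; rewrite addr_eq0 => /eqP h.
have FA := Alt_fder v s PS PA.
rewrite /cs {1}(bcov_sum (sflat s)) contract_suml //.
transitivity (\sum_i dot (val s) (bvec i) *: contract (bcov i) (fder v P s)).
  by apply: eq_bigr => i _; rewrite contractZl // flatE.
rewrite h; congr (- _).
rewrite [in RHS](bcov_sum (flatv dot (tproj s v))) contract_suml //.
by apply: eq_bigr => i _; rewrite contractZl // flatE.
Qed.

End FormOperations.

(** * Sums over the arguments as exterior products *)

Section FormSums.
Context {R : realType} {V : lmodType R} {n : nat}.
Variables (c : 'I_n -> V -> R) (b : 'I_n -> V).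
Hypothesis cb : forall x, x = \sum_i c i x *: b i.

Lemma alternating_sumE (F : 'I_n -> seq V -> R^o) u :
  \sum_(i < size u) (-1) ^+ i * \sum_j c j (nth 0 u i) * F j (take i u ++ drop i.+1 u)
  = \sum_j ext (c j) (F j) u.
Proof.
elim: u F => [|x u IHu] F; first by rewrite big_ord0 big1.
transitivity (\sum_j c j x * F j u - \sum_(i < size u) (-1) ^+ i *
    \sum_j c j (nth 0 u i) * contract x (F j) (take i u ++ drop i.+1 u)).
  rewrite big_ord_recl; congr (_ + _); first by rewrite /= mul1r drop0.
  by rewrite -sumrN; apply: eq_bigr => i _; rewrite exprS mulN1r mulNr.
by rewrite (IHu (fun j => contract x (F j))) -sumrB.
Qed.

(** Both sides are the derivation of the exterior algebra induced by [A]; they obey the same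
    recursion on the arguments. *)
Lemma derivation_sumE (A : V -> V) (a : seq V -> R^o) u : Alt a ->
  (forall x, A x = \sum_i c i x *: A (b i)) ->
  \sum_(i < size u) a (set_nth 0 u i (A (nth 0 u i)))
  = \sum_j ext (c j) (contract (A (b j)) a) u.
Proof.
move=> aA AL; elim: u a aA => [|x u IHu] a aA; first by rewrite big_ord0 big1.
transitivity (contract (A x) a u +
    \sum_(i < size u) contract x a (set_nth 0 u i (A (nth 0 u i)))).
  by rewrite big_ord_recl.
rewrite (IHu (contract x a)); last exact: Alt_contract.
rewrite AL contract_suml // fct_sumE -big_split.
apply: eq_bigr => j _; rewrite contractZl //=; congr (_ + _).
by rewrite [in RHS]contractC // extN !fctE opprK.
Qed.
End FormSums.

(** * Exterior derivative, Lie derivative and divergence *)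

Section ExteriorCalculus.
Context {R : realType} {g : vectType R} (dot : {dot g for idfun}).
Implicit Types (v x : g) (s : sphere dot) (f : sphere dot -> R).
Implicit Types (P Q : mvfield dot) (w : dfield dot).
Implicit Types (a : seq (covector g) -> R^o).

Local Notation n := (\dim {:g}).
Local Notation covec := (covector g).

Lemma ext_dE w s : smoothF w ->
  ext_d (radial_ext w) (val s) =
  \sum_j ext (pair (bcov j)) (fder (bvec j) w s).
Proof.
move=> wS; apply/funext => u; rewrite fct_sumE.
rewrite -(alternating_sumE (fun j => pair (bcov j))).
apply: eq_bigr => i _; congr (_ * _); set t := _ ++ _.
transitivity (fder (nth 0 u i) w s t).
  by rewrite /fder /sder; congr ddir; apply/funext => y; rewrite radial_ext_fun.
by rewrite (fder_basis _ _ wS) fct_sumE.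
Qed.

Definition smoothV (X : sphere dot -> g) := forall p : covec, smooth (fun s => p (X s)).

Definition vder v (X : sphere dot -> g) s : g :=
  \sum_i sder v (fun s => bcov i (X s)) s *: bvec i.

Lemma cov_vder (p : covec) v X s : smoothV X ->
  p (vder v X s) = sder v (fun s => p (X s)) s.
Proof.
move=> XS; rewrite /vder (linp_sum _ (linp_cov p)).
transitivity (sder v (fun s => \sum_i bcov i (X s) * p (bvec i)) s).
  rewrite sder_sum => [|i]; last by apply: smoothM; [exact: XS|exact: smooth_cst].
  apply: eq_bigr => i _; rewrite (linpZ _ _ (linp_cov p)) mulrC -sderZ //.
  by apply: eq_sder => t; rewrite mulrC.
by apply: eq_sder => t; rewrite -(linp_basis _ (linp_cov p)).
Qed.

Lemma vder_basis v X s : smoothV X ->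
  vder v X s = \sum_i bcov i v *: vder (bvec i) X s.
Proof.
move=> XS; rewrite [LHS]bvec_sum; apply: etrans _ (esym (bvec_sum _)).
apply: eq_bigr => j _; congr (_ *: _); rewrite cov_vder //.
rewrite (linp_sum _ (linp_cov _)) (linp_basis v (sder_linv s (XS _))).
by apply: eq_bigr => i _; rewrite (linpZ _ _ (linp_cov _)) cov_vder.
Qed.

Lemma lie_formE X w s : smoothV X -> smoothF w -> AltF w ->
  lie_form (radial_ext X) (radial_ext w) (val s) =
  fder (X s) w s
  + \sum_j ext (pair (bcov j)) (contract (vder (bvec j) X s) (w s)).
Proof.
move=> XS wS wA; apply/funext => u.
rewrite /lie_form !radial_ext_val fctE fct_sumE; congr (_ + _).
  by rewrite /fder /sder; congr ddir; apply/funext => y; rewrite radial_ext_fun.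
rewrite -(@derivation_sumE _ _ _ (fun j => pair (bcov j)) (fun j => bvec j)
  (fun v => vder v X s)) //; last by move=> v; apply: vder_basis.
apply: eq_bigr => i _; congr (w s (set_nth _ _ _ _)).
rewrite /ddirv /vder; apply: eq_bigr => j _; congr (_ *: _).
rewrite /sder; congr ddir; apply/funext => y.
have [->|y0] := eqVneq y 0; first by rewrite !radial_ext0 linear0.
by rewrite (radial_ext_map X (fun x => bcov j x)).
Qed.

(* The divergence of multivectors; [hod] turns it into the exterior derivative. *)
Definition bd P s : seq covec -> R^o :=
  \sum_i contract (bcov i) (fder (bvec i) P s).

Lemma Alt_bd P s : smoothF P -> AltF P -> Alt (bd P s).
Proof.
by move=> PS PA; apply: Alt_sum => i; apply: Alt_contract; apply: Alt_fder.
Qed.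

Lemma smoothF_bd P : smoothF P -> smoothF (bd P).
Proof.
by move=> PS; apply: smoothF_sum => i; apply: smoothF_contract; apply: smoothF_fder.
Qed.

(** The pullback is i_s(s^flat /\ .), and [hod] exchanges the two kinds of operators in it. *)
Lemma pullback_hod s a (w : g -> seq g -> R^o) : Alt a -> w (val s) = hod a ->
  pullback (dot := dot) w s = hod (es s (cs s a)).
Proof.
move=> aA wE; apply/funext => u; rewrite /pullback wE pullbackE; last exact: Alt_hod.
rewrite /es hod_ext ?hod_contract //; exact: Alt_cs.
Qed.

Lemma sd_hod P s : smoothF P -> AltF P ->
  sd (fun s => hod (P s)) s = hod (es s (cs s (bd P s))).
Proof.
move=> PS PA; apply: pullback_hod; first exact: Alt_bd.
rewrite ext_dE; last exact: smoothF_hod.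
rewrite /bd hod_sum; apply: eq_bigr => i _.
by rewrite fder_hod // hod_contract //; apply: Alt_fder.
Qed.

(** The coordinate formula for the Lie derivative [X, P] of a multivector. *)
Definition lied (X : sphere dot -> g) P s : seq covec -> R^o :=
  fder (X s) P s - \sum_j ext (pair^~ (vder (bvec j) X s)) (contract (bcov j) (P s)).

(** The trace of the derivative of the radial extension; for tangent X it is the divergence for the
    standard volume form of the sphere, by [slie_bm]. *)
Definition divg (X : sphere dot -> g) s : R := \sum_j bcov j (vder (bvec j) X s).

(** The terms e^j /\ i(D_j X) of the Lie derivative of a form become i(e^j)(D_j X /\ P) under [hod].
    The antiderivation rule splits them into the trace [divg X] and the correction terms of
    [lied]. *)
Lemma slie_hod X P s : smoothV X -> smoothF P -> AltF P ->
  slie X (fun s => hod (P s)) s =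
  hod (es s (cs s (lied X P s + divg X s *: P s))).
Proof.
move=> XS PS PA.
have lA : Alt (lied X P s + divg X s *: P s).
  apply: AltD; last exact: AltZ.
  apply: AltB; first exact: Alt_fder.
  by apply: Alt_sum => j; apply: Alt_ext; [exact: pairR|exact: Alt_contract].
apply: pullback_hod => //; rewrite lie_formE //; first last.
- by move=> t; apply: Alt_hod.
- exact: smoothF_hod.
rewrite fder_hod // hodD /lied hodB hodZ hod_sum -addrA; congr (_ + _).
rewrite /divg scaler_suml -sumrN -big_split; apply: eq_bigr => j _ /=.
rewrite -hod_ext // -hod_contract; last by apply: Alt_ext => //; apply: pairR.
by rewrite contract_ext hodB hodZ addrC.
Qed.

(** The sign comes from i(X /\ Y) = i_Y i_X, whereas [hod] turns wedging with X /\ Y into i_X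
    i_Y. *)
Lemma iL_hod (L : mvfield dot) a s : (forall u, size u != 2%N -> L s u = 0) ->
  Alt (L s) -> Alt a -> icontract (L s) (hod a) = - hod (wedge (L s) a).
Proof.
move=> L2 LA aA; rewrite (wedge_deg2 (pr := @pair R g) bcov_sum) //.
rewrite hodZ hod_sum -scalerN -sumrN; apply/funext => u.
rewrite /icontract fctE fct_sumE scale_regE; congr (_ * _).
apply: eq_bigr => i _; rewrite hod_sum fctE fct_sumE -sumrN.
apply: eq_bigr => j _; rewrite hodZ !fctE.
rewrite !hod_ext //; last by apply: Alt_ext => //; apply: pairR.
rewrite contractC; last exact: Alt_hod.
by rewrite fctE scalerN opprK.
Qed.

End ExteriorCalculus.

(** * Linearity and degree of wedge products *)

Section WedgeLemmas.
Context {R : realType} {W : lmodType R}.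
Implicit Types (a b : seq W -> R^o).

Lemma wedgeDr a b1 b2 : wedge a (b1 + b2) = wedge a b1 + wedge a b2.
Proof.
apply/funext => u; rewrite -[RHS]/(wedge a b1 u + wedge a b2 u) /wedge -shuffle_sumD.
by apply: eq_shuffle_sum => v w _; rewrite -mulrDr.
Qed.
Lemma wedgeZr (k : R) a b : wedge a (k *: b) = k *: wedge a b.
Proof.
apply/funext => u; rewrite -[RHS]/(k * wedge a b u) /wedge -shuffle_sumZ.
by apply: eq_shuffle_sum => v w _; rewrite mulrCA.
Qed.
Lemma wedgeNr a b : wedge a (- b) = - wedge a b.
Proof. by rewrite -scaleN1r wedgeZr scaleN1r. Qed.
Lemma wedge0r a : wedge a 0 = 0.
Proof. by have := wedgeZr 0 a 0; rewrite !scale0r. Qed.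
Lemma wedge_sumr (I : finType) a (b : I -> seq W -> R^o) :
  wedge a (\sum_i b i) = \sum_i wedge a (b i).
Proof.
elim: (index_enum I) => [|i r IHr]; first by rewrite !big_nil wedge0r.
by rewrite !big_cons wedgeDr IHr.
Qed.

Lemma wedge2_ext a (p : W -> R) b : (forall u, size u != 2%N -> a u = 0) ->
  wedge a (ext p b) = ext p (wedge a b).
Proof.
move=> a2; apply/funext => u; elim: u b => [|x u IHu] b.
  by rewrite wedgeE shuffle_sum_nil a2 // mul0r.
rewrite -[LHS]/(contract x _ u) -[RHS]/(contract x (ext p _) u).
rewrite contract_wedge2 // !contract_ext contract_wedge2 // extD extC.
rewrite wedgeDr wedgeZr wedgeNr -[LHS]/(- _ u + (p x *: wedge a b u - wedge a _ u)).
rewrite IHu -[RHS]/(p x *: wedge a b u - (_ u + _ u)) opprD.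
by rewrite addrCA.
Qed.

Lemma wedge_size i j a b u : (forall v, (size v)%:Z != i -> a v = 0) ->
  (forall v, (size v)%:Z != j -> b v = 0) -> (size u)%:Z != i + j ->
  wedge a b u = 0.
Proof.
move=> ai bj uij; rewrite wedgeE -[RHS](shuffle_sum0 u).
apply: eq_shuffle_sum => v w vw.
have [vi|vi] := eqVneq (size v)%:Z i; last by rewrite ai ?mul0r.
rewrite bj ?mulr0 //; apply: contra_neq uij => wj.
by rewrite -vw -vi -wj PoszD.
Qed.
End WedgeLemmas.

Section PairLemmas.
Context {R : realType} {g : vectType R}.
Local Notation covec := (covector g).
Implicit Types (a : seq covec -> R^o) (x : g).

Lemma ext_pairP (k : R) x y a :
  ext (pair^~ (k *: x + y)) a = k *: ext (pair^~ x) a + ext (pair^~ y) a.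
Proof. by rewrite -ext_linl; apply: ext_eqp => p; apply: linp_cov. Qed.
Lemma ext_pair0 a : ext (pair^~ (0 : g)) a = 0.
Proof.
by rewrite -[RHS](ext0l a); apply: ext_eqp => p; rewrite /pair linear0.
Qed.
Lemma ext_pairZ (k : R) x a : ext (pair^~ (k *: x)) a = k *: ext (pair^~ x) a.
Proof. by rewrite -[k *: x]addr0 ext_pairP ext_pair0 addr0. Qed.
Lemma ext_pairB x y a :
  ext (pair^~ (x - y)) a = ext (pair^~ x) a - ext (pair^~ y) a.
Proof. by rewrite -scaleN1r addrC ext_pairP scaleN1r addrC. Qed.
Lemma ext_pair_sum (I : finType) (k : I -> R) (x : I -> g) a :
  ext (pair^~ (\sum_i k i *: x i)) a = \sum_i k i *: ext (pair^~ (x i)) a.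
Proof.
rewrite -ext_suml; apply: ext_eqp => p; rewrite /pair (linp_sum _ (linp_cov p)).
by apply: eq_bigr => i _; rewrite (linpZ _ _ (linp_cov p)).
Qed.

Lemma vec_ofE (a : seq covec -> R^o) (p : covec) : Alt a -> p (vec_of a) = a [:: p].
Proof.
move=> aA; rewrite (Alt_one_basis (pr := @pair R g) bcov_sum p aA) /vec_of.
rewrite (linp_sum _ (linp_cov p)); apply: eq_bigr => i _.
by rewrite (linpZ _ _ (linp_cov p)) mulrC.
Qed.
End PairLemmas.

(** * Differential operators on contracted volume forms *)

Section Koszul.
Context {R : realType} {g : vectType R} (dot : {dot g for idfun}).
Implicit Types (v x : g) (s : sphere dot) (f : sphere dot -> R).
Implicit Types (P Q : mvfield dot) (w : dfield dot).

Local Notation n := (\dim {:g}).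
Local Notation covec := (covector g).

Definition tmv P := [/\ AltF P, tangent_mv P & smoothF P].

(* [i_P nu], up to sign, for the volume form [nu = i_s mu] of the sphere. *)
Definition bm P : dfield dot := fun s => hod (es s (P s)).

Lemma Alt_esF P : AltF P -> AltF (fun s => es s (P s)).
Proof. by move=> PA s; apply: Alt_es. Qed.

Lemma es_es s (a : seq covec -> R^o) : es s (es s a) = 0.
Proof. exact: extxx. Qed.
Lemma esN s (a : seq covec -> R^o) : es s (- a) = - es s a.
Proof. exact: extN. Qed.
Lemma esD s (a b : seq covec -> R^o) : es s (a + b) = es s a + es s b.
Proof. exact: extD. Qed.
Lemma esB s (a b : seq covec -> R^o) : es s (a - b) = es s a - es s b.
Proof. exact: extB. Qed.
Lemma esZ s (k : R) (a : seq covec -> R^o) : es s (k *: a) = k *: es s a.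
Proof. exact: extZ. Qed.
Lemma csD s (a b : seq covec -> R^o) : cs s (a + b) = cs s a + cs s b.
Proof. by []. Qed.
Lemma csZ s (k : R) (a : seq covec -> R^o) : cs s (k *: a) = k *: cs s a.
Proof. by []. Qed.
Lemma es_cs_es s (a : seq covec -> R^o) : es s (cs s (es s a)) = es s a.
Proof. by rewrite cs_es esB es_es subr0. Qed.

Lemma cs_basis s (a : seq covec -> R^o) : Alt a ->
  cs s a = \sum_i dot (val s) (bvec i) *: contract (bcov i) a.
Proof.
move=> aA; rewrite /cs {1}(bcov_sum (sflat s)) contract_suml //.
by apply: eq_bigr => i _; rewrite contractZl // flatE.
Qed.

(** The divergence of s /\ P is the sum of a tangent multivector, which [cs] kills, and of - s /\
    [bd P]. Hence d(i_P nu) is, up to sign, the contraction of nu with the divergence of P. *)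
Lemma bd_es P s : tmv P ->
  es s (cs s (bd (fun s => es s (P s)) s)) = - es s (bd P s).
Proof.
move=> [PA Pt PS].
have PAs : Alt (P s) := PA s.
have step i : contract (bcov i) (fder (bvec i) (fun s => es s (P s)) s) =
    (P s - ext (pair^~ (bvec i)) (contract (bcov i) (P s)))
    - dot (val s) (bvec i) *: contract (bcov i) (es s (P s))
    + (bcov i (val s) *: fder (bvec i) P s
       - es s (contract (bcov i) (fder (bvec i) P s))).
  rewrite fder_es // contractD /tproj ext_pairB ext_pairZ contractB contractZ.
  by rewrite !contract_ext /pair bcov_bvec eqxx scale1r.
(* For P of degree k this is (n - k) P; only its tangency matters. *)
set N := \sum_i (P s - ext (pair^~ (bvec i)) (contract (bcov i) (P s))).
have Pt0 : cs s (P s) = 0 := Pt s.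
have cN : cs s N = 0.
  rewrite /N sumrB /cs contractB !contract_sum big1 => [|i _]; last exact: Pt0.
  rewrite sub0r.
  under eq_bigr => i _.
    rewrite contract_ext [contract (sflat s) (contract _ _)]contractC //.
    rewrite Pt contract0 oppr0 ext0 subr0 /pair flatE; over.
  by rewrite -cs_basis // Pt0 oppr0.
have -> : bd (fun s => es s (P s)) s = N - P s - es s (bd P s).
  rewrite /bd; under eq_bigr => i _ do rewrite step.
  rewrite big_split /= sumrB -cs_basis; last exact: Alt_es.
  rewrite cs_es Pt0 [es s 0]ext0 subr0; congr (_ + _).
  rewrite sumrB -(fder_basis (val s) s PS) fder_radial // sub0r.
  by rewrite /es -ext_sum.
rewrite /cs !contractB -!/(cs s _) cN Pt0 subrr sub0r esN.
by rewrite es_cs_es.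
Qed.

Lemma sd_bm P s : tmv P -> sd (bm P) s = - hod (es s (bd P s)).
Proof.
move=> Pt; case: (Pt) => PA _ PS; rewrite /bm sd_hod.
- by rewrite bd_es // hodN.
- exact: smoothF_es.
- exact: Alt_esF.
Qed.

Lemma slie_bm X P s : smoothV X -> (forall s, sflat s (X s) = 0) -> tmv P ->
  slie X (bm P) s = hod (es s (lied X P s + divg X s *: P s)).
Proof.
move=> XS Xt [PA Pt PS]; have PAs := PA s; have Pt0 : cs s (P s) = 0 := Pt s.
rewrite /bm slie_hod //; [|exact: smoothF_es|exact: Alt_esF].
have vX v : vder v X s = \sum_i bcov i v *: vder (bvec i) X s.
  exact: vder_basis.
have tX : tproj s (X s) = X s.
  by rewrite /tproj; have := Xt s; rewrite flatE => ->; rewrite scale0r subr0.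
(* Differentiating the position vector along X contributes X /\ P, tangent and therefore killed by
   [cs]. The sum of the e^j(s) D_j X is the radial derivative of X, which vanishes. *)
have E : lied X (fun s => es s (P s)) s =
    ext (pair^~ (X s)) (P s) + es s (lied X P s).
  rewrite {1}/lied fder_es // tX -addrA; congr (_ + _).
  rewrite /lied esB; congr (_ - _).
  rewrite {2}/es ext_sum.
  transitivity (\sum_j bcov j (val s) *: ext (pair^~ (vder (bvec j) X s)) (P s)
     + \sum_j es s (ext (pair^~ (vder (bvec j) X s)) (contract (bcov j) (P s)))).
    rewrite -big_split; apply: eq_bigr => j _ /=.
    by rewrite contract_ext extB extZ [ext _ (ext _ _)]extC opprK.
  rewrite -ext_pair_sum -vX -[RHS]add0r; congr (_ + _).
  rewrite -[RHS](ext_pair0 (P s)); congr (ext (pair^~ _) _).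
  rewrite /vder big1 // => i _; rewrite sder_radial ?scale0r //; exact: XS.
have cX : cs s (ext (pair^~ (X s)) (P s)) = 0.
  by rewrite /cs contract_ext -!/(cs s _) Pt0 /pair Xt scale0r ext0 subr0.
rewrite E; congr (hod _).
rewrite csD csD csZ cX add0r esD es_cs_es esZ.
by rewrite es_cs_es esD esZ.
Qed.
End Koszul.

(** * Lichnerowicz-Jacobi operators *)

Section LichnerowiczJacobi.
Context {R : realType} {g : vectType R} (dot : {dot g for idfun}).
Implicit Types (v x : g) (s : sphere dot) (f : sphere dot -> R).
Implicit Types (P Q : mvfield dot) (w : dfield dot).

Local Notation n := (\dim {:g}).
Local Notation covec := (covector g).

(** By [fder_csP] the normal part of [bd P] is the contraction of P with the scalar product, a
    symmetric tensor, so it is equal to its opposite. *)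
Lemma tmv_bd P : tmv P -> tmv (bd P).
Proof.
move=> [PA Pt PS]; split; [by move=> s; apply: Alt_bd| |exact: smoothF_bd].
move=> s; have PAs := PA s; rewrite -/(cs s _) /bd /cs contract_sum.
pose T := \sum_i \sum_j dot (bvec i) (bvec j) *:
  contract (bcov i) (contract (bcov j) (P s)).
have TE : T = - T.
  rewrite {2}/T exchange_big -sumrN; apply: eq_bigr => i _.
  rewrite -sumrN; apply: eq_bigr => j _.
  by rewrite dotC [contract (bcov j) (contract _ _)]contractC // scalerN opprK.
have T0 : T = 0.
  apply/funext => u; have /(congr1 (@^~ u)) := TE; rewrite !fctE.
  by move: (T u : R) => t tN; rewrite -[RHS]/(0 : R); lra.
rewrite -[RHS]T0; apply: eq_bigr => i _.
rewrite contractC; last exact: Alt_fder.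
rewrite -/(cs s _) fder_csP // contractN opprK.
transitivity (contract (bcov i) (contract (flatv dot (bvec i)) (P s))).
  congr contract; rewrite /tproj -scaleNr addrC flatP contractDl // contractZl //.
  by rewrite [contract _ _](Pt s) scaler0 add0r.
rewrite {1}(bcov_sum (flatv dot (bvec i))) contract_suml // contract_sum.
by apply: eq_bigr => j _; rewrite contractZl // contractZ flatE.
Qed.

Lemma Alt_lied X P s : AltF P -> smoothF P -> Alt (lied X P s).
Proof.
move=> PA PS; apply: AltB; first exact: Alt_fder.
by apply: Alt_sum => j; apply: Alt_ext; [exact: pairR|exact: Alt_contract].
Qed.

(** Differentiating the tangency of P and that of X produces twice the same normal part, the
    contraction of P with the covector dual to X, with opposite signs. *)
Lemma lied_tangent X P s : smoothV X -> (forall s, sflat s (X s) = 0) -> tmv P ->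
  cs s (lied X P s) = 0.
Proof.
move=> XS Xt [PA Pt PS]; have PAs := PA s.
rewrite /lied /cs contractB -!/(cs s _) fder_csP //.
have -> : tproj s (X s) = X s.
  by rewrite /tproj; have := Xt s; rewrite flatE => ->; rewrite scale0r subr0.
have fX j : pair (sflat s) (vder (bvec j) X s) = - dot (bvec j) (X s)
    + dot (val s) (bvec j) * dot (val s) (X s).
  have D : sder (bvec j) (fun t => dot (val t) (X t)) s = 0.
    rewrite -(sder_cst 0 (bvec j) s); apply: eq_sder => t.
    by rewrite -flatE; apply: Xt.
  move: D; have -> : (fun t : sphere dot => dot (val t) (X t)) =
      (fun t => \sum_i bcov i (val t) * flatv dot (bvec i) (X t)).
    apply/funext => t; rewrite [LHS]dot_basis; apply: eq_bigr => i _.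
    by rewrite flatE.
  rewrite sder_sum; last by move=> i; apply: smoothM; [exact: smooth_coord|exact: XS].
  under eq_bigr => i _.
    rewrite (sderM _ _ (smooth_coord dot (bcov i)) (XS _)) sder_coord -cov_vder // !flatE.
    over.
  rewrite big_split /= -dot_basis.
  under [X in _ + X]eq_bigr => i _ do rewrite mulrC.
  rewrite -dot_basis /tproj (linpB _ _ (linp_dotl dot _)) (linpZ _ _ (linp_dotl dot _)).
  by rewrite /pair flatE => h; lra.
have Xs : dot (val s) (X s) = 0 by rewrite -flatE; apply: Xt.
rewrite /cs contract_sum.
under eq_bigr => j _.
  rewrite contract_ext fX Xs mulr0 addr0 [contract (sflat s) (contract _ _)]contractC //.
  rewrite Pt contract0 oppr0 ext0 subr0 scaleNr; over.
rewrite sumrN opprK addrC; apply/eqP; rewrite subr_eq0; apply/eqP.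
rewrite [in RHS](bcov_sum (flatv dot (X s))) contract_suml //.
by apply: eq_bigr => j _; rewrite contractZl // flatE dotC.
Qed.

Variables (L E : mvfield dot).
Hypothesis L2 : forall s u, size u != 2%N -> L s u = 0.
Hypothesis E1 : forall s u, size u != 1%N -> E s u = 0.
Hypothesis Lt : tmv L.
Hypothesis Et : tmv E.
Let d : R := n%:R - 1.
(* The modular pair of the standard volume form vanishes. *)
Hypothesis divL : forall s q,
  \sum_i fder (bvec i) L s [:: bcov i; q] = - (d * E s [:: q]).
Hypothesis divE : forall s, divg (evec E) s = 0.

Lemma evecE s (p : covec) : p (evec E s) = E s [:: p].
Proof. by apply: vec_ofE; case: Et. Qed.

Lemma smoothV_evec : smoothV (evec E).
Proof.
case: Et => _ _ ES p; rewrite (_ : (fun s => _) = (fun s => E s [:: p])) //.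
by apply/funext => s; apply: evecE.
Qed.

Lemma evec_tangent s : sflat s (evec E s) = 0.
Proof. by case: Et => _ Et0 _; rewrite evecE -[LHS]/(contract _ _ [::]) Et0. Qed.

Lemma wedge_evec s a : wedge (E s) a = ext (pair^~ (evec E s)) a.
Proof.
rewrite wedge_deg1; last exact: E1.
by apply: ext_eqp => p; rewrite -evecE.
Qed.

Lemma sbracket_E P s : AltF P -> smoothF P -> sbracket E P s = lied (evec E) P s.
Proof.
case: Et => EA _ ES PA PS.
rewrite (sbracketE s E1) // expr1 scaleN1r /lied; congr (_ - _).
  rewrite (fder_basis (evec E s)) //; apply: eq_bigr => i _.
  rewrite wedge_deg0 ?evecE // => u u0.
  by rewrite /contract E1.
apply: eq_bigr => i _; rewrite wedge_deg1; last first.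
  by move=> u u1; rewrite fder_size // => t; apply: E1.
apply: ext_eqp => p; rewrite /pair cov_vder; last exact: smoothV_evec.
by rewrite /fder; apply: eq_sder => t; rewrite evecE.
Qed.

(** Contracting the Leibniz rule for D_i(L /\ P) with e^i gives four sums: the divergence of L,
    which [divL] evaluates, the two halves of the bracket, and the wedge of L with the divergence of
    P. *)
Lemma bd_wedge P s : AltF P -> smoothF P ->
  bd (fun s => wedge (L s) (P s)) s =
  - d *: wedge (E s) (P s) + sbracket L P s + wedge (L s) (bd P s).
Proof.
case: Lt => LA _ LS PA PS.
rewrite (sbracketE s L2) // sqrrN expr1n scale1r.
have D2 i u : size u != 2%N -> fder (bvec i) L s u = 0.
  by move=> u2; apply: fder_size => t; apply: L2.
have -> : - d *: wedge (E s) (P s) =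
    \sum_i ext (fun q => fder (bvec i) L s [:: bcov i; q]) (P s).
  transitivity (\sum_i (1 : R) *: ext (fun q => fder (bvec i) L s [:: bcov i; q]) (P s));
    last by apply: eq_bigr => i _; rewrite scale1r.
  rewrite -ext_suml wedge_deg1; last exact: E1.
  transitivity (ext (fun q => - d * E s [:: q] + 0) (P s)).
    by rewrite (ext_linl (- d) (fun q => E s [:: q]) (fun=> 0)) ext0l addr0.
  apply: ext_eqp => q; rewrite addr0 mulNr -divL.
  by apply: eq_bigr => i _; rewrite mul1r.
rewrite /bd wedge_sumr -!big_split; apply: eq_bigr => i _ /=.
rewrite fder_wedge // contractD !contract_wedge2 //; [|exact: L2|exact: D2].
rewrite [wedge (contract _ _) _]wedge_deg1; last first.
  by move=> u u1; rewrite /contract L2.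
rewrite -!addrA; congr (_ + _).
by rewrite addrCA.
Qed.

Lemma Alt_wedgeL s a : Alt a -> Alt (wedge (L s) a).
Proof.
case: Lt => LA _ _ aA.
rewrite (wedge_deg2 (pr := @pair R g) bcov_sum) //; last exact: L2.
apply: AltZ; apply: Alt_sum => i; apply: Alt_sum => j; apply: AltZ.
by apply: Alt_ext; [exact: pairR|apply: Alt_ext => //; exact: pairR].
Qed.

Lemma cs_wedgeL s a : cs s (wedge (L s) a) = wedge (L s) (cs s a).
Proof.
case: Lt => LA Lt0 _; rewrite /cs contract_wedge2; last exact: L2.
rewrite (_ : ext _ a = 0) ?add0r // -[RHS](ext0l a); apply: ext_eqp => p.
by rewrite -[LHS]/(contract _ _ [:: p]) Lt0.
Qed.

Lemma tmv_wedgeL P : tmv P -> tmv (fun s => wedge (L s) (P s)).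
Proof.
move=> [PA Pt PS]; split; first by move=> s; apply: Alt_wedgeL.
  by move=> s; rewrite -/(cs s _) cs_wedgeL [cs _ _]Pt wedge0r.
by apply: smoothF_wedge => //; case: Lt.
Qed.

Lemma Alt_wedgeE s a : Alt a -> Alt (wedge (E s) a).
Proof. by move=> aA; rewrite wedge_evec; apply: Alt_ext => //; apply: pairR. Qed.

Lemma cs_wedgeE s a : cs s (wedge (E s) a) = - wedge (E s) (cs s a).
Proof.
rewrite !wedge_evec /cs contract_ext [X in X *: _](evec_tangent s) scale0r.
by rewrite sub0r.
Qed.

(** Expressed through divergences, the bracket inherits alternation and tangency from [bd] and
    [wedge]. *)
Lemma sbracket_L P s : AltF P -> smoothF P -> sbracket L P s =
  bd (fun s => wedge (L s) (P s)) s + d *: wedge (E s) (P s) - wedge (L s) (bd P s).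
Proof.
by move=> PA PS; rewrite bd_wedge // scaleNr addrAC addrK addrAC addNr add0r.
Qed.

Lemma Alt_sbracket_L P s : tmv P -> Alt (sbracket L P s).
Proof.
move=> Pt; case: (Pt) => PA _ PS; rewrite sbracket_L //.
have [WA _ WS] := tmv_wedgeL Pt.
apply: AltB; last by apply: Alt_wedgeL; apply: Alt_bd.
by apply: AltD; [exact: Alt_bd|apply: AltZ; exact: Alt_wedgeE].
Qed.

Lemma cs_sbracket_L P s : tmv P -> cs s (sbracket L P s) = 0.
Proof.
move=> Pt; case: (Pt) => PA Pt0 PS; rewrite sbracket_L //.
have [_ Bt _] := tmv_bd Pt; have [_ BWt _] := tmv_bd (tmv_wedgeL Pt).
rewrite /cs contractB contractD contractZ -!/(cs s _) cs_wedgeL cs_wedgeE.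
have B0 : cs s (bd P s) = 0 := Bt s.
have BW0 : cs s (bd (fun s => wedge (L s) (P s)) s) = 0 := BWt s.
have P0 : cs s (P s) = 0 := Pt0 s.
by rewrite B0 BW0 P0 !wedge0r oppr0 scaler0 !addr0.
Qed.

Lemma wedgeL_es s a : wedge (L s) (es s a) = es s (wedge (L s) a).
Proof. by apply: wedge2_ext; apply: L2. Qed.

Lemma iL_bm P : tmv P -> iL L (bm P) = bm (fun s => - wedge (L s) (P s)).
Proof.
case: Lt => LA _ _ [PA _ _]; apply/funext => s.
rewrite /iL /bm iL_hod //; [|exact: L2|exact: Alt_es].
by rewrite wedgeL_es esN hodN.
Qed.

Lemma tmvN P : tmv P -> tmv (fun s => - P s).
Proof.
move=> [PA Pt PS]; split=> [s|s|].
- exact: AltN.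
- by rewrite contractN Pt oppr0.
- by move=> u; apply: smoothN; apply: PS.
Qed.

Lemma tmvZ (k : R) P : tmv P -> tmv (fun s => k *: P s).
Proof.
move=> [PA Pt PS]; split=> [s|s|].
- exact: AltZ.
- by rewrite contractZ Pt scaler0.
- exact: smoothFZ.
Qed.

Lemma bdN P s : smoothF P -> bd (fun s => - P s) s = - bd P s.
Proof.
move=> PS; rewrite /bd -sumrN; apply: eq_bigr => i _; rewrite -contractN.
congr contract; apply/funext => u; apply: sderN; exact: PS.
Qed.

Lemma iL_sd_bm P s : tmv P -> (iL L (sd (bm P)) - sd (iL L (bm P))) s =
  hod (es s (d *: wedge (E s) (P s) - sbracket L P s)).
Proof.
move=> Pt; case: (Pt) => PA _ PS; have WLt := tmv_wedgeL Pt.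
rewrite iL_bm //.
transitivity (iL L (sd (bm P)) s - sd (bm (fun s => - wedge (L s) (P s))) s).
  by [].
rewrite sd_bm; last exact: tmvN.
rewrite /iL sd_bm // bdN; last by case: WLt.
have BA : Alt (bd P s) by apply: Alt_bd.
rewrite -hodN -esN iL_hod; [|exact: L2|by case: Lt|by apply: Alt_es; apply: AltN].
rewrite wedgeL_es wedgeNr !esN !hodN !opprK -hodB -esB; congr (hod (es s _)).
rewrite sbracket_L // opprB [RHS]addrC -addrA; congr (_ + _).
by rewrite opprD -addrA addNr addr0.
Qed.

End LichnerowiczJacobi.

(** * The isomorphism between cochains and chains *)

Section ChainMap.
Context {R : realType} {g : vectType R} (dot : {dot g for idfun}).
Implicit Types (v x : g) (s : sphere dot) (f : sphere dot -> R).
Implicit Types (P Q : mvfield dot) (w : dfield dot).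

Local Notation n := (\dim {:g}).
Local Notation covec := (covector g).

Lemma mulrz_fctE (T : Type) (M : zmodType) (f : T -> M) (m : int) (t : T) :
  (f *~ m) t = f t *~ m.
Proof. by case: m => k; rewrite /intmul /= ?natmulfctE // opprfctE natmulfctE. Qed.

Lemma scale_intE (V : Type) (a : seq V -> R^o) (m : int) : a *~ m = (m%:~R : R) *: a.
Proof. by rewrite scaler_int. Qed.

(** Inverse of [bm]: [cohod] recovers s /\ P from the form, and [cs] strips off the factor s. *)
Definition cobm w : mvfield dot := fun s => cs s (cohod (w s)).

Lemma bmP (k : R) P Q : bm (k *: P + Q) = k *: bm P + bm Q.
Proof.
apply/funext => s; rewrite /bm -[in LHS]/((k *: P s + Q s)).
by rewrite /es extD extZ hodP.
Qed.
Lemma cobmP (k : R) w w' : cobm (k *: w + w') = k *: cobm w + cobm w'.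
Proof.
apply/funext => s; rewrite /cobm -[cohod _]/(cohod (k *: w s + w' s)).
by rewrite [cohod _]linearP.
Qed.

Lemma bm0 : bm (0 : mvfield dot) = 0.
Proof. by have := bmP (-1) 0 0; rewrite scaleN1r oppr0 addr0 scaleN1r addNr. Qed.
Lemma bmZ (k : R) P : bm (k *: P) = k *: bm P.
Proof. by rewrite -[k *: P]addr0 bmP bm0 addr0. Qed.
Lemma cobm0 : cobm (0 : dfield dot) = 0.
Proof. by have := cobmP (-1) 0 0; rewrite scaleN1r oppr0 addr0 scaleN1r addNr. Qed.
Lemma cobmZ (k : R) w : cobm (k *: w) = k *: cobm w.
Proof. by rewrite -[k *: w]addr0 cobmP cobm0 addr0. Qed.

Lemma bmK P : AltF P -> tangent_mv P -> cobm (bm P) = P.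
Proof.
move=> PA Pt; apply/funext => s; rewrite /cobm /bm hodK; last exact: Alt_es.
by rewrite cs_es [cs s _]Pt /es ext0 subr0.
Qed.

Lemma cobmK w : AltF w -> tangent_form w -> bm (cobm w) = w.
Proof.
move=> wA wt; apply/funext => s; rewrite /cobm /bm /es.
have cA := Alt_cohod (w s).
rewrite hod_ext; last exact: Alt_cs.
rewrite /cs hod_contract // cohodK // contract_ext1; last exact: sflat1.
by rewrite wt ext0 subr0.
Qed.

Lemma bm_kform (k : int) P : kvector k P -> kform (n%:Z - 1 - k) (bm P).
Proof.
move=> /kvectorP[Pk PA Pt PS]; apply/kformP; split.
- move=> s u sz_u; apply: (@hodge_size _ _ _ _ _ _ _ mu_size (k + 1)); last first.
    by apply: contra_neq sz_u => ->; ring.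
  case=> [|p v] // sz_v; rewrite /es /= Pk; last first.
    by apply: contra_neq sz_v => /= <-; rewrite -addn1 PoszD.
  rewrite mulr0 sub0r (@ext_local _ _ _ _ 0) ?ext0 ?oppr0 // => r sz_r.
  rewrite /contract Pk //=; apply: contra_neq sz_v => /= <-.
  by rewrite -sz_r -addn1 PoszD.
- by move=> s; apply: Alt_hod.
- by move=> s; rewrite /bm /es -hod_ext ?extxx ?[hod 0]linear0 //; apply: Alt_es.
- by apply: smoothF_hod; apply: smoothF_es.
Qed.

Lemma smoothF_cs P : smoothF P -> AltF P -> smoothF (fun s => cs s (P s)).
Proof.
move=> PS PA; rewrite (_ : (fun s => cs s (P s)) = (fun s =>
   \sum_i dot (val s) (bvec i) *: contract (bcov i) (P s))); last first.
  by apply/funext => s; rewrite cs_basis.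
apply: smoothF_sum => i; apply: smoothFM; last exact: smoothF_contract.
exact: (smooth_lin dot (linp_dotl dot (bvec i))).
Qed.

Lemma cobm_kvector (k : int) w : kform k w -> kvector (n%:Z - 1 - k) (cobm w).
Proof.
move=> /kformP[wk wA wt wS]; apply/kvectorP; split.
- move=> s u sz_u; rewrite /cobm /cs /contract.
  apply: (@hodge_size _ _ _ _ _ _ _ comu_size k); first exact: wk.
  by apply: contra_neq sz_u => /= h; rewrite addrAC -h -addn1 PoszD; ring.
- by move=> s; apply: Alt_cs; apply: Alt_cohod.
- by move=> s; rewrite /cobm /cs contractxx //; apply: Alt_cohod.
- apply: smoothF_cs; first exact: smoothF_cohod.
  by move=> s; apply: Alt_cohod.
Qed.

Definition eps (k : int) : R := ((-1) ^ k : int)%:~R.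

Lemma epsS (k : int) : eps (k - 1) = - eps k.
Proof.
rewrite /eps exprzDr; last by rewrite unitrN1.
by rewrite -[(-1) ^ (-1)]/(((-1) ^+ 1)^-1) expr1 invrN invr1 mulrN1 rmorphN.
Qed.

Lemma eps_sqr (k : int) : eps k * eps k = 1.
Proof.
by rewrite /eps -intrM -exprzMl ?unitrN1 // mulrNN mulr1 exp1rz.
Qed.

Section Structure.
Variables (L E : mvfield dot).
Hypothesis L2 : forall s u, size u != 2%N -> L s u = 0.
Hypothesis E1 : forall s u, size u != 1%N -> E s u = 0.
Hypothesis Lt : tmv L.
Hypothesis Et : tmv E.
Let d : R := n%:R - 1.
Hypothesis divL : forall s q,
  \sum_i fder (bvec i) L s [:: bcov i; q] = - (d * E s [:: q]).
Hypothesis divE : forall s, divg (evec E) s = 0.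

Lemma kvector_tmv (k : int) P : kvector k P -> tmv P.
Proof. by move=> /kvectorP[]. Qed.

Lemma sbracketZ (j : nat) (k : R) P Q s : (forall s u, size u != j -> P s u = 0) ->
  tmv P -> tmv Q ->
  sbracket P (k *: Q) s = k *: sbracket P Q s.
Proof.
move=> Pj [PA Pt PS] [QA Qt QS].
have [kA _ kS] := tmvZ k (And3 QA Qt QS).
rewrite !(sbracketE s Pj) // scalerDr; congr (_ + _).
  rewrite scaler_sumr; apply: eq_bigr => i _; rewrite -wedgeZr; congr wedge.
  exact: fderZ.
rewrite scalerA mulrC -scalerA; congr (_ *: _).
by rewrite scaler_sumr; apply: eq_bigr => i _; rewrite -wedgeZr.
Qed.

Lemma iE_bm P s : tmv P -> iE E (bm P) s = - hod (es s (wedge (E s) (P s))).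
Proof.
move=> [PA _ _]; rewrite /iE /bm -hod_ext; last exact: Alt_es.
by rewrite wedge_evec // /es extC hodN.
Qed.

Lemma slie_evec_bm P s : tmv P ->
  slie (evec E) (bm P) s = hod (es s (sbracket E P s)).
Proof.
move=> Pt; rewrite slie_bm //; first last.
- exact: evec_tangent.
- exact: smoothV_evec.
by case: Pt => PA _ PS; rewrite divE scale0r addr0 (sbracket_E E1).
Qed.

(* The relative sign makes [Phi] anticommute with the differentials. *)
Definition Phi (k : int) (c : mvfield dot * mvfield dot) : dfield dot * dfield dot :=
  (bm c.2, eps (k - 1) *: bm c.1).
Definition Psi (k : int) (c : dfield dot * dfield dot) : mvfield dot * mvfield dot :=
  (eps (k - 1) *: cobm c.2, cobm c.1).

(** The term (n - 1) E, which [iL_sd_bm] owes to the divergence of Lambda, combines with the term k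
    i_E of delta, of opposite sign by [iE_bm]: the coefficients n - 1 - k and n - 1 - (k - 1) = n -
    k are those of E in sigma at degree n - k. *)
Lemma delta_Phi (k : int) c : LJ_cochain (n%:Z - k) c ->
  LJ_delta L E k (Phi k c) = - Phi (k - 1) (LJ_sigma L E (n%:Z - k) c).
Proof.
case: c => P Q [/= /kvector_tmv Pt /kvector_tmv Qt].
have Pt' : tmv (eps (k - 1) *: P) by apply: tmvZ.
have hz a s (m : int) : hod (es s (a *~ m)) = (m%:~R : R) *: hod (es s a).
  by rewrite scale_intE /es extZ hodZ.
have hb a b s : hod (es s (a - b)) = hod (es s a) - hod (es s b).
  by rewrite esB hodB.
have hd a b s : hod (es s (a + b)) = hod (es s a) + hod (es s b).
  by rewrite esD hodD.
have hs (r : R) a s : hod (es s (r *: a)) = r *: hod (es s a).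
  by rewrite esZ hodZ.
have hn a s : hod (es s (- a)) = - hod (es s a) by rewrite esN hodN.
apply: injective_projections; apply/funext => s.
  rewrite /= -bmZ.
  transitivity ((iL L (sd (bm Q)) - sd (iL L (bm Q))) s
     + iE E (bm Q) s *~ k + slie (evec E) (bm (eps (k - 1) *: P)) s *~ (-1) ^ k).
    by rewrite -!mulrz_fctE.
  rewrite (iL_sd_bm L2 E1) // iE_bm // slie_evec_bm //.
  rewrite (sbracketZ _ _ E1) // !scale_intE -/(eps k) epsS hb !hs.
  rewrite -[RHS]/(- hod (es s (sbracket L Q s -
    (swedge E Q *~ (n%:Z - k - 1)) s + sbracket E P s))).
  rewrite mulrz_fctE hd hb hz.
  move: (hod _) (hod _) (hod _) => X Y Z; apply/funext => u; rewrite !fctE.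
  have -> : (n%:Z - k - 1)%:~R = n%:R - k%:~R - 1 :> R.
    by rewrite !rmorphB /= -pmulrn.
  move: (X u : R) (Y u : R) (Z u : R) => x y z.
  rewrite -[LHS]/((n%:R - 1) * z - y + k%:~R * - z + eps k * (- eps k * x) : R).
  have e2 : eps k * (- eps k * x) = - x by rewrite mulrA mulrN eps_sqr mulN1r.
  by rewrite e2 -[RHS]/(- (y - (n%:R - k%:~R - 1) * z + x) : R); ring.
rewrite /= -bmZ.
transitivity ((iL L (sd (bm (eps (k - 1) *: P))) -
    sd (iL L (bm (eps (k - 1) *: P)))) s
   + iE E (bm (eps (k - 1) *: P)) s *~ (k - 1) + iL L (bm Q) s *~ (-1) ^ k).
  by rewrite -!mulrz_fctE.
rewrite (iL_sd_bm L2 E1) // iE_bm // (iL_bm L2) //.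
rewrite (sbracketZ _ _ L2) // !scale_intE -/(eps k).
rewrite -[RHS]/(- (eps (k - 1 - 1) *: hod (es s (- sbracket L P s +
    (swedge E P *~ (n%:Z - k)) s + wedge (L s) (Q s))))).
rewrite mulrz_fctE !hd hn hz /bm hn -[(eps (k - 1) *: P) s]/(eps (k - 1) *: P s).
rewrite ?wedgeZr ?hn !hs !epsS -/(swedge E P s).
move: (hod _) (hod _) (hod _) => X Y Z; apply/funext => u; rewrite !fctE.
have -> : (n%:Z - k)%:~R = n%:R - k%:~R :> R by rewrite rmorphB /= -pmulrn.
have -> : (k - 1)%:~R = k%:~R - 1 :> R by rewrite rmorphB.
move: (X u : R) (Y u : R) (Z u : R) => x y z.
rewrite -[LHS]/((n%:R - 1) * (- eps k * z) - - eps k * y +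
  (k%:~R - 1) * - (- eps k * z) + eps k * - x : R).
by rewrite -[RHS]/(- (- - eps k * (- y + (n%:R - k%:~R) * z + x)) : R); ring.
Qed.

(** Makes [Psi] a left inverse of [Phi] on the values of sigma, by [PhiK]. *)
Lemma sigma_tangent (k : int) c : LJ_cochain k c ->
  let c' := LJ_sigma L E k c in
  [/\ AltF c'.1, tangent_mv c'.1, AltF c'.2 & tangent_mv c'.2].
Proof.
case: c => P Q [/= /kvector_tmv Pt /kvector_tmv Qt].
have [PA Pt0 PS] := Pt; have [QA Qt0 QS] := Qt.
have AE a s : Alt a -> Alt (wedge (E s) a) by apply: Alt_wedgeE.
have AL a s : Alt a -> Alt (wedge (L s) a) by apply: Alt_wedgeL.
have cE s (a : seq covec -> R^o) : cs s a = 0 -> cs s (wedge (E s) a) = 0.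
  by move=> a0; rewrite cs_wedgeE // a0 wedge0r oppr0.
have cL s (a : seq covec -> R^o) : cs s a = 0 -> cs s (wedge (L s) a) = 0.
  by move=> a0; rewrite cs_wedgeL // a0 wedge0r.
have E1s (m : int) s : (- sbracket L P + swedge E P *~ m + swedge L Q) s =
    - sbracket L P s + m%:~R *: wedge (E s) (P s) + wedge (L s) (Q s).
  by rewrite -scale_intE -(mulrz_fctE (swedge E P)).
have E2s (m : int) s : (sbracket L Q - swedge E Q *~ m + sbracket E P) s =
    sbracket L Q s - m%:~R *: wedge (E s) (Q s) + sbracket E P s.
  by rewrite -scale_intE -(mulrz_fctE (swedge E Q)).
split=> s.
- rewrite E1s; apply: AltD; last exact: AL.
  by apply: AltD; [apply: AltN; apply: (Alt_sbracket_L L2 E1)|apply: AltZ; apply: AE].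
- rewrite E1s -/(cs s _) !csD csZ (cE _ _ (Pt0 s)) (cL _ _ (Qt0 s)).
  rewrite scaler0 !addr0 -[LHS]/(- cs s (sbracket L P s)) (cs_sbracket_L L2 E1) //.
  by rewrite oppr0.
- rewrite E2s (sbracket_E E1) //; apply: AltD; last exact: Alt_lied.
  by apply: AltB; [apply: (Alt_sbracket_L L2 E1)|apply: AltZ; apply: AE].
rewrite E2s -/(cs s _) !csD -scaleNr csZ (cE _ _ (Qt0 s)) scaler0 addr0.
rewrite (cs_sbracket_L L2 E1) // add0r (sbracket_E E1) // lied_tangent //.
  exact: smoothV_evec.
exact: evec_tangent.
Qed.

Lemma PhiK (k : int) c : AltF c.1 -> tangent_mv c.1 -> AltF c.2 -> tangent_mv c.2 ->
  Psi k (Phi k c) = c.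
Proof.
case: c => P Q /= PA Pt QA Qt; rewrite /Psi /Phi /= cobmZ !bmK //.
by rewrite scalerA eps_sqr scale1r.
Qed.

Lemma PsiK (k : int) c : LJ_chain k c -> Phi k (Psi k c) = c.
Proof.
case: c => a b [/= /kformP[_ aA at_ _] /kformP[_ bA bt _]].
rewrite /Psi /Phi /= bmZ !cobmK //.
by rewrite scalerA eps_sqr scale1r.
Qed.

Lemma kformZ (k : int) (r : R) w : kform k w -> kform k (r *: w).
Proof.
move=> /kformP[wk wA wt wS]; apply/kformP; split.
- by move=> s u /wk w0; rewrite -[LHS]/(r *: w s u) w0 scaler0.
- by move=> s; apply: AltZ.
- by move=> s; rewrite -[LHS]/(r *: contract _ (w s)) wt scaler0.
- exact: smoothFZ.
Qed.

Lemma kvectorZ (k : int) (r : R) P : kvector k P -> kvector k (r *: P).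
Proof.
move=> /kvectorP[wk wA wt wS]; apply/kvectorP; split.
- by move=> s u /wk w0; rewrite -[LHS]/(r *: P s u) w0 scaler0.
- by move=> s; apply: AltZ.
- by move=> s; rewrite -[LHS]/(r *: contract _ (P s)) wt scaler0.
- exact: smoothFZ.
Qed.

Lemma Phi_chain (k : int) c : LJ_cochain (n%:Z - k) c -> LJ_chain k (Phi k c).
Proof.
case: c => P Q [/= Pk Qk]; split=> /=.
  by have := bm_kform Qk; congr kform; ring.
by apply: kformZ; have := bm_kform Pk; congr kform; ring.
Qed.

Lemma Psi_cochain (k : int) c : LJ_chain k c -> LJ_cochain (n%:Z - k) (Psi k c).
Proof.
case: c => a b [/= ak bk]; split=> /=.
  by apply: kvectorZ; have := cobm_kvector bk; congr kvector; ring.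
by have := cobm_kvector ak; congr kvector; ring.
Qed.

Lemma Phi_linear (k : int) (r : R) c c' : Phi k (r *: c + c') = r *: Phi k c + Phi k c'.
Proof.
case: c c' => [P Q] [P' Q']; apply: injective_projections => /=.
  exact: bmP.
by rewrite bmP scalerDr !scalerA mulrC.
Qed.

Lemma Psi_linear (k : int) (r : R) c c' : Psi k (r *: c + c') = r *: Psi k c + Psi k c'.
Proof.
case: c c' => [P Q] [P' Q']; apply: injective_projections => /=.
  by rewrite cobmP scalerDr !scalerA mulrC.
exact: cobmP.
Qed.

End Structure.
End ChainMap.

(** * Isomorphisms of subquotients *)

Section LinearIso.
Context {R : realType} {V W : lmodType R}.
Variables (Z B : set V) (Z' B' : set W) (psi : V -> W) (phi : W -> V).
Hypothesis B0 : B 0.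
Hypothesis BP : forall (a : R) x y, B x -> B y -> B (a *: x + y).
Hypothesis B'0 : B' 0.
Hypothesis B'P : forall (a : R) x y, B' x -> B' y -> B' (a *: x + y).
Hypothesis psiP : forall (a : R) x y, psi (a *: x + y) = a *: psi x + psi y.
Hypothesis phiP : forall (a : R) x y, phi (a *: x + y) = a *: phi x + phi y.
Hypothesis psiZ : forall z, Z z -> Z' (psi z).
Hypothesis phiZ : forall z, Z' z -> Z (phi z).
Hypothesis psiB : forall z, B z -> B' (psi z).
Hypothesis phiB : forall z, B' z -> B (phi z).
Hypothesis psiK : forall z, Z z -> phi (psi z) = z.
Hypothesis phiK : forall z, Z' z -> psi (phi z) = z.

Lemma linear_isoI : linear_iso Z B Z' B'.
Proof.
have psiBr x y : psi (x - y) = psi x - psi y.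
  by rewrite addrC -scaleN1r psiP scaleN1r addrC.
have phiBr x y : phi (x - y) = phi x - phi y.
  by rewrite addrC -scaleN1r phiP scaleN1r addrC.
have B'D x y : B' x -> B' y -> B' (x + y).
  by rewrite -{2}[x]scale1r; apply: B'P.
have B'N x : B' x -> B' (- x).
  by move=> /(B'P (-1)) /(_ B'0); rewrite addr0 scaleN1r.
have BN x : B x -> B (- x).
  by move=> /(BP (-1)) /(_ B0); rewrite addr0 scaleN1r.
have BD x y : B x -> B y -> B (x + y).
  by rewrite -{2}[x]scale1r; apply: BP.
have cosetE z z' : coset B' z = coset B' z' -> B' (z - z').
  move=> h; have : coset B' z z by rewrite /coset /= subrr.
  by rewrite h.
have cosetI (z z' : V) : B (z - z') -> coset B z = coset B z'.
  move=> zz'; apply/seteqP; split=> x /= xz.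
    by have := BD _ _ xz zz'; rewrite addrA subrK.
  by have := BD _ _ xz (BN _ zz'); rewrite opprB addrA subrK.
have coset'I (z z' : W) : B' (z - z') -> coset B' z = coset B' z'.
  move=> zz'; apply/seteqP; split=> x /= xz.
    by have := B'D _ _ xz zz'; rewrite addrA subrK.
  by have := B'D _ _ xz (B'N _ zz'); rewrite opprB addrA subrK.
(* The induced map is defined on all subsets, as the saturation of the image under translations by
   [B'], which avoids choosing representatives. *)
pose F (C : set V) : set W := [set y | exists2 x, C x & B' (y - psi x)].
have FE z : F (coset B z) = coset B' (psi z).
  apply/seteqP; split=> [y [x /= xz yx]|y yz].
    by have := B'D _ _ yx (psiB xz); rewrite psiBr addrA subrK.
  by exists z => //; rewrite /coset /= subrr.
exists F; split.
  split.
  - by move=> _ [z Zz <-]; rewrite FE; exists (psi z) => //; apply: psiZ.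
  - move=> _ _ /set_mem[z Zz <-] /set_mem[t Zt <-]; rewrite !FE => /cosetE h.
    by apply: cosetI; rewrite -(psiK Zz) -(psiK Zt) -phiBr; apply: phiB.
  - move=> _ [z' Zz' <-]; exists (coset B (phi z')).
      by exists (phi z') => //; apply: phiZ.
    by rewrite FE phiK.
move=> a x y x' y' Zx Zy Zx' Zy'; rewrite !FE => /cosetE hx /cosetE hy.
apply: coset'I; rewrite psiP opprD addrACA -scalerBr.
exact: B'P.
Qed.
End LinearIso.

(** * Duality under a vanishing modular pair *)

Section LJDuality.
Context {R : realType} {g : vectType R} (dot : {dot g for idfun}).
Local Notation n := (\dim {:g}).
Variables (L E : mvfield dot).
Hypothesis L2 : forall s u, size u != 2%N -> L s u = 0.
Hypothesis E1 : forall s u, size u != 1%N -> E s u = 0.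
Hypothesis Lt : tmv L.
Hypothesis Et : tmv E.
Hypothesis divL : forall s q,
  \sum_i fder (bvec i) L s [:: bcov i; q] = - ((n%:R - 1) * E s [:: q]).
Hypothesis divE : forall s, divg (evec E) s = 0.

Lemma kvector_lin (k : int) (a : R) (P Q : mvfield dot) :
  kvector k P -> kvector k Q -> kvector k (a *: P + Q).
Proof.
move=> /kvectorP[Pk PA Pt PS] /kvectorP[Qk QA Qt QS]; apply/kvectorP; split.
- move=> s u su; rewrite -[LHS]/(a *: P s u + Q s u) Pk // Qk //.
  by rewrite scaler0 addr0.
- by move=> s; apply: AltP.
- move=> s; rewrite -[LHS]/(a *: contract _ (P s) + contract _ (Q s)) Pt Qt.
  by rewrite scaler0 addr0.
- exact: (smoothFD (smoothFZ a PS) QS).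
Qed.

Lemma kvector0 (k : int) : kvector k (0 : mvfield dot).
Proof.
apply/kvectorP; split=> // [s|u]; first exact: Alt0.
exact: smooth_cst.
Qed.

Lemma cochain_lin (k : int) (a : R) (c c' : mvfield dot * mvfield dot) :
  LJ_cochain k c -> LJ_cochain k c' -> LJ_cochain k (a *: c + c').
Proof.
case: c c' => [P Q] [P' Q'] [/= h1 h2] [/= h1' h2'].
by split; [exact: (kvector_lin a h1 h1')|exact: (kvector_lin a h2 h2')].
Qed.

Lemma sbracketP (j : nat) (a : R) (P Q Q' : mvfield dot) :
  (forall s u, size u != j -> P s u = 0) -> tmv P -> tmv Q -> tmv Q' ->
  sbracket P (a *: Q + Q') = a *: sbracket P Q + sbracket P Q'.
Proof.
move=> Pj [PA Pt PS] [QA Qt QS] [QA' Qt' QS']; apply/funext => s.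
have kA : AltF (a *: Q + Q') by move=> t; apply: AltP.
have kS : smoothF (a *: Q + Q') by exact: (smoothFD (smoothFZ a QS) QS').
rewrite -[RHS]/(a *: sbracket P Q s + sbracket P Q' s).
rewrite !(sbracketE s Pj) // scalerDr addrACA; congr (_ + _).
  rewrite scaler_sumr -big_split; apply: eq_bigr => i _ /=.
  rewrite -wedgeZr -wedgeDr; congr wedge.
  rewrite -[LHS]/(fder (bvec i) (fun s => a *: Q s + Q' s) s) fderD ?fderZ //.
  exact: smoothFZ.
rewrite scalerA mulrC -scalerA -scalerDr; congr (_ *: _).
rewrite scaler_sumr -big_split; apply: eq_bigr => i _ /=.
by rewrite -wedgeZr -wedgeDr.
Qed.

Lemma swedge_lin (a : R) (P Q Q' : mvfield dot) :
  swedge P (a *: Q + Q') = a *: swedge P Q + swedge P Q'.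
Proof. by apply/funext => s; rewrite /swedge [LHS]wedgeDr wedgeZr. Qed.

(** Restricted to cochains: sigma differentiates, so linearity is established from smoothness. *)
Lemma sigma_lin (k : int) (a : R) c c' : LJ_cochain k c -> LJ_cochain k c' ->
  LJ_sigma L E k (a *: c + c') = a *: LJ_sigma L E k c + LJ_sigma L E k c'.
Proof.
case: c c' => [P Q] [P' Q'] [/= /kvector_tmv Pt /kvector_tmv Qt].
move=> [/= /kvector_tmv Pt' /kvector_tmv Qt'].
have mz (M : lmodType R) (x y : M) (m : int) :
    (a *: x + y) *~ m = a *: (x *~ m) + y *~ m.
  by rewrite mulrzDl scalerMzr.
apply: injective_projections => /=.
  rewrite (sbracketP _ L2) // !swedge_lin mz opprD !scalerDr scalerN.
  by rewrite [X in X + _ = _]addrACA [LHS]addrACA.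
rewrite (sbracketP _ L2) // (sbracketP _ E1) // swedge_lin mz opprD !scalerDr.
by rewrite scalerN [X in X + _ = _]addrACA [LHS]addrACA.
Qed.

Lemma sigma0 (k : int) : LJ_sigma L E k 0 = 0.
Proof.
have c0 : LJ_cochain k (0 : mvfield dot * mvfield dot).
  by split; apply: kvector0.
have := sigma_lin (-1) c0 c0; rewrite scaler0 addr0 scaleN1r addNr.
by [].
Qed.

Lemma Phi0 (k : int) : Phi k (0 : mvfield dot * mvfield dot) = 0.
Proof.
by have := Phi_linear k (-1) (0 : mvfield dot * mvfield dot) 0;
  rewrite scaler0 addr0 scaleN1r addNr.
Qed.
Lemma PhiN (k : int) (c : mvfield dot * mvfield dot) : Phi k (- c) = - Phi k c.
Proof. by rewrite -scaleN1r -[_ *: _]addr0 Phi_linear Phi0 addr0 scaleN1r. Qed.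
Lemma Psi0 (k : int) : Psi k (0 : dfield dot * dfield dot) = 0.
Proof.
by have := Psi_linear k (-1) (0 : dfield dot * dfield dot) 0;
  rewrite scaler0 addr0 scaleN1r addNr.
Qed.
Lemma coboundary_lin (k : int) (a : R) x y :
  LJ_coboundary L E k x -> LJ_coboundary L E k y ->
  LJ_coboundary L E k (a *: x + y).
Proof.
move=> [c cC <-] [c' cC' <-]; exists (a *: c + c'); first exact: cochain_lin.
exact: sigma_lin.
Qed.

Lemma coboundary0 (k : int) : LJ_coboundary L E k 0.
Proof.
by exists 0; [split; apply: kvector0|apply: sigma0].
Qed.

(** [Phi] carries the cochains of degree n - k - 1 onto the chains of degree k + 1; the sign in
    [delta_Phi] is absorbed by passing to the opposite cochain. *)
Lemma boundaryE (k : int) x : LJ_boundary L E k x <->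
  exists2 y, LJ_coboundary L E (n%:Z - k) y & x = Phi k y.
Proof.
have e : n%:Z - (k + 1) = n%:Z - k - 1 by ring.
have dE c : LJ_cochain (n%:Z - k - 1) c ->
    LJ_delta L E (k + 1) (Phi (k + 1) c) = Phi k (- LJ_sigma L E (n%:Z - k - 1) c).
  rewrite -e => cC; rewrite (delta_Phi L2 E1) // PhiN.
  by rewrite addrK.
split=> [[w wC <-]|[_ [c cC <-] ->]].
  have cC := Psi_cochain wC; rewrite e in cC.
  exists (- LJ_sigma L E (n%:Z - k - 1) (Psi (k + 1) w)).
    rewrite -scaleN1r -[_ *: _]addr0; apply: coboundary_lin; last exact: coboundary0.
    by exists (Psi (k + 1) w).
  by rewrite -dE // PsiK.
have c0 : LJ_cochain (n%:Z - k - 1) (0 : mvfield dot * mvfield dot).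
  by split; apply: kvector0.
have NC : LJ_cochain (n%:Z - k - 1) (- c).
  by rewrite -scaleN1r -[_ *: _]addr0; apply: cochain_lin.
exists (Phi (k + 1) (- c)); first by apply: Phi_chain; rewrite e.
have sN := sigma_lin (-1) cC c0.
by rewrite dE //; move: sN; rewrite sigma0 !addr0 !scaleN1r => ->; rewrite opprK.
Qed.

Lemma LJ_duality (k : int) :
  linear_iso (LJ_cycle L E k) (LJ_boundary L E k)
    (LJ_cocycle L E (n%:Z - k)) (LJ_coboundary L E (n%:Z - k)).
Proof.
have PhiKc (j : int) c : LJ_coboundary L E j c -> forall i, Psi i (Phi i c) = c.
  move=> [c' cC <-] i.
  have [h1 h2 h3 h4] := sigma_tangent L2 E1 Lt Et divL cC.
  exact: PhiK.
apply: (@linear_isoI _ _ _ _ _ _ _ (Psi k) (Phi k)).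
- by apply/boundaryE; exists 0; [exact: coboundary0|rewrite Phi0].
- move=> a x y /boundaryE[x' x'B ->] /boundaryE[y' y'B ->]; apply/boundaryE.
  by exists (a *: x' + y'); [exact: coboundary_lin|rewrite Phi_linear].
- exact: coboundary0.
- by move=> a x y; apply: coboundary_lin.
- exact: Psi_linear.
- exact: Phi_linear.
- move=> z [zC dz]; have cC := Psi_cochain zC; split=> //.
  (* For a cycle, [Phi] kills the value of sigma; that value is alternating and tangent, where [Phi]
     is injective. *)
  have := delta_Phi L2 E1 Lt Et divL divE cC; rewrite PsiK // dz => /esym/eqP.
  rewrite oppr_eq0 => /eqP Ph0; have [h1 h2 h3 h4] := sigma_tangent L2 E1 Lt Et divL cC.
  by rewrite -[LHS](PhiK (k - 1) h1 h2 h3 h4) Ph0 Psi0.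
- move=> z [zC dz]; split; first exact: Phi_chain.
  by rewrite (delta_Phi L2 E1) // dz Phi0 oppr0.
- by move=> z /boundaryE[y yB ->]; rewrite (PhiKc _ _ yB).
- by move=> z zB; apply/boundaryE; exists z.
- by move=> z [zC _]; apply: PsiK.
- move=> z [[/kvectorP[_ h1 h2 _] /kvectorP[_ h3 h4 _]] _].
  exact: PhiK.
Qed.
End LJDuality.

(** * The Lie-Poisson sphere *)

Section LiePoissonSphere.
Context {R : realType} {g : vectType R}.
Variables (br : {bilinear g -> g -> g}) (dot : {dot g for idfun}).
Hypothesis brLie : lie_bracket br.
Implicit Types (x y z v a b c : g) (s : sphere dot) (p q t : covector g).

Local Notation n := (\dim {:g}).
Local Notation covec := (covector g).

Lemma brPl (k : R) x y z : br (k *: x + y) z = k *: br x z + br y z.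
Proof. exact: linearPl. Qed.
Lemma brPr (k : R) x y z : br z (k *: x + y) = k *: br z x + br z y.
Proof. exact: linearPr. Qed.
Lemma brxx x : br x x = 0. Proof. exact: brLie.1. Qed.
Lemma brC x y : br x y = - br y x.
Proof.
apply/eqP; rewrite -addr_eq0; apply/eqP; have := brxx (1 *: x + y).
by rewrite brPl !brPr !brxx !scale1r add0r addr0.
Qed.

Lemma flat_inj x : flatv dot x = 0 -> x = 0.
Proof.
move=> fx; apply/eqP; apply: contraT => x0; have := dot_gt0 dot x0.
by rewrite -flatE fx lfunE ltxx.
Qed.

(** Composing with the coordinate identification [psi] of the dual with g gives an endomorphism of
    g, for which injectivity implies surjectivity. *)
Lemma flat_surj p : exists x, p = flatv dot x.
Proof.
pose psi : covec -> g := fun p => \sum_i p (bvec i) *: bvec i.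
have psiL : linear psi.
  move=> k r r'; rewrite /psi scaler_sumr -big_split; apply: eq_bigr => i _ /=.
  by rewrite add_lfunE scale_lfunE scalerDl scalerA.
have psiE r i : bcov i (psi r) = r (bvec i).
  rewrite /psi (linp_sum _ (linp_cov _)) (bigD1 i) //= big1 => [|j ji].
    by rewrite addr0 (linpZ _ _ (linp_cov _)) bcov_bvec eqxx mulr1.
  by rewrite (linpZ _ _ (linp_cov _)) bcov_bvec eq_sym (negPf ji) mulr0.
have psi_inj r r' : psi r = psi r' -> r = r'.
  move=> rr; rewrite (bcov_sum r) (bcov_sum r'); apply: eq_bigr => i _.
  by rewrite -!psiE rr.
pose T x := psi (flatv dot x).
have TL : linear T by move=> k x y; rewrite /T flatP psiL.
pose Tl : {linear g -> g} := HB.pack T (GRing.isLinear.Build R g g *:%R T TL).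
have kT : lker (linfun Tl) == 0%VS.
  apply/lker0P => x y; rewrite !lfunE /= /T => /psi_inj xy.
  apply/eqP; rewrite -subr_eq0; apply/eqP/flat_inj.
  by rewrite addrC -scaleN1r flatP xy scaleN1r addNr.
have := memvf (psi p); rewrite -(lker0_limgf kT) => /memv_imgP[x _].
by rewrite lfunE => /psi_inj ->; exists x.
Qed.

Lemma dsharp_flat x : dsharp dot (flatv dot x) = x.
Proof.
rewrite /dsharp; apply: lker0_lfunK; apply/lker0P => y z yz.
apply/eqP; rewrite -subr_eq0; apply/eqP/flat_inj.
by rewrite addrC -scaleN1r flatP [flatv dot z](esym yz) scaleN1r addNr.
Qed.

Lemma dsharpE p v : dot (dsharp dot p) v = p v.
Proof. by have [x ->] := flat_surj p; rewrite dsharp_flat flatE. Qed.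

Lemma dsharpP (k : R) p q :
  dsharp dot (k *: p + q) = k *: dsharp dot p + dsharp dot q.
Proof. by rewrite /dsharp linearP. Qed.

Lemma alphaE x : x != 0 -> alpha dot x = flatv dot x.
Proof.
move=> x0; have dE v : ddir v (fun x => 2^-1 * dot x x) x = dot x v.
  apply: has_ddirE.
  have := has_ddirM (has_ddir_cst (2^-1) x v) (has_ddir_dot dot x v).
  by rewrite mulr0 addr0 mulrA mulVf ?mul1r // pnatr_eq0.
rewrite /alpha /dfun.
have -> : (fun v => ddir v (fun x => 2^-1 * dot x x) x : R^o) = linR (linp_dot dot x).
  by apply/funext => v; rewrite dE.
by apply/lfunP => v; rewrite lfunE flatE.
Qed.

Lemma lie_poissonE x a b : lie_poisson br (flat dot x) a b = dot x (br a b).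
Proof. by rewrite /lie_poisson -/(flatv dot x) flatE. Qed.

(** The scalar product of E with [b]. Here and in [Lform], which does the same for Lambda, covectors
    are replaced by vectors through [dsharp], so that the structure identities become identities for
    [dot] and [br]. *)
Definition phi x b : R := dot x (br x b).

Lemma sphere_EE s : sphere_E br dot s =
  fun u => if u is [:: q] then phi (val s) (dsharp dot q) else 0.
Proof.
apply/funext => -[|q [|r u]]; rewrite /sphere_E /E' /contract //=.
by rewrite lie_poissonE alphaE ?dsharp_flat //; apply: sphere_neq0.
Qed.

Lemma E_deg s u : size u != 1%N -> sphere_E br dot s u = 0.
Proof. by rewrite sphere_EE; case: u => [|q [|r u]]. Qed.

Definition Lform x a b : R :=
  dot x (br a b) - (dot a x * phi x b - dot b x * phi x a).

Lemma sphere_LE s : sphere_L br dot s =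
  fun u => if u is [:: p; q] then Lform (val s) (dsharp dot p) (dsharp dot q) else 0.
Proof.
have E1 u : (size u)%:Z != 1 -> sphere_E br dot s u = 0.
  by move=> u1; apply: E_deg; apply: contra_neq u1 => ->.
have V1 u : (size u)%:Z != 1 -> vec1 (val s) u = 0 by case: u => [|p [|q u]].
apply/funext => u; rewrite /sphere_L /L'.
rewrite -[LHS]/(barL br dot (val s) u - wedge (vec1 (val s)) (sphere_E br dot s) u).
have [u2|u2] := eqVneq (size u) 2%N; last first.
  rewrite (wedge_size V1 E1); last by apply: contra_neq u2 => -[].
  by rewrite subr0; move: u2; case: u => [|p [|q [|r u]]].
rewrite wedge_deg1; last by move=> v v1; rewrite V1 //; apply: contra_neq v1 => -[].
move: u2; case: u => [|p [|q [|r u]]] //= _.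
rewrite /contract lie_poissonE !sphere_EE subr0 /Lform !dsharpE.
by [].
Qed.

Lemma L_deg s u : size u != 2%N -> sphere_L br dot s u = 0.
Proof. by rewrite sphere_LE; case: u => [|p [|q [|r u]]]. Qed.

Lemma linp_dotbr x a : linp (fun b => dot x (br a b)).
Proof. by move=> k b c; rewrite brPr dotPr. Qed.
Lemma linp_dotbrl x b : linp (fun a => dot x (br a b)).
Proof. by move=> k a c; rewrite brPl dotPr. Qed.
Lemma linp_phi x : linp (phi x).
Proof. exact: linp_dotbr. Qed.
Lemma phixx x : phi x x = 0.
Proof. by rewrite /phi brxx (linp0 (linp_dot dot x)). Qed.

Lemma Lform_alt x a : Lform x a a = 0.
Proof. by rewrite /Lform brxx (linp0 (linp_dot dot x)); ring. Qed.
Lemma Lform_linr x a : linp (Lform x a).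
Proof.
by move=> k b c; rewrite /Lform (linp_dotbr x a) (linp_phi x) dotP; ring.
Qed.
Lemma Lform_linl x b : linp (fun a => Lform x a b).
Proof.
by move=> k a c; rewrite /Lform (linp_dotbrl x b) (linp_phi x) dotP; ring.
Qed.

Lemma Alt_E : AltF (sphere_E br dot).
Proof.
move=> s; rewrite sphere_EE; split.
  move=> [|p u] [|q v] k r r' //=; rewrite ?mulr0 ?addr0 //.
    by rewrite dsharpP (linp_phi (val s)).
  - by case: u => [|? ?]; rewrite ?mulr0 ?addr0.
  - by case: u => [|? ?]; rewrite ?mulr0 ?addr0.
by move=> [|p u] v r //=; case: u.
Qed.

Lemma Alt_L : AltF (sphere_L br dot).
Proof.
move=> s; rewrite sphere_LE; split.
  move=> [|p [|p' [|? ?]]] [|q [|q' v]] k r r' //=; rewrite ?mulr0 ?addr0 //.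
  - by rewrite dsharpP (Lform_linl (val s) (dsharp dot q)).
  - by rewrite dsharpP (Lform_linr (val s) (dsharp dot p)).
move=> [|p [|p' [|? ?]]] [|q v] r //=.
exact: Lform_alt.
Qed.

Section Bilinear.
Variable B : g -> g -> R.
Hypotheses (Bl : forall y, linp (fun x => B x y)) (Br : forall x, linp (B x)).

Lemma bilin_basis x : B x x = \sum_i bcov i x * B (bvec i) x.
Proof. exact: (linp_basis x (Bl x)). Qed.

Lemma smooth_bilin : smooth (fun s => B (val s) (val s)).
Proof.
have -> : (fun s : sphere dot => B (val s) (val s)) =
    (fun s => \sum_i bcov i (val s) * B (bvec i) (val s)).
  by apply/funext => s; apply: bilin_basis.
apply: smooth_sum => i; apply: smoothM; first exact: smooth_coord.
exact: (smooth_lin dot (Br (bvec i))).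
Qed.

Lemma sder_bilin v s : sder v (fun s => B (val s) (val s)) s =
  B (tproj s v) (val s) + B (val s) (tproj s v).
Proof.
have -> : (fun s : sphere dot => B (val s) (val s)) =
    (fun s => \sum_i bcov i (val s) * B (bvec i) (val s)).
  by apply/funext => t; apply: bilin_basis.
have sB i : smooth (fun s : sphere dot => B (bvec i) (val s)).
  exact: (smooth_lin dot (Br (bvec i))).
rewrite sder_sum; last by move=> i; apply: smoothM => //; apply: smooth_coord.
under eq_bigr => i _.
  rewrite (sderM _ _ (smooth_coord dot (bcov i)) (sB i)) sder_coord (sder_lin _ _ (Br _)).
  rewrite -(linpZ _ _ (Br _)) -(linpB _ _ (Br _)) -/(tproj s v) [B _ _ * bcov _ _]mulrC.
  over.
rewrite big_split /= addrC; congr (_ + _).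
  by rewrite -(linp_basis (tproj s v) (Bl (val s))).
by rewrite -(linp_basis (val s) (Bl (tproj s v))).
Qed.
End Bilinear.

Definition dphi s v b : R :=
  dot (tproj s v) (br (val s) b) + dot (val s) (br (tproj s v) b).

Lemma phi_bilinl b y : linp (fun x => dot x (br y b)).
Proof. exact: linp_dotl. Qed.
Lemma phi_bilinr b x : linp (fun y => dot x (br y b)).
Proof. exact: linp_dotbrl. Qed.

Lemma smooth_phi b : smooth (fun s : sphere dot => phi (val s) b).
Proof. exact: (smooth_bilin (phi_bilinl b) (phi_bilinr b)). Qed.

Lemma sder_phi v s b : sder v (fun s => phi (val s) b) s = dphi s v b.
Proof. exact: (sder_bilin (phi_bilinl b) (phi_bilinr b)). Qed.

Lemma sder_dotl v s a : sder v (fun s : sphere dot => dot (val s) a) s = dot (tproj s v) a.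
Proof.
rewrite (sder_lin _ _ (linp_dotl dot a)) /tproj (linpB _ _ (linp_dotl dot a)).
by rewrite (linpZ _ _ (linp_dotl dot a)).
Qed.
Lemma sder_dotr v s a : sder v (fun s : sphere dot => dot a (val s)) s = dot a (tproj s v).
Proof.
rewrite (sder_lin _ _ (linp_dot dot a)) /tproj (linpB _ _ (linp_dot dot a)).
by rewrite (linpZ _ _ (linp_dot dot a)).
Qed.

Lemma smooth_dotl a : smooth (fun s : sphere dot => dot (val s) a).
Proof. exact: (smooth_lin dot (linp_dotl dot a)). Qed.
Lemma smooth_dotr a : smooth (fun s : sphere dot => dot a (val s)).
Proof. exact: (smooth_lin dot (linp_dot dot a)). Qed.

Lemma smooth_Lform a b : smooth (fun s : sphere dot => Lform (val s) a b).
Proof.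
apply: smoothB; first exact: smooth_dotl.
apply: smoothB; first exact: (smoothM (smooth_dotr a) (smooth_phi b)).
exact: (smoothM (smooth_dotr b) (smooth_phi a)).
Qed.

Definition dL s v a b : R := dot (tproj s v) (br a b)
  - (dot a (tproj s v) * phi (val s) b + dot a (val s) * dphi s v b)
  + (dot b (tproj s v) * phi (val s) a + dot b (val s) * dphi s v a).

Lemma sder_Lform v s a b : sder v (fun s => Lform (val s) a b) s = dL s v a b.
Proof.
have Sa := smooth_dotr a; have Sb := smooth_dotr b.
have Fa := smooth_phi a; have Fb := smooth_phi b.
have Sab := smoothM Sa Fb; have Sba := smoothM Sb Fa.
rewrite (sderB _ _ (smooth_dotl (br a b)) (smoothB Sab Sba)).
rewrite (sderB _ _ Sab Sba) (sderM _ _ Sa Fb) (sderM _ _ Sb Fa).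
rewrite sder_dotl !sder_dotr !sder_phi /dL.
move: (dphi s v a) (dphi s v b) (phi (val s) a) (phi (val s) b) => x1 x2 x3 x4.
move: (dot _ (br a b)) (dot a _) (dot b _) (dot a _) (dot b _) => y1 y2 y3 y4 y5.
ring.
Qed.

Lemma tmv_E : tmv (sphere_E br dot).
Proof.
split; first exact: Alt_E.
  move=> s; apply/funext => -[|q u]; rewrite /contract sphere_EE //.
  by rewrite dsharp_flat phixx.
move=> u; rewrite (_ : (fun s => _) = fun s =>
  if u is [:: q] then phi (val s) (dsharp dot q) else 0); last first.
  by apply/funext => s; rewrite sphere_EE.
case: u => [|q [|r u]]; [exact: smooth_cst|exact: smooth_phi|exact: smooth_cst].
Qed.

Lemma tmv_L : tmv (sphere_L br dot).
Proof.
split; first exact: Alt_L.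
  move=> s; apply/funext => -[|q [|r u]]; rewrite /contract sphere_LE //.
  rewrite dsharp_flat /Lform phixx mulr0 subr0 sphere_dot mul1r.
  by rewrite -/(phi _ _) subrr.
move=> u; rewrite (_ : (fun s => _) = fun s =>
  if u is [:: p; q] then Lform (val s) (dsharp dot p) (dsharp dot q) else 0); last first.
  by apply/funext => s; rewrite sphere_LE.
case: u => [|p [|q [|r u]]]; [exact: smooth_cst|exact: smooth_cst| |exact: smooth_cst].
exact: smooth_Lform.
Qed.

Lemma sphere_LpE s p q : sphere_L br dot s [:: p; q] =
  Lform (val s) (dsharp dot p) (dsharp dot q).
Proof. by rewrite sphere_LE. Qed.
Lemma sphere_EpE s q : sphere_E br dot s [:: q] = phi (val s) (dsharp dot q).
Proof. by rewrite sphere_EE. Qed.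

Lemma fder_L v s p q : fder v (sphere_L br dot) s [:: p; q] =
  dL s v (dsharp dot p) (dsharp dot q).
Proof.
rewrite -sder_Lform /fder; apply: eq_sder => t; exact: sphere_LpE.
Qed.
Lemma fder_E v s q : fder v (sphere_E br dot) s [:: q] = dphi s v (dsharp dot q).
Proof.
rewrite -sder_phi /fder; apply: eq_sder => t; exact: sphere_EpE.
Qed.
End LiePoissonSphere.

(** * The modular pair as traces in a basis and its reciprocal basis *)

Section Divergence.
Context {R : realType} {g : vectType R}.
Variables (br : {bilinear g -> g -> g}) (dot : {dot g for idfun}).
Hypothesis brLie : lie_bracket br.
Hypothesis brU : unimodular_lie br.
Implicit Types (x y z v a b c : g) (s : sphere dot) (p q t : covector g).
Local Notation n := (\dim {:g}).
Local Notation phi := (phi br dot).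

Definition recip (i : 'I_n) : g := dsharp dot (bcov i).

Lemma recipE i v : dot (recip i) v = bcov i v.
Proof. exact: dsharpE. Qed.

Lemma recip_sum x : x = \sum_i dot x (bvec i) *: recip i.
Proof.
have h : flatv dot x = flatv dot (\sum_i dot x (bvec i) *: recip i).
  apply/lfunP => v; rewrite !flatE (linp_sum _ (linp_dotl dot v)).
  rewrite (linp_basis v (linp_dot dot x)); apply: eq_bigr => i _.
  by rewrite (linpZ _ _ (linp_dotl dot v)) recipE mulrC.
by rewrite -[LHS](dsharp_flat dot) h dsharp_flat.
Qed.

Lemma recip_linp (l : g -> R) x : linp l -> l x = \sum_i dot x (bvec i) * l (recip i).
Proof.
move=> lL; rewrite {1}(recip_sum x) (linp_sum _ lL); apply: eq_bigr => i _.
exact: linpZ.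
Qed.

(* [\sum_i b_i (x) r_i] is a symmetric tensor. *)
Lemma recip_sym (B : g -> g -> R) : (forall y, linp (fun x => B x y)) ->
  (forall x, linp (B x)) ->
  \sum_i B (bvec i) (recip i) = \sum_i B (recip i) (bvec i).
Proof.
move=> Bl Br.
transitivity (\sum_i \sum_j dot (bvec i) (bvec j) * B (recip j) (recip i)).
  by apply: eq_bigr => i _; apply: (recip_linp _ (Bl (recip i))).
rewrite exchange_big; apply: eq_bigr => i _ /=.
rewrite (recip_linp (bvec i) (Br (recip i))); apply: eq_bigr => j _.
by rewrite dotC.
Qed.

Lemma trace_ad y : \sum_i bcov i (br y (bvec i)) = 0.
Proof.
rewrite -[RHS](brU y) /mxtrace; apply: eq_bigr => i _.
by rewrite bcovE mxE /= /passmx.rVof mxE passmx.vecof_delta lfunE.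
Qed.

(** The trace over the tangent space is the ambient trace minus the value on the normal direction,
    since the r_i weighted by the scalar products of s with b_i add up to s. *)
Lemma sum_tproj (B : g -> g -> R) s : (forall y, linp (fun x => B x y)) ->
  (forall x, linp (B x)) ->
  \sum_i B (tproj s (bvec i)) (recip i) =
  \sum_i B (bvec i) (recip i) - B (val s) (val s).
Proof.
move=> Bl Br; rewrite (recip_linp (val s) (Br (val s))) -sumrB.
apply: eq_bigr => i _.
by rewrite /tproj (linpB _ _ (Bl _)) (linpZ _ _ (Bl _)).
Qed.

Lemma linp_scale (l : g -> R) k : linp l -> linp (fun x => k * l x).
Proof. by move=> lL c x y; rewrite lL; ring. Qed.
Lemma linp_scaler (l : g -> R) k : linp l -> linp (fun x => l x * k).
Proof. by move=> lL c x y; rewrite lL; ring. Qed.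

(** By the symmetry of the tensor this is the trace of ad_y, which vanishes by unimodularity. *)
Lemma trace_br_sym y : \sum_i dot (bvec i) (br y (recip i)) = 0.
Proof.
rewrite (recip_sym (fun z => linp_dotl dot (br y z))); last first.
  by move=> x; apply: linp_dotbr.
rewrite -[RHS](trace_ad y); apply: eq_bigr => i _.
exact: recipE.
Qed.

(** A symmetric tensor is contracted with an antisymmetric bracket. *)
Lemma sum_br_recip x : \sum_i dot x (br (bvec i) (recip i)) = 0.
Proof.
have h := recip_sym (fun z => linp_dotbrl br dot x z) (fun z => linp_dotbr br dot x z).
have : \sum_i dot x (br (bvec i) (recip i)) = - \sum_i dot x (br (bvec i) (recip i)).
  rewrite {1}h -sumrN; apply: eq_bigr => i _.
  by rewrite (brC brLie) (linpN _ (linp_dot dot x)).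
by move: (\sum_i _) => r rr; lra.
Qed.

Lemma div_phi s : \sum_i dphi br s (bvec i) (recip i) = 0.
Proof.
rewrite /dphi big_split /=.
rewrite (sum_tproj (B := fun x y => dot x (br (val s) y))); first last.
- by move=> x; apply: linp_dotbr.
- by move=> y; apply: linp_dotl.
rewrite (sum_tproj (B := fun x y => dot (val s) (br x y))); first last.
- by move=> x; apply: linp_dotbr.
- by move=> y; apply: linp_dotbrl.
rewrite trace_br_sym sum_br_recip (brxx brLie) (linp0 (linp_dot dot _)).
by rewrite !subr0 addr0.
Qed.

(** Unimodularity kills the ambient trace in [T1], leaving the normal term, and gives [div_phi].
    [T2] is the trace of the tangential projection, hence the dimension n - 1, and [T3] is a radial
    derivative. [T1] and [T4] cancel. *)
Lemma div_L s b : \sum_i dL br s (bvec i) (recip i) b = - ((n%:R - 1) * phi (val s) b).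
Proof.
have ph1 := linp_phi br dot (val s).
have T1 : \sum_i dot (tproj s (bvec i)) (br (recip i) b) = - phi (val s) b.
  rewrite (sum_tproj (B := fun x y => dot x (br y b))); first last.
  - by move=> x; apply: linp_dotbrl.
  - by move=> y; apply: linp_dotl.
  rewrite (_ : \sum_i _ = 0) ?sub0r //.
  rewrite (recip_sym (fun y => linp_dotl dot (br y b))); last first.
    by move=> x; apply: linp_dotbrl.
  rewrite -[RHS]oppr0 -[in RHS](trace_ad b) -sumrN; apply: eq_bigr => i _.
  by rewrite recipE (brC brLie) (linpN _ (linp_cov _)).
have T2 : \sum_i dot (recip i) (tproj s (bvec i)) = n%:R - 1.
  under eq_bigr => i _ do rewrite dotC.
  rewrite (sum_tproj (B := fun x y => dot x y)); first last.
  - by move=> x; apply: linp_dot.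
  - by move=> y; apply: linp_dotl.
  rewrite sphere_dot; congr (_ - _).
  under eq_bigr => i _ do rewrite dotC recipE bcov_bvec eqxx.
  by rewrite sumr_const card_ord.
have T3 : \sum_i dot (recip i) (val s) * dphi br s (bvec i) b = 0.
  have dl : linp (fun v => dphi br s v b).
    by rewrite /linp => k x y; rewrite -!sder_phi; apply: (sder_linv s (smooth_phi br dot b)).
  under eq_bigr => i _ do rewrite recipE.
  rewrite -(linp_basis (val s) dl) -sder_phi.
  exact: (sder_radial s (smooth_phi br dot b)).
have T4 : \sum_i dot b (tproj s (bvec i)) * phi (val s) (recip i) = phi (val s) b.
  rewrite (sum_tproj (B := fun x y => dot b x * phi (val s) y)); first last.
  - by move=> x; apply: linp_scale.
  - by move=> y; apply: linp_scaler; apply: linp_dot.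
  rewrite (phixx dot brLie) mulr0 subr0 [RHS](recip_linp b ph1).
  by [].
rewrite /dL big_split sumrB /= T1 !big_split /= -mulr_suml T2 T3 T4.
by rewrite -mulr_sumr div_phi; ring.
Qed.

Lemma sphere_divL s q :
  \sum_i fder (bvec i) (sphere_L br dot) s [:: bcov i; q]
  = - ((n%:R - 1) * sphere_E br dot s [:: q]).
Proof.
rewrite sphere_EpE -div_L; apply: eq_bigr => i _; exact: fder_L.
Qed.

Lemma sphere_divE s : divg (evec (sphere_E br dot)) s = 0.
Proof.
rewrite -[RHS](div_phi s) /divg; apply: eq_bigr => i _.
rewrite cov_vder; last exact: (smoothV_evec (tmv_E dot brLie)).
rewrite -fder_E /fder; apply: eq_sder => t.
exact: (evecE (tmv_E dot brLie)).
Qed.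
End Divergence.

(** * Wedge products on pairs and triples *)

Section SmallWedges.
Context {R : realType} {W : lmodType R}.
Implicit Types (A B : seq W -> R^o) (p q t : W).

Lemma wedge_size_nat (i j : nat) A B (u : seq W) :
  (forall v, size v != i -> A v = 0) -> (forall v, size v != j -> B v = 0) ->
  size u != (i + j)%N -> wedge A B u = 0.
Proof.
move=> Ai Bj uij; apply: (@wedge_size _ _ i j) => [v vi|v vj|].
- by apply: Ai; apply: contra_neq vi => ->.
- by apply: Bj; apply: contra_neq vj => ->.
- by apply: contra_neq uij; rewrite -PoszD => -[].
Qed.

Lemma wedge1_pair A B p q : (forall u, size u != 1%N -> A u = 0) ->
  wedge A B [:: p; q] = A [:: p] * B [:: q] - A [:: q] * B [:: p].
Proof. by move=> A1; rewrite wedge_deg1 //= subr0. Qed.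

Lemma wedge1_triple A B p q t : (forall u, size u != 1%N -> A u = 0) ->
  wedge A B [:: p; q; t] =
  A [:: p] * B [:: q; t] - A [:: q] * B [:: p; t] + A [:: t] * B [:: p; q].
Proof.
by move=> A1; rewrite wedge_deg1 //= subr0 /contract opprB addrA addrAC.
Qed.

Lemma wedge2_triple A B p q t : (forall u, size u != 2%N -> A u = 0) ->
  (forall u, size u != 1%N -> B u = 0) ->
  wedge A B [:: p; q; t] =
  A [:: p; q] * B [:: t] - A [:: p; t] * B [:: q] + A [:: q; t] * B [:: p].
Proof.
move=> A2 B1; rewrite -[LHS]/(contract p (wedge A B) [:: q; t]) contract_wedge2 //.
rewrite -[LHS]/(ext _ B [:: q; t] + contract q (wedge A (contract p B)) [:: t]).
rewrite contract_wedge2 // -[X in _ + X]/(ext _ _ [:: t] + wedge A _ [:: t]).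
rewrite (_ : wedge A _ [:: t] = 0) ?addr0; last first.
  rewrite (_ : contract q _ = 0) ?wedge0r //.
  by apply/funext => u; rewrite /contract B1.
by rewrite /= !subr0 /contract.
Qed.
End SmallWedges.

(** * The two identities of a Jacobi structure *)

Section JacobiStructure.
Context {R : realType} {g : vectType R}.
Variables (br : {bilinear g -> g -> g}) (dot : {dot g for idfun}).
Hypothesis brLie : lie_bracket br.
Implicit Types (x y z v a b c : g) (s : sphere dot) (p q t : covector g).
Local Notation n := (\dim {:g}).

Lemma riesz (l : g -> R) : linp l ->
  forall y, dot y (\sum_i l (recip dot i) *: bvec i) = l y.
Proof.
move=> lL y; rewrite (linp_sum _ (linp_dot dot y)) (recip_linp dot y lL).
by apply: eq_bigr => i _; rewrite (linpZ _ _ (linp_dot dot y)) mulrC.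
Qed.

Lemma dotN x y : dot x (- y) = - dot x y.
Proof. exact: (linpN y (linp_dot dot x)). Qed.
Lemma brNr x y : br y (- x) = - br y x.
Proof. by have := brPr br (-1) x 0 y; rewrite !scaleN1r addr0 linear0r addr0. Qed.

Lemma dot_jacobi u x y z :
  dot u (br x (br y z)) = - dot u (br y (br z x)) - dot u (br z (br x y)).
Proof.
have /(congr1 (dot u)) := brLie.2 x y z.
by rewrite !(linpD _ _ (linp_dot dot u)) (linp0 (linp_dot dot u)) => h; lra.
Qed.

Section AtPoint.
Variable s : sphere dot.
Local Notation S := (val s).
Local Notation ph := (phi br dot S).
Local Notation M := (Lform br dot S).

(** [XL a] is the opposite of the vector #_Lambda of the covector dual to [a], and [YL c] is the
    opposite of the transpose of ad_c applied to s. They absorb the sums over the basis in the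
    brackets. *)
Definition XL a : g := \sum_i M (recip dot i) a *: bvec i.
Definition YL c : g := \sum_i dot S (br (recip dot i) c) *: bvec i.

Lemma dot_XL a y : dot y (XL a) = M y a.
Proof. exact: (riesz (Lform_linl br dot S a)). Qed.
Lemma dot_YL c y : dot y (YL c) = dot S (br y c).
Proof. exact: (riesz (linp_dotbrl br dot S c)). Qed.

(** The Jacobi identity in the only form in which it involves E. *)
Lemma phi_bracket x y : ph (br x y) =
  dot S (br x (br S y)) - dot S (br y (br S x)).
Proof.
rewrite /phi dot_jacobi (brC brLie y S) brNr dotN opprK.
by [].
Qed.

Lemma dphi_tangent X c : dot S X = 0 ->
  dphi br s X c = dot X (br S c) + dot S (br X c).
Proof. by move=> SX; rewrite /dphi /tproj SX scale0r subr0. Qed.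

Lemma dL_tangent X b c : dot S X = 0 -> dL br s X b c =
  dot X (br b c) - (dot b X * ph c + dot b S * (dot X (br S c) + dot S (br X c)))
  + (dot c X * ph b + dot c S * (dot X (br S b) + dot S (br X b))).
Proof. by move=> SX; rewrite /dL !dphi_tangent // /tproj SX scale0r subr0. Qed.

Lemma M_S a : M S a = 0.
Proof.
by rewrite /Lform (phixx dot brLie) sphere_dot mulr0 mul1r subr0 subrr.
Qed.

Lemma sum_dL a b c : \sum_i M (recip dot i) a * dL br s (bvec i) b c = dL br s (XL a) b c.
Proof.
have dl : linp (fun v => dL br s v b c).
  by move=> k x y; rewrite -!sder_Lform; apply: (sder_linv s (smooth_Lform br dot b c)).
rewrite /XL (linp_sum _ dl); apply: eq_bigr => i _.
by rewrite (linpZ _ _ dl).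
Qed.

Lemma sum_dphi a b : \sum_i M (recip dot i) a * dphi br s (bvec i) b = dphi br s (XL a) b.
Proof.
have dl : linp (fun v => dphi br s v b).
  by move=> k x y; rewrite -!sder_phi; apply: (sder_linv s (smooth_phi br dot b)).
rewrite /XL (linp_sum _ dl); apply: eq_bigr => i _.
by rewrite (linpZ _ _ dl).
Qed.

Lemma M_bracket x c a : M (br x c) a = - dot S (br a (br x c))
  - (dot S (br x c) * ph a - dot a S * ph (br x c)).
Proof. by rewrite /Lform (brC brLie (br x c)) dotN [dot (br x c) S]dotC. Qed.

Lemma M_YL c a : M (YL c) a = dot (YL c) (YL a)
  - (ph c * ph a - dot a S * ph (YL c)).
Proof. by rewrite /Lform !dot_YL [dot (YL c) S]dotC dot_YL. Qed.

Lemma dphi_XL a c : dphi br s (XL a) c = M (br S c) a + M (YL c) a.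
Proof.
by rewrite dphi_tangent ?dot_XL ?M_S // dotC dot_XL -dot_YL dotC dot_XL.
Qed.

Lemma dL_XL a b c : dL br s (XL a) b c =
  M (br b c) a - (M b a * ph c + dot b S * (M (br S c) a + M (YL c) a))
  + (M c a * ph b + dot c S * (M (br S b) a + M (YL b) a)).
Proof.
rewrite dL_tangent ?dot_XL ?M_S // -!dot_YL.
by rewrite ![dot (XL a) _]dotC !dot_XL.
Qed.

(** Half of [Lambda, Lambda] = 2 E /\ Lambda on three covectors. Once the derivatives are taken
    along the vectors [XL], everything is a polynomial in scalar products. *)
Lemma jacobi_LL a b c :
  dL br s (XL a) b c - dL br s (XL b) a c + dL br s (XL c) a b =
  ph a * M b c - ph b * M a c + ph c * M a b.
Proof.
rewrite !dL_XL !M_bracket !M_YL !phi_bracket.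
(* The Jacobi identity eliminates one of the three cyclic double brackets; antisymmetry then puts
   the remaining scalar products in normal form, after which they are treated as independent
   variables. *)
rewrite (dot_jacobi _ a b c) (brC brLie c a) brNr dotN.
rewrite /Lform (brC brLie b a) (brC brLie c a) (brC brLie c b) !dotN.
rewrite (dotC dot (YL b) (YL a)) (dotC dot (YL c) (YL a)) (dotC dot (YL c) (YL b)).
have e x : dot S (br S x) = ph x by [].
rewrite !e.
move: (dot S (br b (br a c))) (dot S (br c (br a b))) => A1 A2.
move: (dot S (br a (br S b))) (dot S (br a (br S c))) => Q1 Q2.
move: (dot S (br b (br S a))) (dot S (br b (br S c))) => Q3 Q4.
move: (dot S (br c (br S a))) (dot S (br c (br S b))) => Q5 Q6.
move: (dot (YL a) (YL b)) (dot (YL a) (YL c)) (dot (YL b) (YL c)) => G1 G2 G3.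
move: (dot S (br a b)) (dot S (br a c)) (dot S (br b c)) => B1 B2 B3.
move: (dot a S) (dot b S) (dot c S) => a1 b1 c1.
move: (ph (YL a)) (ph (YL b)) (ph (YL c)) => Y1 Y2 Y3.
move: (ph (br S a)) (ph (br S b)) (ph (br S c)) => P1 P2 P3.
move: (dot S (br a (br S S))) (dot S (br b (br S S))) (dot S (br c (br S S))).
move=> Z1 Z2 Z3.
move: (ph a) (ph b) (ph c) => p1 p2 p3.
ring.
Qed.

(** [E, Lambda] = 0 on two covectors; [e] stands for the vector E, known only through its scalar
    products. *)
Lemma jacobi_EL e b c : (forall y, dot y e = ph y) ->
  dL br s e b c - (dphi br s (XL c) b - dphi br s (XL b) c) = 0.
Proof.
move=> eE; have Se : dot S e = 0 by rewrite eE (phixx dot brLie).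
rewrite dL_tangent // !dphi_XL !M_bracket !M_YL -(dot_YL c e) -(dot_YL b e).
rewrite ![dot e _]dotC !eE.
rewrite !phi_bracket.
rewrite (dotC dot (YL c) (YL b)).
have e' x : dot S (br S x) = ph x by [].
rewrite !e'.
move: (dot S (br b (br S c))) (dot S (br c (br S b))) => Q1 Q2.
move: (ph (br S b)) (ph (br S c)) => P1 P2.
move: (dot S (br b (br S S))) (dot S (br c (br S S))) => Z1 Z2.
move: (ph (YL b)) (ph (YL c)) (ph b) (ph c) => Y1 Y2 p1 p2.
move: (dot (YL b) (YL c)) (dot b S) (dot c S) => G b1 c1.
ring.
Qed.
End AtPoint.

Lemma sphere_kvectors : kvector 2 (sphere_L br dot) /\ kvector 1 (sphere_E br dot).
Proof.
split; apply/kvectorP.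
  have [LA Lt LS] := tmv_L dot brLie; split=> // s u u2.
  by apply: L_deg; apply: contra_neq u2 => ->.
have [EA Et ES] := tmv_E dot brLie; split=> // s u u1.
by apply: E_deg; apply: contra_neq u1 => ->.
Qed.

(** All terms are homogeneous, so only triples, respectively pairs, of covectors need evaluation;
    there linearity of the derivative in its direction collects the sums over the basis into
    [XL]. *)
Lemma sphere_jacobi : jacobi_structure (sphere_L br dot) (sphere_E br dot).
Proof.
have [LA Lt LS] := tmv_L dot brLie; have [EA Et ES] := tmv_E dot brLie.
have L2 := @L_deg R g br dot; have E1 := @E_deg R g br dot.
have cL1 s i u : size u != 1%N -> contract (bcov i) (sphere_L br dot s) u = 0.
  by move=> u1; apply: L2.
have dL2 s i u : size u != 2%N -> fder (bvec i) (sphere_L br dot) s u = 0.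
  by move=> u2; apply: fder_size => t; apply: L2.
have dE1 s i u : size u != 1%N -> fder (bvec i) (sphere_E br dot) s u = 0.
  by move=> u2; apply: fder_size => t; apply: E1.
have [Lk Ek] := sphere_kvectors; split=> //; apply/funext => s; apply/funext => u.
- rewrite (sbracketE s L2) // sqrrN expr1n scale1r.
  transitivity (wedge (sphere_E br dot s) (sphere_L br dot s) u *+ 2 : R); last first.
    by rewrite natmulfctE natmulfctE.
  rewrite fctE !fct_sumE.
  have [u3|u3] := eqVneq (size u) 3%N; last first.
    rewrite !big1 ?(wedge_size_nat (E1 s) (L2 s)) ?mul0rn ?addr0 // => i _.
      exact: (wedge_size_nat (dL2 s i) (cL1 s i)).
    exact: (wedge_size_nat (cL1 s i) (dL2 s i)).
  case: u u3 => [|p [|q [|t [|r u]]]] // _.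
  rewrite wedge1_triple; last exact: E1.
  rewrite !sphere_LpE !sphere_EpE -(jacobi_LL s).
  rewrite -!sum_dL -!sumrB -!big_split -sumrMnl.
  apply: eq_bigr => i _ /=.
  rewrite wedge1_triple; last exact: cL1.
  rewrite wedge2_triple; [|exact: dL2|exact: cL1].
  rewrite /contract !sphere_LpE !fder_L -/(recip dot i).
  move: (Lform _ _ _ _ _) (Lform _ _ _ _ _) (Lform _ _ _ _ _) => x1 x2 x3.
  move: (dL _ _ _ _ _) (dL _ _ _ _ _) (dL _ _ _ _ _) => y1 y2 y3.
  ring.
rewrite (sbracketE s E1) // expr1 scaleN1r.
transitivity (\sum_i wedge (contract (bcov i) (sphere_E br dot s))
    (fder (bvec i) (sphere_L br dot) s) u
  - \sum_i wedge (fder (bvec i) (sphere_E br dot) s)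
    (contract (bcov i) (sphere_L br dot s)) u).
  by rewrite -[LHS]/((\sum_i wedge _ _) u - (\sum_i wedge _ _) u) !fct_sumE.
have cE0 i r : size r != 0%N -> contract (bcov i) (sphere_E br dot s) r = 0.
  by move=> r0; apply: E1.
have [u2|u2] := eqVneq (size u) 2%N; last first.
  rewrite !big1 ?subr0 // => i _.
    exact: (wedge_size_nat (dE1 s i) (cL1 s i)).
  exact: (wedge_size_nat (cE0 i) (dL2 s i)).
case: u u2 => [|q [|t [|r u]]] // _.
have eE y : dot y (evec (sphere_E br dot) s) = phi br dot (val s) y.
  by rewrite -(flatE dot y) (evecE (tmv_E dot brLie)) sphere_EpE dsharp_flat.
rewrite -[RHS](jacobi_EL (dsharp dot q) (dsharp dot t) eE).
congr (_ - _).
  rewrite -fder_L (fder_basis _ _ LS) fct_sumE; apply: eq_bigr => i _.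
  rewrite (wedge_deg0 _ (cE0 i)) (evecE (tmv_E dot brLie)).
  by [].
rewrite -!sum_dphi -sumrB; apply: eq_bigr => i _.
rewrite (wedge1_pair _ _ _ (dE1 s i)) /contract !sphere_LpE !fder_E.
by rewrite -/(recip dot i) mulrC [X in _ - X]mulrC.
Qed.
End JacobiStructure.

(** * The modular class *)

Section Unimodular.
Context {R : realType} {g : vectType R} (dot : {dot g for idfun}).
Local Notation n := (\dim {:g}).
Local Notation covec := (covector g).
Variables (L E : mvfield dot).
Hypothesis L2 : forall s u, size u != 2%N -> L s u = 0.
Hypothesis E1 : forall s u, size u != 1%N -> E s u = 0.
Hypothesis Lt : tmv L.
Hypothesis Et : tmv E.
Hypothesis divL : forall s q,
  \sum_i fder (bvec i) L s [:: bcov i; q] = - ((n%:R - 1) * E s [:: q]).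
Hypothesis divE : forall s, divg (evec E) s = 0.
Implicit Types (f h : sphere dot -> R) (s : sphere dot).

Lemma wedge_one (W : lmodType R) (a : seq W -> R^o) : wedge a one = a.
Proof.
apply/funext => u; elim: u a => [|x u IHu] a.
  by rewrite wedgeE shuffle_sum_nil mulr1.
rewrite wedgeE shuffle_sum_cons -[X in X + _]/(wedge (contract x a) one u) IHu.
rewrite (@eq_shuffle_sum _ _ _ (fun _ _ => 0)) ?shuffle_sum0 ?addr0 // => v w _.
by rewrite /= !mulr0.
Qed.

(** A function as a 0-vector; [bm (fone f)] is f times the standard volume form. *)
Definition fone f : mvfield dot := fun s => f s *: one.

Lemma fone_kvector f : smooth f -> kvector 0 (fone f).
Proof.
move=> fS; apply/kvectorP; split.
- by move=> s [|p u] // _; rewrite /fone fctE scaler0.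
- by move=> s; apply: AltZ; apply: Alt_one.
- by move=> s; rewrite /fone contractZ contract_one; apply: scaler0.
- by apply: smoothFM => //; apply: smoothF_cst.
Qed.

Lemma fder_fone v f s : smooth f -> fder v (fone f) s = sder v f s *: one.
Proof.
move=> fS; rewrite /fone (@fderM _ _ _ _ v f (fun=> one)) //; last exact: smoothF_cst.
rewrite (_ : fder v (fun=> one) s = 0) ?scaler0 ?add0r //.
by apply/funext => u; apply: sder_cst.
Qed.

Lemma lied_fone X f s : smooth f -> lied X (fone f) s = sder (X s) f s *: one.
Proof.
move=> fS; rewrite /lied fder_fone // big1 ?subr0 // => j _.
by rewrite /fone contractZ contract_one [f s *: _]scaler0 ext0.
Qed.

Lemma bm_fone f s : bm (fone f) s = f s *: hod (es s one).
Proof. by rewrite /bm /fone esZ hodZ. Qed.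

Lemma slie_fone X f s : smoothV X -> (forall s, sflat s (X s) = 0) -> smooth f ->
  slie X (bm (fone f)) s = (sder (X s) f s + divg X s * f s) *: hod (es s one).
Proof.
move=> XS Xt fS; rewrite slie_bm //; last exact: (kvector_tmv (fone_kvector fS)).
by rewrite lied_fone // /fone scalerA -scalerDl esZ hodZ.
Qed.

(** [cobm nu] has degree 0, so it is a function, and a zero of it would be a zero of [nu]. *)
Lemma volume_formE nu : volume_form (n%:Z - 1) nu ->
  exists f, [/\ smooth f, forall s, f s != 0 & nu = bm (fone f)].
Proof.
move=> [nuF nu0]; have := cobm_kvector nuF; rewrite subrr => hk.
have /kvectorP[h0 hA ht hS] := hk; have /kformP[_ nuA nut _] := nuF.
have hE : cobm nu = fone (fun s => cobm nu s [::]).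
  apply/funext => s; apply/funext => -[|p u]; last first.
    by rewrite h0 // /fone fctE scaler0.
  by rewrite /fone fctE [RHS]mulr1.
have nuE := cobmK nuA nut; rewrite hE in nuE.
exists (fun s => cobm nu s [::]); split=> // s; apply/eqP => f0.
have [u] := nu0 s; rewrite -nuE bm_fone f0 scale0r.
by rewrite eqxx.
Qed.

Lemma volume_form_exists : exists nu : dfield dot, volume_form (n%:Z - 1) nu.
Proof.
have oS : smooth (fun _ : sphere dot => 1) := smooth_cst dot 1.
have ok := fone_kvector oS; exists (bm (fone (fun=> 1))); split.
  by have := bm_kform ok; rewrite subr0.
move=> s; apply: contrapT => nz.
have /kvectorP[_ oA ot _] := ok.
have b0 : bm (fone (fun=> 1)) s = 0.
  apply/funext => u; apply: contrapT => bu; apply: nz; exists u.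
  exact/eqP.
have := congr1 (fun P : mvfield dot => P s [::]) (bmK oA ot).
rewrite /cobm b0 [cohod 0]linear0 /fone fctE => /esym/eqP.
by rewrite [_ *: _]mulr1 oner_eq0.
Qed.

Lemma smooth_contract_df f (u : seq covec) : smooth f ->
  smooth (fun s => contract (sdfun f s) (L s) u).
Proof.
case: Lt => LA _ LS fS.
rewrite (_ : (fun s => _) = fun s => \sum_i sder (bvec i) f s * L s (bcov i :: u)).
  apply: smooth_sum => i; apply: smoothM; last exact: LS.
  exact: smooth_sder.
apply/funext => s; rewrite sdfun_sum // contract_suml // fct_sumE.
by apply: eq_bigr => i _; rewrite contractZl.
Qed.

Definition hamv f s : g := bisharp (L s) (sdfun f s).

Lemma hamvE f s (q : covec) : q (hamv f s) = L s [:: sdfun f s; q].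
Proof.
case: Lt => LA _ _; rewrite /hamv /bisharp vec_ofE //.
exact: Alt_contract.
Qed.

Lemma smoothV_hamv f : smooth f -> smoothV (hamv f).
Proof.
move=> fS q; rewrite (_ : (fun s => _) = fun s => contract (sdfun f s) (L s) [:: q]).
  exact: smooth_contract_df.
by apply/funext => s; rewrite hamvE.
Qed.

Lemma hamv_tangent f s : sflat s (hamv f s) = 0.
Proof.
case: Lt => LA Lt0 _; rewrite hamvE (Alt_swap2 _ _ (LA s)).
by rewrite -[X in - X]/(contract (sflat s) (L s) [:: _]) Lt0 oppr0.
Qed.

(* The second derivatives of [f] enter through their commutator only, by the
   antisymmetry of [L]. *)
Lemma divg_hamv f s : smooth f -> divg (hamv f) s = (n%:R - 1) * E s [:: sdfun f s].
Proof.
case: (Lt) => LA Lt0 LS fS.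
have fi i := smooth_sder (bvec i) fS.
have step j : bcov j (vder (bvec j) (hamv f) s) =
    \sum_i (sder (bvec i) f s * fder (bvec j) L s [:: bcov i; bcov j]
          + L s [:: bcov i; bcov j] * sder (bvec j) (sder (bvec i) f) s).
  rewrite cov_vder; last exact: smoothV_hamv.
  rewrite (_ : (fun s => _) = fun s => \sum_i sder (bvec i) f s * L s [:: bcov i; bcov j]).
    rewrite sder_sum => [|i]; last by apply: smoothM; [exact: fi|exact: LS].
    apply: eq_bigr => i _; rewrite sderM; [|exact: fi|exact: LS].
    by [].
  apply/funext => t; rewrite hamvE -[LHS]/(contract _ (L t) [:: bcov j]).
  rewrite sdfun_sum // contract_suml // fct_sumE.
  by apply: eq_bigr => i _; rewrite contractZl.
rewrite /divg; under eq_bigr => j _ do rewrite step big_split /=.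
rewrite big_split /=.
have -> : \sum_j \sum_i sder (bvec i) f s * fder (bvec j) L s [:: bcov i; bcov j]
    = (n%:R - 1) * E s [:: sdfun f s].
  rewrite exchange_big /=.
  have EA : Alt (E s) by case: Et.
  rewrite sdfun_sum // -[E s _]/(contract _ (E s) [::]) contract_suml // fct_sumE mulr_sumr.
  apply: eq_bigr => i _; rewrite contractZl //= fctE scale_regE /contract.
  rewrite -mulr_sumr mulrCA -[X in _ = _ * X]opprK -divL -sumrN; congr (_ * _).
  apply: eq_bigr => j _; apply: (Alt_swap2 _ _ (Alt_fder (bvec j) s LS LA)).
set T := \sum_j \sum_i _; suff -> : T = 0 by rewrite addr0.
have TE : T = - \sum_i \sum_j L s [:: bcov i; bcov j] * sder (bvec i) (sder (bvec j) f) s.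
  rewrite /T -sumrN; apply: eq_bigr => j _; rewrite -sumrN; apply: eq_bigr => i _.
  by rewrite (Alt_swap2 _ _ (LA s)) mulNr.
(* By [sderC] the commutator is of first order, and each of its terms puts the conormal covector
   into a slot of L, where L vanishes by tangency. *)
have T2 : T + T = \sum_j \sum_i L s [:: bcov i; bcov j] *
    (dot (val s) (bvec j) * sder (bvec i) f s - dot (val s) (bvec i) * sder (bvec j) f s).
  rewrite {2}TE exchange_big /= -sumrB; apply: eq_bigr => j _.
  rewrite -sumrB; apply: eq_bigr => i _.
  by rewrite -mulrBr sderC.
have z1 i : \sum_j dot (val s) (bvec j) * L s [:: bcov i; bcov j] = 0.
  transitivity (L s [:: bcov i; sflat s]).
    rewrite -[RHS]/(contract (bcov i) (L s) [:: sflat s]).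
    rewrite (Alt_one_basis (pr := @pair R g) bcov_sum (sflat s) (Alt_contract (bcov i) (LA s))).
    by apply: eq_bigr => j _; rewrite /pair flatE.
  rewrite (Alt_swap2 _ _ (LA s)) -[X in - X]/(contract (sflat s) (L s) [:: _]) Lt0.
  by rewrite oppr0.
have : T + T = 0.
  rewrite T2; under eq_bigr => j _.
    under eq_bigr => i _ do rewrite mulrBr.
    rewrite sumrB; over.
  rewrite sumrB exchange_big /= !big1 ?subr0 // => [i _|i _].
    transitivity (- sder (bvec i) f s *
       \sum_j dot (val s) (bvec j) * L s [:: bcov i; bcov j]).
      rewrite mulr_sumr; apply: eq_bigr => j _.
      by rewrite (Alt_swap2 _ _ (LA s)); ring.
    by rewrite z1 mulr0.
  transitivity (sder (bvec i) f s *
     \sum_j dot (val s) (bvec j) * L s [:: bcov i; bcov j]).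
    by rewrite mulr_sumr; apply: eq_bigr => j _; ring.
  by rewrite z1 mulr0.
by move=> TT; lra.
Qed.

Lemma sbracket_fone f s : smooth f ->
  sbracket L (fone f) s = contract (sdfun f s) (L s).
Proof.
case: (Lt) => LA Lt0 LS fS; have [oA ot oS] := kvector_tmv (fone_kvector fS).
rewrite (sbracketE s L2) // sqrrN expr1n scale1r [X in _ + X]big1 ?addr0; last first.
  by move=> i _; rewrite /fone contractZ contract_one [f s *: _]scaler0 wedge0r.
rewrite sdfun_sum // contract_suml //; apply: eq_bigr => i _.
by rewrite contractZl // fder_fone // wedgeZr wedge_one.
Qed.

Lemma smooth_contract_df_kvector f h : smooth f -> smooth h ->
  kvector 1 (fun s => h s *: contract (sdfun f s) (L s)).
Proof.
case: (Lt) => LA Lt0 LS fS hS; apply/kvectorP; split.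
- move=> s u u1.
  have u2 : size (sdfun f s :: u) != 2%N by apply: contra_neq u1 => -[->].
  by rewrite -[LHS]/(h s *: L s (sdfun f s :: u)) L2 // scaler0.
- by move=> s; apply: AltZ; apply: Alt_contract.
- move=> s; rewrite contractZ contractC // Lt0 contract0 oppr0.
  exact: scaler0.
- by move=> u; apply: smoothM => //; apply: smooth_contract_df.
Qed.

Lemma E_kvector : kvector 1 E.
Proof.
case: Et => EA Et0 ES; by apply/kvectorP; split.
Qed.

Lemma unimodular_of_divergence_free : jacobi_structure L E ->
  unimodular_jacobi L E (n%:Z - 1).
Proof.
move=> J; split=> //; first exact: volume_form_exists.
move=> nu /volume_formE[f [fS f0 ->]].
have fVS := smooth_inv fS f0; have ffS := smoothM fS fS.
have ff0 s : 0 < f s * f s by rewrite -expr2 lt_def sqrf_eq0 f0 sqr_ge0.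
have lS := smooth_ln ffS ff0.
(* This is ln |f| in a form that is smooth whatever the sign of [f], which may differ between the
   two points of S^0. *)
pose ph s := 2^-1 * ln (f s * f s).
have phS : smooth ph := smoothZ 2^-1 lS.
have dph v s : sder v ph s = (f s)^-1 * sder v f s.
  rewrite /ph sderZ // (sder_ln _ _ ffS ff0) sderM //; field; exact: f0.
pose hE := fone (fun s => sder (evec E s) ph s).
have eS : smooth (fun s => sder (evec E s) ph s).
  rewrite (_ : (fun s => _) = fun s => \sum_i bcov i (evec E s) * sder (bvec i) ph s).
    apply: smooth_sum => i; apply: smoothM; last exact: smooth_sder.
    exact: smoothV_evec.
  by apply/funext => s; apply: (linp_basis (evec E s) (sder_linv s phS)).
(* For nu = f nu_0, the Lie derivative along #(dh) has coefficient #(dh)(f) + f div #(dh) on nu_0.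
   Dividing by f, with #(dh)(f) = - Lambda(df, dh) and [divg_hamv] for the divergence, gives X. *)
pose X : mvfield dot := (n%:R - 1 : R) *: E +
  (fun s => - (f s)^-1 *: contract (sdfun f s) (L s)).
have XE : X - E *~ (n%:Z - 1) = fun s => - (f s)^-1 *: contract (sdfun f s) (L s).
  rewrite /X addrAC (_ : E *~ (n%:Z - 1) = (n%:R - 1 : R) *: E) ?subrr ?add0r //.
  by rewrite -scaler_int; congr (_ *: _); rewrite rmorphB /= -pmulrn.
have X1 : kvector 1 X.
  apply: kvector_lin; first exact: E_kvector.
  by apply: smooth_contract_df_kvector => //; apply: smoothN.
exists X, hE; split.
- split=> // h hS; apply/funext => s; apply/funext => u.
  rewrite -/(hamv h) (slie_fone s (smoothV_hamv hS) (hamv_tangent h) fS).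
  rewrite -sdfunE // hamvE divg_hamv // bm_fone.
  have LA : Alt (L s) by case: Lt.
  rewrite (Alt_swap2 _ _ LA).
  rewrite -[X s _]/((n%:R - 1) * E s [:: sdfun h s]
    + - (f s)^-1 * L s [:: sdfun f s; sdfun h s] : R).
  rewrite !fctE !scale_regE.
  move: (L s _ : R) (E s _ : R) (hod _ u : R) (f0 s) => x y z.
  move: (f s) => r r0; field.
  exact: r0.
- split; first exact: fone_kvector.
  apply/funext => s; apply/funext => u.
  rewrite (slie_fone s (smoothV_evec Et) (evec_tangent Et) fS) divE mul0r addr0.
  rewrite bm_fone /hE /fone !fctE dph !scale_regE [one _]/=.
  move: (sder _ _ _) (hod _ u : R) (f0 s) => y z.
  move: (f s) => r r0; field.
  exact: r0.
(* A cochain of degree 0 has its second component in degree -1, hence 0; sigma sends it to (-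
   [Lambda, ph], [E, ph]). *)
exists (fone ph, 0).
  by split; [exact: fone_kvector|exact: kvector0].
have t0 : tmv (0 : mvfield dot) by exact: (kvector_tmv (kvector0 dot 0)).
have sb0 (j : nat) (P : mvfield dot) : (forall s u, size u != j -> P s u = 0) ->
    tmv P -> sbracket P 0 = 0.
  move=> Pj Pt; have := sbracketP (-1) Pj Pt t0 t0.
  by rewrite scaler0 addr0 scaleN1r addNr.
rewrite subrr; apply: injective_projections => /=; apply/funext => s.
  rewrite XE mulr0z addr0.
  rewrite -[LHS]/(- sbracket L (fone ph) s + wedge (L s) 0) wedge0r addr0.
  rewrite sbracket_fone // scaleNr; congr (- _).
  have -> : sdfun ph s = (f s)^-1 *: sdfun f s.
    by apply/lfunP => v; rewrite scale_lfunE !sdfunE // dph.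
  by rewrite contractZl //; case: Lt.
rewrite (sb0 _ _ L2 Lt) sub0r.
rewrite -[LHS]/((- (swedge E 0 *~ (0 - 1))) s + sbracket E (fone ph) s).
have -> : swedge E 0 = 0 by apply/funext => t; apply: wedge0r.
rewrite mul0rz oppr0 add0r.
have [oA _ oS] := kvector_tmv (fone_kvector phS).
by rewrite (sbracket_E E1) // lied_fone.
Qed.

End Unimodular.

Theorem theorem4p33 (R : realType) (n : nat) (g : vectType R)
    (br : {bilinear g -> g -> g}) (dot : {dot g for idfun}) :
  \dim {:g} = n -> lie_bracket br -> unimodular_lie br ->
  unimodular_jacobi (sphere_L br dot) (sphere_E br dot) (n%:Z - 1) /\
  forall k : int,
    linear_iso (LJ_cycle (sphere_L br dot) (sphere_E br dot) k)
               (LJ_boundary (sphere_L br dot) (sphere_E br dot) k)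
               (LJ_cocycle (sphere_L br dot) (sphere_E br dot) (n%:Z - k))
               (LJ_coboundary (sphere_L br dot) (sphere_E br dot) (n%:Z - k)).
Proof.
move=> <- brLie brU.
have L2 := @L_deg R g br dot; have E1 := @E_deg R g br dot.
have Lt := tmv_L dot brLie; have Et := tmv_E dot brLie.
have divL := @sphere_divL R g br dot brLie brU.
have divE := @sphere_divE R g br dot brLie brU.
split; first exact: (unimodular_of_divergence_free L2 E1 Lt Et divL divE
  (sphere_jacobi dot brLie)).
by move=> k; apply: (LJ_duality L2 E1 Lt Et divL divE).
Qed.
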